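(* Let $(\mathbb{T}_n)_{n\ge1}$ be the binary search tree and $h_n$ the saturation level of $\mathbb{T}_n$. Let $\alpha>0$ be the unique positive solution of $2(\alpha+1)e^{-\alpha}-1=0$ and let $\beta:=2\alpha e^{-\alpha}$ (numerically $\alpha\approx1.6783$, $\beta\approx0.6266$). Then, almost surely, \[\frac12=\liminf_{n\to\infty}\frac{\alpha h_n-\beta\log n}{\log\log n}<\limsup_{n\to\infty}\frac{\alpha h_n-\beta\log n}{\log\log n}=\frac32,\] and \[\frac{\alpha h_n-\beta\log n}{\log\log n}\xrightarrow{\ \mathbb{P}\ }\frac32\quad\text{as } n\to\infty.\]
   Context: Let $\mathbb{T}$ be the complete rooted binary tree. The binary search tree is the random sequence of subtrees $(\mathbb{T}_n)_{n\ge1}$ defined recursively: $\mathbb{T}_1$ consists only of the root; given $\mathbb{T}_n$, a leaf $u$ of $\mathbb{T}_n$ is chosen uniformly at random among all leaves of $\mathbb{T}_n$, and $\mathbb{T}_{n+1}$ is $\mathbb{T}_n$ together with the two children of $u$. The generation of a node is its distance from the root (the root has generation $0$). The saturation level $h_n$ is the greatest $k$ such that all $2^k$ nodes of $\mathbb{T}$ of generation $k$ belong to $\mathbb{T}_n$. *)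

(* Defs.v *)
From HB Require Import structures.
From mathcomp Require Import all_boot all_order all_algebra.
From mathcomp Require Import all_classical all_reals all_analysis.
Set Implicit Arguments. Unset Strict Implicit. Unset Printing Implicit Defensive.
Import Order.TTheory GRing.Theory Num.Theory.
Local Open Scope ring_scope.
Local Open Scope classical_set_scope.

(* Nodes of the complete rooted binary tree: finite words over bool,
   [::] is the root; the children of u are rcons u false and rcons u true.
   The generation of u is size u. *)
Definition node := seq bool.

Definition tree_of (us : seq node) : seq node :=
  foldl (fun t u => t ++ [:: rcons u false; rcons u true]) [:: [::]] us.

Definition is_leaf (t : seq node) (u : node) : bool :=
  (u \in t) && (rcons u false \notin t) && (rcons u true \notin t).

Definition nleaves (t : seq node) : nat := count (is_leaf t) (undup t).

(* Probability that the first n leaf choices are us = [:: u_1; ...; u_n]: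
   at step i the leaf u_{i+1} is uniform among the leaves of the current tree. *)
Definition bst_path_prob (R : realType) (us : seq node) : R :=
  \prod_(i < size us)
     (if is_leaf (tree_of (take i us)) (nth [::] us i)
      then (nleaves (tree_of (take i us)))%:R^-1 else 0).

(* The law of the binary search tree: U i is the leaf split at step i+1
   (going from T_{i+1} to T_{i+2}); the finite dimensional distributions of
   the leaf choices are those of the uniform-leaf recursion. *)
Definition is_bst_process d (T : measurableType d) (R : realType)
    (P : probability T R) (U : nat -> T -> node) : Prop :=
  (forall i (u : node), measurable [set w | U i w = u]) /\
  (forall us : seq node,
     P [set w | forall i, (i < size us)%N -> U i w = nth [::] us i]
       = (bst_path_prob R us)%:E).

Definition bst_tree T (U : nat -> T -> node) (n : nat) (w : T) : seq node :=
  tree_of [seq U i w | i <- iota 0 n.-1].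

Definition saturated (k : nat) (t : seq node) : bool :=
  [forall u : k.-tuple bool, (val u : node) \in t].

(* saturation level: the greatest k such that generation k is saturated
   (generation 0 always is for a tree containing the root; any saturated k
    satisfies 2^k <= size t, so k <= size t and the bound is harmless). *)
Definition sat_level (t : seq node) : nat :=
  \max_(k < (size t).+1 | saturated k t) k.

(* Main.v *)
(* Write V_n = alpha h_n - beta ln n, so that h_n < k means that some leaf has generation
   less than k. Each leaf splits with probability 1/n at time n, and the mean number of leaves
   of generation i solves a linear recursion in (n, i). In the frame X = x + i y - ln n this
   recursion has almost explicit solutions built from the Abel polynomials X (X + l y)^(l-1) / l!,
   which vanish on the barrier X = 0. The resulting supersolution bounds the number of slow
   leaves that never cross a barrier of slope y = 1 + alpha, and gives
   P(V_n <= a ln ln n) <= C (ln n)^(a - 3/2 + o(1)).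
   Conversely, a second moment argument with a barrier of slope slightly below 1 + alpha bounds
   from below the probability that level K is saturated late: by a constant at the 3/2 barrier,
   and by (M / K)^2 if one only asks for some level J in [K, K + M] at the 1/2 barrier. Since the
   product over the leaves of their probabilities of never being late is a supermartingale, the
   2^m subtrees at a generation m of order ln K amplify this to a probability close to 1.
   Borel-Cantelli along n = 2^j and monotonicity of h_n give the liminf >= 1/2 and
   limsup <= 3/2; the windows M = K / ln K give liminf <= 1/2. *)
Require Import Defs.
From HB Require Import structures.
From mathcomp Require Import all_boot all_order all_algebra.
From mathcomp Require Import all_classical all_reals all_analysis.
From mathcomp Require Import zify ring lra.
Import Order.TTheory GRing.Theory Num.Theory.
Import numFieldNormedType.Exports.
Local Open Scope ring_scope.
Local Open Scope classical_set_scope.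
Import Defs.
Set Implicit Arguments. Unset Strict Implicit. Unset Printing Implicit Defensive.

(** * Abel polynomials *)

(** At slope y = 1 + alpha the exponential growth of the counts cancels, and vanishing at the
    barrier turns the decay l^(-1/2) of a free count into l^(-3/2). A free count loses this factor
    because its mean is carried by rare trees in which some ancestor was exceptionally slow. The
    resulting bound (ln n)^(a - 3/2) tends to 0 for a < 3/2 and, along n = 2^j, where ln n is of
    order j, is summable for a < 1/2: one estimate yields both constants. Conversely, lowering the
    slope by a factor 1 - eps multiplies a count over K generations by K^(b/2); b = 3 makes the
    expected number of late leaves of order 1, while b = 1 leaves 1 / K per level, which a window of
    M levels turns into M / K. In continuous time s = ln n the Abel solutions are exact. The
    discrete clock advances by something between 1 / (n + 1) and 1 / n, so each of them is only a
    supersolution or a subsolution; the shifts n - 1, n - 2 and x0 + 1 select the side. *)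

Lemma mulr_cancel_fact (R : fieldType) (c F r a : R) : c != 0 -> F != 0 ->
  r * (a / F) = c * r * a / (c * F).
Proof. by move=> c0 F0; field; rewrite c0 F0. Qed.

Section Abel.
Variable R : realFieldType.
Implicit Types (x y r B : R) (l m n : nat).

(* Abel polynomials, normalised so that d/dx abel y l.+1 x = abel y l (x + y). *)
Definition abel y l x : R :=
  if l is l'.+1 then x * (x + l%:R * y) ^+ l' / l`!%:R else 1.

Lemma bernoulliD B r m : 0 <= B -> 0 <= r ->
  B ^+ m.+1 + m.+1%:R * r * B ^+ m <= (B + r) ^+ m.+1.
Proof.
move=> B0 r0; elim: m => [|m IH]; first by rewrite expr0 !expr1; lra.
have := ler_wpM2l (addr_ge0 B0 r0) IH; rewrite -exprS; apply: le_trans.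
rewrite -subr_ge0 [X in 0 <= X](_ : _ = m.+1%:R * r ^+ 2 * B ^+ m).
  by rewrite !mulr_ge0 ?exprn_ge0.
by rewrite -[m.+2%:R]natr1 !exprS; ring.
Qed.

Lemma bernoulliB B r m : 0 <= r -> r <= B ->
  B ^+ m.+1 - m.+1%:R * r * B ^+ m <= (B - r) ^+ m.+1.
Proof.
move=> r0 rB; elim: m => [|m IH]; first by rewrite expr0 !expr1; lra.
have Br : 0 <= B - r by lra.
have := ler_wpM2l Br IH; rewrite -exprS; apply: le_trans.
rewrite -subr_ge0 [X in 0 <= X](_ : _ = m.+1%:R * r ^+ 2 * B ^+ m).
  by rewrite !mulr_ge0 ?exprn_ge0 //; lra.
by rewrite -[m.+2%:R]natr1 !exprS; ring.
Qed.

Lemma abel_ge0 y l x : 0 <= y -> 0 <= x -> 0 <= abel y l x.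
Proof.
by move=> y0 x0; case: l => [|l] //=; rewrite !mulr_ge0 ?exprn_ge0 ?addr_ge0 ?mulr_ge0.
Qed.

(** Convexity: the tangent at x - r, whose slope is [abel y l (x - r + y)], stays below the graph to
    its right. *)
Lemma abel_super y l x r : 0 <= y -> 0 <= r -> r <= x ->
  abel y l.+1 (x - r) + r * abel y l (x - r + y) <= abel y l.+1 x.
Proof.
move=> y0 r0 rx; case: l => [|m] /=.
  by rewrite ?expr0 ?mulr1 ?factS ?fact0 ?muln1 ?divr1; lra.
set B := x - r + m.+2%:R * y.
have -> : x - r + y + m.+1%:R * y = B.
  by rewrite /B -[m.+2%:R]natr1; ring.
have -> : x + m.+2%:R * y = B + r by rewrite /B; ring.
have B0 : 0 <= B by rewrite addr_ge0 ?mulr_ge0 // subr_ge0.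
rewrite (factS m.+1) natrM.
have f0 : (m.+1)`!%:R != 0 :> R by rewrite pnatr_eq0 -lt0n fact_gt0.
have m0 : m.+2%:R != 0 :> R by rewrite pnatr_eq0.
have -> : r * ((x - r + y) * B ^+ m / (m.+1)`!%:R) =
   (m.+2%:R * r * (x - r + y) * B ^+ m) / (m.+2%:R * (m.+1)`!%:R).
  by rewrite (mulr_cancel_fact _ _ m0 f0) !mulrA.
rewrite -mulrDl ler_wpM2r ?invr_ge0 ?mulr_ge0 //.
apply: le_trans (ler_wpM2l (le_trans r0 rx) (bernoulliD m B0 r0)).
rewrite -subr_ge0 [X in 0 <= X](_ : _ = m.+1%:R * r ^+ 2 * B ^+ m).
  by rewrite !mulr_ge0 ?exprn_ge0.
rewrite (_ : m.+2%:R * r * (x - r + y) = r * (m.+2%:R * (x - r + y))); last by ring.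
by rewrite (_ : _ * (x - r + y) = B + m.+1%:R * (x - r)) ?exprS /B -[m.+2%:R]natr1; ring.
Qed.

(* The continuous identity abel' (l+1) x = abel l (x+y) is discretised from the
   other side; the shift by r costs a factor (1 - r/2)^2 >= 1 - r as y >= 2. *)
Lemma abel_shift y l x r : 2 <= y -> 0 <= r -> r <= 1 -> y <= x ->
  (1 - r) * abel y l x <= abel y l (x - r).
Proof.
move=> y2 r0 r1 yx; case: l => [|m] /=; first by rewrite mulr1; lra.
rewrite mulrA ler_wpM2r ?invr_ge0 //.
set B := x + m.+1%:R * y; have -> : x - r + m.+1%:R * y = B - r by rewrite /B; ring.
have m1 : 1 <= m.+1%:R :> R by rewrite ler1n.
have By : m.+1%:R * y <= B by rewrite /B; lra.
have Br : r <= B by rewrite /B; nra.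
have B0 : 0 <= B by lra.
case: m => [|m] in m1 B By Br B0 *; first by rewrite !expr0; nra.
have h1 : (1 - r / 2) * x <= x - r by nra.
have h2 : (1 - r / 2) * B ^+ m.+1 <= (B - r) ^+ m.+1.
  apply: le_trans (bernoulliB m r0 Br).
  rewrite [B ^+ m.+1]exprS; have Bm : 0 <= B ^+ m by rewrite exprn_ge0.
  have : m.+1%:R * 2 <= B.
    apply: le_trans By; have : m.+1%:R <= m.+2%:R :> R by rewrite ler_nat.
    have : 0 <= m.+1%:R :> R by [].
    nra.
  move=> h; have : 0 <= r * (B / 2 - m.+1%:R) * B ^+ m.
    by rewrite !mulr_ge0 //; lra.
  lra.
have p0 : 0 <= (1 - r / 2) * x by nra.
have q0 : 0 <= (1 - r / 2) * B ^+ m.+1 by rewrite mulr_ge0 ?exprn_ge0 //; lra.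
apply: le_trans (ler_pM p0 q0 h1 h2).
have : 0 <= x * B ^+ m.+1 by rewrite mulr_ge0 ?exprn_ge0 //; lra.
by nra.
Qed.

(** The tangent at x, followed to the left. If the step r reaches past 0, its linear term alone
    suffices, because [abel y l.+1] vanishes at 0. *)
Lemma abel_sub_aux y l x r : 0 <= y -> 0 <= r -> 0 <= x ->
  abel y l.+1 x <= (if r < x then abel y l.+1 (x - r) else 0) + r * abel y l (x + y).
Proof.
move=> y0 r0 x0; case: l => [|m] /=.
  by rewrite ?expr0 ?mulr1 ?factS ?fact0 ?muln1 ?divr1; case: ifP; lra.
set B := x + m.+2%:R * y.
have -> : x + y + m.+1%:R * y = B by rewrite /B -[m.+2%:R]natr1; ring.
have -> : x - r + m.+2%:R * y = B - r by rewrite /B; ring.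
have xB : x <= B by rewrite lerDl mulr_ge0.
have B0 : 0 <= B by lra.
rewrite (factS m.+1) natrM.
have f0 : (m.+1)`!%:R != 0 :> R by rewrite pnatr_eq0 -lt0n fact_gt0.
have m0 : m.+2%:R != 0 :> R by rewrite pnatr_eq0.
have -> : r * ((x + y) * B ^+ m / (m.+1)`!%:R) =
   (m.+2%:R * r * (x + y) * B ^+ m) / (m.+2%:R * (m.+1)`!%:R).
  by rewrite (mulr_cancel_fact _ _ m0 f0) !mulrA.
have Bm : 0 <= B ^+ m by rewrite exprn_ge0.
have eB : m.+2%:R * (x + y) = B + m.+1%:R * x.
  by rewrite /B -[m.+2%:R]natr1; ring.
case: ltP => rx.
- rewrite -mulrDl ler_wpM2r ?invr_ge0 ?mulr_ge0 //.
  have xr : 0 <= x - r by lra.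
  have rB : r <= B by lra.
  have := ler_wpM2l xr (bernoulliB m r0 rB).
  rewrite (_ : m.+2%:R * r * (x + y) = r * (m.+2%:R * (x + y))); last by ring.
  rewrite eB exprS.
  have : 0 <= m.+1%:R * r ^+ 2 * B ^+ m by rewrite !mulr_ge0 ?exprn_ge0.
  by nra.
- rewrite add0r ler_wpM2r ?invr_ge0 ?mulr_ge0 //.
  rewrite (_ : m.+2%:R * r * (x + y) = r * (m.+2%:R * (x + y))); last by ring.
  rewrite eB exprS mulrA ler_wpM2r //.
  have : 0 <= m.+1%:R * x by rewrite mulr_ge0.
  by nra.
Qed.

(** Moves the slope from x + y to x - r + y, where the recursion evaluates it. The price 1 / (1 - r)
    comes from [abel_shift] and is absorbed in r'. *)
Lemma abel_sub y l x r r' : 2 <= y -> 0 <= r -> r <= 1 -> r <= r' * (1 - r) -> 0 <= x ->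
  abel y l.+1 x <=
    (if r < x then abel y l.+1 (x - r) else 0) + r' * abel y l (x - r + y).
Proof.
move=> y2 r0 r1 rr' x0.
have y0 : 0 <= y by lra.
apply: le_trans (abel_sub_aux l y0 r0 x0) _; rewrite lerD2l.
have yx : y <= x + y by lra.
have := abel_shift l y2 r0 r1 yx.
rewrite (_ : x + y - r = x - r + y); last by ring.
have := abel_ge0 l y0 (addr_ge0 x0 y0).
have := @abel_ge0 y l (x - r + y) y0.
set A := abel y l (x + y); set A' := abel y l (x - r + y).
move=> A'0 A0 h.
have : 0 <= A' by apply: A'0; lra.
move=> {}A'0.
have [r1'|r1'] := ltP r 1; last first.
  by move: rr'; rewrite (_ : r = 1) ?subrr ?mulr0; lra.
have r'0 : 0 <= r' by nra.
apply: le_trans (ler_wpM2l r'0 h); rewrite mulrA; exact: ler_wpM2r.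
Qed.
End Abel.

(** * Stirling bounds *)

Section LnBounds.
Variable R : realType.
Implicit Types (x t v : R).

Lemma ge0_derive_ge0 (F dF : R -> R) v : 1 <= v -> F 1 = 0 ->
  (forall x, 1 <= x -> is_derive x 1 F (dF x)) ->
  (forall x, 1 <= x -> 0 <= dF x) -> 0 <= F v.
Proof.
move=> v1 F1 dF1 dF0.
have [||c /[!in_itv]/= /andP[c1 cv]] := @MVT_segment R F dF 1 v v1.
- by move=> x /[!in_itv]/= /andP[x1 _]; exact/dF1/ltW.
- apply: derivable_within_continuous => z /[!in_itv]/= /andP[z1 _].
  by have [] := dF1 z z1.
- rewrite F1 subr0 => ->; rewrite mulr_ge0 ?dF0 // subr_ge0 //.
Qed.

(** At t = 1 / x this reads (x + 1/2) ln (1 + 1 / x) >= 1, which is exactly what makes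
    [stirling_err] nondecreasing. *)
Lemma ln_ge_pade t : 0 <= t -> 2 * t / (2 + t) <= ln (1 + t).
Proof.
move=> t0; pose F v := ln v - 2 + 4 * (v + 1)^-1 : R.
have -> : 2 * t / (2 + t) = 2 - 4 * (1 + t + 1)^-1 by field; do ?[apply/andP; split]; lra.
suff : 0 <= F (1 + t) by rewrite /F; lra.
apply: (@ge0_derive_ge0 F (fun v => v^-1 + 4 * (- (v + 1) ^- 2))).
- lra.
- by rewrite /F ln1 (_ : (1 + 1 : R)^-1 = 2^-1) //; lra.
- move=> x x1; rewrite /F.
  have x0 : 0 < x by lra.
  have xn : x + 1 != 0 by lra.
  have h1 := is_derive1_ln x0.
  by apply: is_derive_eq; rewrite subr0 addr0 /GRing.scale /= mulr1.
- move=> x x1; rewrite -subr_ge0 subr0.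
  have x0 : 0 < x by lra.
  have -> : x^-1 + 4 * - (x + 1) ^- 2 = (x - 1) ^+ 2 / (x * (x + 1) ^+ 2).
    by field; do ?[apply/andP; split]; rewrite ?gt_eqF //; lra.
  by rewrite divr_ge0 ?sqr_ge0 // mulr_ge0 ?sqr_ge0 ?ltW.
Qed.

(** The trapezoid rule for the convex function 1 / v on [1, 1 + t]. At t = 1 / x its error becomes a
    telescoping difference. *)
Lemma ln_le_trapezoid t : 0 <= t -> ln (1 + t) <= t * (2 + t) / (2 * (1 + t)).
Proof.
move=> t0; pose F v := (v - v^-1) / 2 - ln v : R.
have -> : t * (2 + t) / (2 * (1 + t)) = ((1 + t) - (1 + t)^-1) / 2.
  by field; do ?[apply/andP; split]; lra.
suff : 0 <= F (1 + t) by rewrite /F; lra.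
apply: (@ge0_derive_ge0 F (fun v => (1 + v ^- 2) / 2 - v^-1)).
- lra.
- by rewrite /F ln1 invr1; lra.
- move=> x x1; rewrite /F.
  have x0 : 0 < x by lra.
  have xn : x != 0 by lra.
  have h1 := is_derive1_ln x0; have h2 : is_derive x 1 (fun v : R => v^-1) (- x ^- 2).
    have h := @is_deriveV R id x 1 1 xn (is_derive_id _ _).
 by apply: is_derive_eq; rewrite scaler1.
  apply: is_derive_eq.
 rewrite /GRing.scale /=.
  by field.
- move=> x x1; have x0 : x != 0 by lra.
  have -> : (1 + x ^- 2) / 2 - x^-1 = (1 - x^-1) ^+ 2 / 2 by field.
  by rewrite divr_ge0 ?sqr_ge0.
Qed.

Lemma ln_ge_quadratic t : 0 <= t -> t - t ^+ 2 / 2 <= ln (1 + t).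
Proof.
move=> t0; apply: le_trans (ln_ge_pade t0).
rewrite -subr_ge0.
have -> : 2 * t / (2 + t) - (t - t ^+ 2 / 2) = t ^+ 3 / 2 / (2 + t) by field; lra.
by rewrite !divr_ge0 ?exprn_ge0 //; lra.
Qed.

(* ln of l^(l+1/2) e^(-l) / l! *)
Definition stirling_err (l : nat) : R :=
  l%:R * ln l%:R - l%:R + ln l%:R / 2 - ln l`!%:R.

Lemma stirling_err_step l : (0 < l)%N ->
  0 <= stirling_err l.+1 - stirling_err l <= (l%:R^-1 - l.+1%:R^-1) / 4.
Proof.
move=> l0; set x : R := l%:R.
have x0 : 1 <= x by rewrite /x ler1n.
have xp : 0 < x by lra.
have f0 : 0 < l`!%:R :> R by rewrite ltr0n fact_gt0.
have t0 : 0 <= x^-1 by rewrite invr_ge0; lra.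
have e1 : l.+1%:R = x + 1 :> R by rewrite natr1.
have e2 : ln (l.+1)`!%:R = ln (x + 1) + ln l`!%:R :> R.
  by rewrite factS natrM lnM ?posrE ?e1 //; lra.
have e3 : ln (x + 1) = ln x + ln (1 + x^-1).
  rewrite -lnM ?posrE //; last by lra.
  by congr ln; field; lra.
rewrite /stirling_err e2 e1 -/x e3.
have -> : (x + 1) * (ln x + ln (1 + x^-1)) - (x + 1) + (ln x + ln (1 + x^-1)) / 2 -
  (ln x + ln (1 + x^-1) + ln l`!%:R) - (x * ln x - x + ln x / 2 - ln l`!%:R) =
  (x + 2^-1) * ln (1 + x^-1) - 1 by field.
have c0 : 0 < x + 2^-1 by lra.
apply/andP; split.
- have := ler_wpM2l (ltW c0) (ln_ge_pade t0).
  have -> : (x + 2^-1) * (2 * x^-1 / (2 + x^-1)) = 1.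
    by field; do ?[apply/andP; split]; lra.
  lra.
- have := ler_wpM2l (ltW c0) (ln_le_trapezoid t0).
  have -> : (x + 2^-1) * (x^-1 * (2 + x^-1) / (2 * (1 + x^-1))) =
     1 + (x^-1 - (x + 1)^-1) / 4.
    by field; do ?[apply/andP; split]; lra.
  lra.
Qed.

Lemma stirling_err_bounds l : (0 < l)%N -> -1 <= stirling_err l <= 0.
Proof.
(* [stirling_err 1] is -1, and the increments telescope to less than 1/4. *)
move=> l0; suff : -1 <= stirling_err l <= -1 + (1 - l%:R^-1) / 4.
  have : 0 <= l%:R^-1 :> R by rewrite invr_ge0.
  by move=> ? /andP[-> ?] /=; lra.
elim: l l0 => // -[_ _|l IH _].
  by rewrite /stirling_err !ln1 invr1; lra.
have /andP[h1 h2] := IH isT.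
have /andP[] := stirling_err_step (ltn0Sn l); rewrite -/(stirling_err _).
by move: h1 h2; set u := l.+1%:R^-1; set v := l.+2%:R^-1 => *; apply/andP; split; lra.
Qed.

Definition isq (n : nat) : R := (Num.sqrt n%:R)^-1.

Lemma isq_gt0 n : (0 < n)%N -> 0 < isq n.
Proof. by move=> n0; rewrite invr_gt0 sqrtr_gt0 ltr0n. Qed.

Lemma isq_ge0 n : 0 <= isq n.
Proof. by rewrite invr_ge0 sqrtr_ge0. Qed.

Lemma isq_sqr n : isq n ^+ 2 = n%:R^-1.
Proof. by rewrite exprVn sqr_sqrtr. Qed.

Lemma isqE n : (0 < n)%N -> isq n = expR (- (ln n%:R / 2)).
Proof.
move=> n0; have n0' : 0 < n%:R :> R by rewrite ltr0n.
rewrite expRN; congr (_^-1); apply: (@pexpIrn _ 2) => //; rewrite ?nnegrE ?sqrtr_ge0 ?expR_ge0 //.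
by rewrite sqr_sqrtr ?ltW // -expRM_natr divfK ?pnatr_eq0 // lnK.
Qed.

(** Without the factor 2 ^+ l this is the generalised Poisson weight: the probability that a Poisson
    variable of mean x + l y equals l, times the ballot factor x / (x + l y). *)
Definition ah (y : R) (l : nat) x : R :=
  2 ^+ l * abel y l x * expR (- (x + l%:R * y)).

(* The equation for alpha says that theta (1 + alpha) = 1, so that ah (1 + alpha) l x
   is of order x * l ^ (- 3 / 2). *)
Definition theta (y : R) : R := 2 * y * expR (1 - y).

(** Stirling's formula with all inexactness collected in E. The upper bound on E holds for every x,
    whereas the lower one is useful only for x ^+ 2 of order l. *)
Lemma ahE (y : R) l x : 0 < y -> 0 <= x -> (0 < l)%N -> exists E,
  [/\ -1 - x ^+ 2 / (2 * l%:R * y ^+ 2) <= E, E <= 0 &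
    ah y l x = x / (x + l%:R * y) * (isq l * theta y ^+ l) *
       (expR (- ((1 - y^-1) * x)) * expR E)].
Proof.
move=> y0 x0; case: l => // l _; set n := l.+1.
have n1 : 1 <= n%:R :> R by rewrite ler1n.
have n0 : 0 < n%:R :> R by lra.
have f0 : 0 < n`!%:R :> R by rewrite ltr0n fact_gt0.
have ny : 0 < n%:R * y by rewrite mulr_gt0.
set B := x + n%:R * y.
have B0 : 0 < B by rewrite /B; lra.
pose t := x / (n%:R * y).
have t0 : 0 <= t by rewrite divr_ge0 // ltW.
have t1 : 0 < 1 + t by lra.
have lnB : ln B = ln n%:R + ln y + ln (1 + t).
  rewrite -lnM ?posrE // -lnM ?posrE //; congr ln.
  by rewrite /B /t; field; rewrite ?gt_eqF.
(* Stirling's error, plus the defect of n ln (1 + t) from its linear part n t = x / y. *)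
exists (stirling_err n + (n%:R * ln (1 + t) - x / y)).
have nt : n%:R * t = x / y by rewrite /t; field; rewrite ?gt_eqF.
have /andP[s1 s2] := @stirling_err_bounds n isT; split.
- have := ler_wpM2l (ltW n0) (ln_ge_quadratic t0).
  rewrite mulrBr nt.
  have -> : n%:R * (t ^+ 2 / 2) = x ^+ 2 / (2 * n%:R * y ^+ 2).
    by rewrite /t; field; rewrite ?gt_eqF.
  lra.
- have : ln (1 + t) <= t by apply: le_ln1Dx; lra.
  move/(ler_wpM2l (ltW n0)); rewrite nt; lra.
rewrite -expRD /ah /= -/B -/n.
have -> : x / B * (isq n * theta y ^+ n) * expR (- ((1 - y^-1) * x) +
     (stirling_err n + (n%:R * ln (1 + t) - x / y))) =
   x / B * (2 ^+ n * (B ^+ n / n`!%:R * expR (- B))).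
  rewrite -(@lnK _ (n`!%:R)) // -expRN {1}[B ^+ n](_ : _ = expR (n%:R * ln B)); last first.
    by rewrite expRM_natl lnK.
  have -> : theta y ^+ n = 2 ^+ n * expR (n%:R * (ln y + (1 - y))).
    by rewrite expRM_natl -exprMn expRD lnK // mulrA.
  rewrite isqE //.
  rewrite -!mulrA; congr (_ * _); congr (_ * _).
  rewrite mulrCA; congr (_ * _); rewrite -!expRD; congr expR.
  by rewrite lnB /stirling_err /B; field; rewrite ?gt_eqF.
rewrite (exprS B l : B ^+ n = _).
by move: (B ^+ l) (2 ^+ n) (expR _) => u v w; field; rewrite ?gt_eqF.
Qed.

Lemma isq_le n m : (0 < n)%N -> (n <= m)%N -> isq m <= isq n.
Proof.
move=> n0 nm; rewrite lef_pV2 ?posrE ?sqrtr_gt0 ?ltr0n ?(leq_trans n0) //.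
by rewrite ler_wsqrtr // ler_nat.
Qed.

Lemma isqS_le l : (0 < l)%N -> isq l <= 2 * isq l.+1.
Proof.
move=> l0; rewrite -(@ler_pXn2r _ 2) // ?nnegrE ?mulr_ge0 ?isq_ge0 //.
rewrite exprMn !isq_sqr; have l1 : 1 <= l%:R :> R by rewrite ler1n.
have l2 : l.+1%:R = l%:R + 1 :> R by rewrite natr1.
rewrite l2 -[2 ^+ 2]/(2 * 2) -mulrA; move: (l%:R) l1 => u u1.
rewrite mulrA ler_pdivlMr; last by lra.
by rewrite ler_pdivrMl; lra.
Qed.

Lemma isq1 : isq 1 = 1.
Proof. by rewrite /isq sqrtr1 invr1. Qed.

Lemma theta_ge0 y : 0 <= y -> 0 <= theta y.
Proof. by move=> y0; rewrite !mulr_ge0 ?expR_ge0. Qed.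

Lemma ah_ge0 y l x : 0 <= y -> 0 <= x -> 0 <= ah y l x.
Proof. by move=> y0 x0; rewrite !mulr_ge0 ?expR_ge0 ?exprn_ge0 ?abel_ge0. Qed.

(** The shift to l.+1 and the factor 1 + x, in place of x, include the case l = 0. *)
Lemma ah_ub y l x : 2 <= y -> 0 <= x ->
  ah y l x <= 2 * (1 + x) * isq l.+1 ^+ 3 * theta y ^+ l * expR (- ((1 - y^-1) * x)).
Proof.
move=> y2 x0; case: l => [|l].
  rewrite /ah isq1 !expr0 expr1n !mulr1 mul1r mul0r addr0 /=.
  have iy : 0 <= y^-1 by rewrite invr_ge0; lra.
  have : expR (- x) <= expR (- ((1 - y^-1) * x)) by rewrite ler_expR; nra.
  have := expR_ge0 (- x); set u := expR _; set v := expR _ => *; nra.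
have yp : 0 < y by lra.
have [E [_ E0 ->]] := @ahE y l.+1 x yp x0 isT.
set n := l.+1; have n1 : 1 <= n%:R :> R by rewrite ler1n.
have D0 : 0 <= expR (- ((1 - y^-1) * x)) by exact: expR_ge0.
rewrite mulrA; have E1 : expR E <= 1 by rewrite expR_le1.
apply: (@le_trans _ _ (x / (x + n%:R * y) * (isq n * theta y ^+ n) * expR (- ((1 - y^-1) * x)))).
  by rewrite ler_piMr // !mulr_ge0 ?isq_ge0 ?exprn_ge0 ?theta_ge0 ?invr_ge0 ?addr_ge0 ?mulr_ge0 //; lra.
have T0 : 0 <= theta y ^+ n by rewrite exprn_ge0 ?theta_ge0 ?ltW.
rewrite ler_wpM2r // mulrA ler_wpM2r //.
have i1 := isqS_le (isT : (0 < n)%N).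
have i0 := isq_ge0 n; have i0' := isq_ge0 n.+1.
have h : isq n ^+ 2 <= (2 * isq n.+1) ^+ 2 by rewrite lerXn2r ?nnegrE ?mulr_ge0.
have h3 : isq n ^+ 3 <= 4 * isq n.+1 ^+ 3.
  rewrite isq_sqr in h; have e : isq n.+1 ^+ 3 = isq n.+1 ^+ 2 * isq n.+1 by ring.
  have -> : isq n ^+ 3 = isq n ^+ 2 * isq n by ring.
  rewrite e !isq_sqr; have h' : n%:R^-1 <= 2 * n.+1%:R^-1 :> R.
    rewrite -[n.+1%:R]natr1 ler_pdivlMr; last by lra.
    by rewrite ler_pdivrMl; lra.
  have : 0 <= n.+1%:R^-1 :> R by rewrite invr_ge0.
  have : 0 <= n%:R^-1 :> R by rewrite invr_ge0.
  move: h' i1 i0 i0'; set a := n%:R^-1; set b := n.+1%:R^-1; set c := isq n; set d := isq n.+1.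
  move=> h' i1 i0 i0' a0 b0; apply: (@le_trans _ _ (2 * b * (2 * d))); last by lra.
  by apply: ler_pM.
apply: (@le_trans _ _ (x / 2 * isq n ^+ 3)); last first.
  have := exprn_ge0 3 i0'; move: h3; set a := isq n ^+ 3; set b := isq _ ^+ 3; nra.
have -> : isq n ^+ 3 = n%:R^-1 * isq n by rewrite exprS mulrC isq_sqr.
rewrite mulrA ler_wpM2r // -mulrA ler_wpM2l // -invfM.
rewrite lef_pV2 ?posrE; nra.
Qed.

Lemma ah_lb y l x : 2 <= y -> (0 < l)%N -> 0 <= x -> x ^+ 2 <= l%:R ->
  expR (- 2) / (2 * y) * x * isq l ^+ 3 * theta y ^+ l * expR (- ((1 - y^-1) * x))
    <= ah y l x.
Proof.
move=> y2 l0 x0 xl; have yp : 0 < y by lra.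
have [E [E1 _ ->]] := ahE yp x0 l0.
have l1 : 1 <= l%:R :> R by rewrite ler1n.
have E2 : - 2 <= E.
  apply: le_trans E1; rewrite -opprD lerN2 -lerBrDl.
  rewrite ler_pdivrMr; last by rewrite !mulr_gt0 ?exprn_gt0 //; lra.
  have : 4 <= y ^+ 2 by nra.
  move: (y ^+ 2) => z z4; nra.
have -> : isq l ^+ 3 = l%:R^-1 * isq l by rewrite exprS mulrC isq_sqr.
have e1 : expR (- 2) <= expR E by rewrite ler_expR.
have e2 : x / (2 * (l%:R * y)) <= x / (x + l%:R * y).
  have x1 : x <= l%:R.
    by have [x1|x1] := leP x 1; [exact: le_trans l1 | apply: le_trans xl; nra].
  have ly : l%:R <= l%:R * y by rewrite ler_peMr //; lra.
  rewrite ler_wpM2l // lef_pV2 ?posrE; lra.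
rewrite [X in X <= _](_ : _ = x / (2 * (l%:R * y)) * (isq l * theta y ^+ l) *
   (expR (- ((1 - y^-1) * x)) * expR (- 2))); last first.
  move: (expR _) (expR _) (isq _) (theta _ ^+ _) => a b c d.
  by field; rewrite ?gt_eqF //; lra.
have p0 : 0 <= isq l * theta y ^+ l by rewrite mulr_ge0 ?isq_ge0 ?exprn_ge0 ?theta_ge0 // ltW.
apply: ler_pM.
- by rewrite mulr_ge0 // mulr_ge0 // invr_ge0 !mulr_ge0 // ltW.
- by rewrite mulr_ge0 ?expR_ge0.
- by rewrite ler_wpM2r.
- by rewrite ler_wpM2l ?expR_ge0.
Qed.
End LnBounds.

(** * The law of the tree *)

Definition split_leaf (t : seq node) (u : node) : seq node :=
  t ++ [:: rcons u false; rcons u true].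

Definition leaves (t : seq node) : seq node := [seq u <- undup t | is_leaf t u].

(** Recursion on the reversed list: whether a choice is a leaf depends on the choices before it. *)
Fixpoint valid_rev (us : seq node) : bool :=
  if us is u :: us' then is_leaf (tree_of (rev us')) u && valid_rev us' else true.

Definition valid (us : seq node) : bool := valid_rev (rev us).

Lemma tree_of_rcons us u : tree_of (rcons us u) = split_leaf (tree_of us) u.
Proof. by rewrite /tree_of -cats1 foldl_cat. Qed.

Lemma valid_rcons us u : valid (rcons us u) = valid us && is_leaf (tree_of us) u.
Proof. by rewrite /valid rev_rcons /= revK andbC. Qed.

Definition tree_ok (t : seq node) : Prop :=
  [/\ [::] \in t, uniq t, forall u b, rcons u b \in t -> u \in t &
    forall u b b', rcons u b \in t -> rcons u b' \in t].

Lemma mem_split_leaf t u v :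
  (v \in split_leaf t u) = [|| v \in t, v == rcons u false | v == rcons u true].
Proof. by rewrite mem_cat !inE. Qed.

Lemma tree_ok_split t u : tree_ok t -> is_leaf t u -> tree_ok (split_leaf t u).
Proof.
move=> [t0 tu tp ts] /andP[/andP[ut u0] u1]; split.
- by rewrite mem_split_leaf t0.
- rewrite cat_uniq tu /= orbF !negb_or u0 u1 /= ?inE ?andbT.
  by rewrite eqseq_rcons andbF.
- move=> v b; rewrite !mem_split_leaf => /or3P[/tp ->//|/eqP|/eqP] /rcons_inj[-> _];
  by rewrite ut.
- move=> v b b'; rewrite !mem_split_leaf => /or3P[/ts ->//|/eqP|/eqP] /rcons_inj[-> _];
  by case: b'; rewrite eqxx ?orbT.
Qed.

Lemma tree_ok_valid us : valid us -> tree_ok (tree_of us).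
Proof.
elim/last_ind: us => [_|us u IH].
  split=> //; first by move=> u b; rewrite !inE; case: u.
  by move=> u b b'; rewrite !inE; case: u.
by rewrite valid_rcons tree_of_rcons => /andP[/IH h1 h2]; exact: tree_ok_split.
Qed.

Lemma mem_leaves t u : (u \in leaves t) = is_leaf t u.
Proof.
by rewrite mem_filter mem_undup andb_idr // => /andP[/andP[]].
Qed.

Lemma leaves_uniq t : uniq (leaves t).
Proof. by rewrite filter_uniq ?undup_uniq. Qed.

Lemma rcons_neq (T : eqType) (u : seq T) b : (rcons u b == u) = false.
Proof. by apply/eqP => /(congr1 size); rewrite size_rcons => /eqP; rewrite gtn_eqF. Qed.

Lemma eqseq_rcons_bool (u v : node) b c : (rcons u b == rcons v c) = (u == v) && (b == c).
Proof. by rewrite eqseq_rcons. Qed.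

Lemma leaves_split t u : tree_ok t -> is_leaf t u ->
  perm_eq (leaves (split_leaf t u))
    (rcons u false :: rcons u true :: [seq v <- leaves t | v != u]).
Proof.
move=> [t0 tu tp ts] lu; have /andP[/andP[ut u0] u1] := lu.
have hm v : (v \in [seq v <- leaves t | v != u]) = (v != u) && is_leaf t v.
  by rewrite mem_filter mem_leaves.
apply: uniq_perm; first exact: leaves_uniq.
- rewrite /= filter_uniq ?leaves_uniq // !inE !hm /is_leaf.
  by rewrite eqseq_rcons_bool (negPf u0) (negPf u1) /= !andbF.
- have ub b c : rcons (rcons u b) c \notin t.
    by apply/negP => /tp; case: b; rewrite ?(negPf u0) ?(negPf u1).
  move=> v; rewrite !inE hm mem_leaves /is_leaf !mem_split_leaf !negb_or.
  rewrite !eqseq_rcons_bool !andbF !andbT ?orbF.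
  have [->|v0] := eqVneq v (rcons u false).
    by rewrite (negPf u0) /= !(negPf (ub _ _)) rcons_neq.
  have [->|v1] := eqVneq v (rcons u true).
    by rewrite (negPf u1) /= !(negPf (ub _ _)) rcons_neq.
  rewrite !orbF /=; have [->|vu] := eqVneq v u; first by rewrite !andbF.
  by rewrite !andbT.
Qed.

Lemma size_leaves us : valid us -> size (leaves (tree_of us)) = (size us).+1.
Proof.
elim/last_ind: us => [//|us u IH]; rewrite valid_rcons tree_of_rcons => /andP[v lu].
rewrite (perm_size (leaves_split (tree_ok_valid v) lu)) /= size_rcons -(IH v).
rewrite -rem_filter ?leaves_uniq // size_rem ?mem_leaves // prednK //.
by rewrite (IH v).
Qed.

Lemma tree_ok_prefix t u w : tree_ok t -> u ++ w \in t -> u \in t.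
Proof.
move=> [_ _ tp _]; elim/last_ind: w => [|w b IH]; first by rewrite cats0.
by rewrite -rcons_cat => /tp.
Qed.

Lemma saturated_size k t : tree_ok t -> saturated k t -> (k <= size t)%N.
Proof.
move=> ok /forallP sat.
have inc : {subset [seq nseq j false | j <- iota 0 k.+1] <= t}.
  move=> u /mapP[j]; rewrite mem_iota /= add0n ltnS => jk ->.
  have := sat (nseq_tuple k false); rewrite /= -(subnKC jk) nseqD.
  exact: tree_ok_prefix.
have := uniq_leq_size _ inc; rewrite size_map size_iota => /(_ _)/ltnW; apply.
rewrite map_inj_in_uniq ?iota_uniq // => i j _ _ /(congr1 size).
by rewrite !size_nseq.
Qed.

Lemma saturated0 t : tree_ok t -> saturated 0 t.
Proof. by move=> [t0 _ _ _]; apply/forallP => u; rewrite tuple0. Qed.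

Lemma saturated_sat_level t : tree_ok t -> saturated (sat_level t) t.
Proof.
move=> ok; rewrite /sat_level.
have [i si ->] := @eq_bigmax_cond _ (fun k : 'I_(size t).+1 => saturated k t) (@nat_of_ord _)
  (ltac:(apply/card_gt0P; exists ord0; exact: saturated0)).
exact: si.
Qed.

Lemma le_sat_level k t : tree_ok t -> saturated k t -> (k <= sat_level t)%N.
Proof.
move=> ok sk; have kt := saturated_size ok sk; rewrite -ltnS in kt.
exact: (@leq_bigmax_cond _ (fun k : 'I_(size t).+1 => saturated k t) (@nat_of_ord _) (Ordinal kt)).
Qed.

Lemma sat_level_le_leaf t v : tree_ok t -> v \in leaves t -> (sat_level t <= size v)%N.
Proof.
move=> ok; rewrite mem_leaves => /andP[/andP[vt v0] v1]; rewrite leqNgt; apply/negP => lt.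
have /forallP sat := saturated_sat_level ok.
have sz : size (rcons v false ++ nseq (sat_level t - (size v).+1) false) = sat_level t.
  by rewrite size_cat size_rcons size_nseq subnKC.
have := sat (tcast sz (in_tuple _)).
by rewrite /= val_tcast /= => /(tree_ok_prefix ok); rewrite (negPf v0).
Qed.

(** Follow a missing word of length k from the root: its last prefix in the tree has one missing
    child, hence both are missing, and it is a leaf. *)
Lemma unsaturated_leaf t k : tree_ok t -> (sat_level t < k)%N ->
  exists2 v, v \in leaves t & (size v < k)%N.
Proof.
move=> ok lt; have /forallPn[u uN] : ~~ saturated k t.
  by apply/negP => /(le_sat_level ok); rewrite leqNgt lt.
have [t0 _ tp ts] := ok.
have ex : exists j, take j u \notin t by exists k; rewrite take_oversize ?size_tuple.
pose j := ex_minn ex; have := erefl j; rewrite {1}/j; case: ex_minnP => -[|i] jN jmin _.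
  by rewrite take0 t0 in jN.
have iu : (i < size u)%N.
  by rewrite ltnNge; apply: contra jN => le; rewrite take_oversize ?(leq_trans le) //
     -(take_oversize le); apply: contraT => /jmin; rewrite ltnn.
exists (take i u); last by rewrite size_take iu -(size_tuple u).
have it : take i u \in t by apply: contraT => /jmin; rewrite ltnn.
rewrite mem_leaves /is_leaf it /=; rewrite (take_nth false iu) in jN.
by apply/andP; split; apply: contra jN; apply: ts.
Qed.

Section TreeSums.
Variable R : realFieldType.
Implicit Types (g : node -> R) (a d : node -> R).

Lemma sum_leaves_rcons us u g : valid us -> is_leaf (tree_of us) u ->
  \sum_(v <- leaves (tree_of (rcons us u))) g v =
  g (rcons u false) + g (rcons u true) + \sum_(v <- leaves (tree_of us) | v != u) g v.
Proof.
move=> vu lu; rewrite tree_of_rcons (perm_big _ (leaves_split (tree_ok_valid vu) lu)) /=.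
by rewrite !big_cons big_filter addrA.
Qed.

Lemma prod_leaves_rcons us u g : valid us -> is_leaf (tree_of us) u ->
  \prod_(v <- leaves (tree_of (rcons us u))) g v =
  g (rcons u false) * g (rcons u true) * \prod_(v <- leaves (tree_of us) | v != u) g v.
Proof.
move=> vu lu; rewrite tree_of_rcons (perm_big _ (leaves_split (tree_ok_valid vu) lu)) /=.
by rewrite !big_cons big_filter mulrA.
Qed.

(* Exactly one leaf splits at each step; this makes the futures of distinct leaves
   negatively dependent, and their joint probability is at most the product. *)
Lemma sum_prod_le (s : seq node) a d (c : R) : uniq s -> 0 <= c ->
  (forall v, 0 <= a v <= d v) ->
  \prod_(v <- s) a v + c * \sum_(u <- s) (d u - a u) * \prod_(v <- s | v != u) a v
    <= \prod_(v <- s) (a v + c * (d v - a v)).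
Proof.
move=> + c0 ad; have a0 v : 0 <= a v by case/andP: (ad v).
have da v : 0 <= d v - a v by rewrite subr_ge0; case/andP: (ad v).
elim: s => [|x s IH] /=; first by rewrite !big_nil mulr0 addr0.
move=> /andP[xs us]; rewrite !big_cons eqxx /=.
have -> : \prod_(j <- s | j != x) a j = \prod_(j <- s) a j.
  rewrite -big_filter; congr (\big[_/_]_(_ <- _) _); apply/all_filterP/allP => y ys.
  by apply: contraNneq xs => <-.
have -> : \sum_(j <- s) (d j - a j) * \prod_(v <- x :: s | v != j) a v =
   a x * \sum_(j <- s) (d j - a j) * \prod_(v <- s | v != j) a v.
  rewrite big_distrr /=; apply: eq_big_seq => j js; rewrite big_cons.
  have -> : x != j by apply: contraNneq xs => ->.
  by rewrite mulrCA.
have := IH us; set A := \prod_(j <- s) a j; set D := \sum_(j <- s) _.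
set Q := \prod_(j <- s) _ => h.
have D0 : 0 <= D by apply: sumr_ge0 => j _; rewrite mulr_ge0 ?prodr_ge0.
have := ler_wpM2l (addr_ge0 (a0 x) (mulr_ge0 c0 (da x))) h; apply: le_trans.
have : 0 <= c * (d x - a x) * (c * D) by rewrite !mulr_ge0.
by nra.
Qed.
End TreeSums.

(** * Cylinder events and backward induction along the leaf choices *)

Section Law.
Context d (T : measurableType d) (R : realType) (P : probability T R).
Variable U : nat -> T -> node.
Hypothesis hU : is_bst_process P U.

Definition cyl (us : seq node) : set T :=
  [set w | forall i, (i < size us)%N -> U i w = nth [::] us i].

Definition prefix (N : nat) (w : T) : seq node := [seq U i w | i <- iota 0 N].

Lemma cylP us w : cyl us w <-> prefix (size us) w = us.
Proof.
split=> [h|e i ilt].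
- apply: (@eq_from_nth _ [::]) => [|i]; rewrite size_map size_iota // => ilt.
  by rewrite (nth_map 0%N) ?size_iota // nth_iota // h.
- by rewrite -[in RHS]e (nth_map 0%N) ?size_iota // nth_iota.
Qed.

Lemma measurable_cyl us : measurable (cyl us).
Proof.
have -> : cyl us = \bigcap_(i in [set i | (i < size us)%N]) [set w | U i w = nth [::] us i].
  by apply/seteqP; split=> w h i; exact: h.
by apply: bigcap_measurableType => i _; case: hU.
Qed.

Lemma measurable_prefix N (p : set (seq node)) : measurable [set w | p (prefix N w)].
Proof.
have -> : [set w | p (prefix N w)] =
    \bigcup_(us : seq node) (if `[< p us >] && (size us == N) then cyl us else set0).
  apply/seteqP; split=> w.
  - move=> pw; exists (prefix N w) => //; rewrite size_map size_iota eqxx andbT.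
    by rewrite asboolT //; apply/cylP; rewrite size_map size_iota.
  - by case=> us _; case: ifP => // /andP[/asboolP pus /eqP <-] /cylP /= ->.
apply: countable_bigcupT_measurable => [|us]; first exact: countableP.
case: ifP => _; [exact: measurable_cyl|exact: measurable0].
Qed.

Lemma path_prob_rcons us u : valid us ->
  bst_path_prob R (rcons us u) = bst_path_prob R us *
    (if is_leaf (tree_of us) u then (size us).+1%:R^-1 else 0).
Proof.
move=> vu; rewrite /bst_path_prob size_rcons big_ord_recr /=; congr (_ * _).
- apply: eq_bigr => i _; rewrite nth_rcons ltn_ord -cats1 takel_cat //.
  exact/ltnW.
- by rewrite nth_rcons ltnn eqxx -cats1 take_size_cat // /nleaves -size_filter -size_leaves.
Qed.

Lemma path_prob_ge0 us : 0 <= bst_path_prob R us.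
Proof. by rewrite prodr_ge0 // => i _; case: ifP. Qed.

Lemma cyl_rcons us u w : cyl (rcons us u) w <-> cyl us w /\ U (size us) w = u.
Proof.
split=> [h|[h e] i].
  split; last by have := h (size us); rewrite size_rcons nth_rcons ltnn eqxx; apply.
  by move=> i il; have := h i; rewrite size_rcons nth_rcons il ltnW //; apply.
rewrite size_rcons ltnS nth_rcons leq_eqVlt => /orP[/eqP ->|il].
  by rewrite ltnn eqxx.
by rewrite il; exact: h.
Qed.

Lemma probability_U2 (A B : set T) : measurable A -> measurable B ->
  (P (A `|` B) <= P A + P B)%E.
Proof. by move=> mA mB; exact: measureU2. Qed.

Lemma probability_le_bigsetU (s : seq node) (F : node -> set T) :
  (forall v, measurable (F v)) ->
  (P (\big[setU/set0]_(v <- s) F v) <= \sum_(v <- s) P (F v))%E.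
Proof.
move=> mF; elim: s => [|x s IH]; first by rewrite !big_nil measure0.
rewrite !big_cons; apply: le_trans (probability_U2 _ _) _ => //.
- exact: bigsetU_measurable.
- exact: leeD2l.
Qed.

(** The parts F v need only fill [A] up to a null set: in the application the next choice may fail
    to be a leaf, with probability 0. *)
Lemma measure_le_split (A : set T) (s : seq node) (F : node -> set T) : uniq s ->
  measurable A -> (forall v, measurable (F v)) ->
  (forall v w, F v w -> A w) ->
  (forall u v w, F u w -> F v w -> u = v) ->
  P A = (\sum_(v <- s) P (F v))%E ->
  forall E, measurable E -> (P (A `&` E) <= \sum_(v <- s) P (F v `&` E))%E.
Proof.
move=> us mA mF FA Finj eA E mE.
pose B := \big[setU/set0]_(v <- s) F v.
have mB s' : measurable (\big[setU/set0]_(v <- s') F v) by apply: bigsetU_measurable.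
have eB : P B = (\sum_(v <- s) P (F v))%E.
  rewrite /B; elim: (s) us => [|x s' IH] /=; first by rewrite !big_nil measure0.
  move=> /andP[xs us']; rewrite !big_cons measureU //; first by congr (_ + _)%E; exact: IH.
  rewrite -subset0 => w [/= Fx]; rewrite -bigcup_seq => -[y ys Fy].
  by rewrite (Finj _ _ _ Fx Fy) (ys : y \in s') in xs.
have BA : B `<=` A by rewrite /B -bigcup_seq => w [v _ /FA].
have AB0 : P (A `\` B) = 0%E.
  rewrite measureD //; [|exact: mB|by rewrite ltey_eq fin_num_measure].
  rewrite setIidr //; transitivity (P A - P A)%E; last by rewrite subee // fin_num_measure.
  by congr (_ - _)%E; rewrite eA; exact: eB.
have mEB : measurable (B `&` E) by apply: measurableI; rewrite /B.
have -> : A `&` E = (B `&` E) `|` ((A `\` B) `&` E).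
  rewrite -setIUl; congr (_ `&` _); by rewrite setDUK.
have mABE : measurable ((A `\` B) `&` E).
  by apply: measurableI => //; apply: measurableD => //; exact: mB.
apply: le_trans (probability_U2 mEB mABE) _.
have -> : P ((A `\` B) `&` E) = 0%E.
  apply/eqP; rewrite -measure_le0 -AB0; apply: measureIl => //.
  by apply: measurableD => //; exact: mB.
rewrite adde0 /B big_distrl /=.
by apply: probability_le_bigsetU => v; exact: measurableI.
Qed.

(** A supermartingale bound without conditional expectations, by backward induction over cylinders.
    Asking for the inequalities only on cylinders that meet [E] lets [Psi] exploit that [E] has not
    failed so far. *)
Lemma law_le (E : set T) (N : nat) (Psi : seq node -> R) : measurable E ->
  (forall us, valid us -> (size us < N)%N -> cyl us `&` E !=set0 ->
     \sum_(v <- leaves (tree_of us)) Psi (rcons us v) <= (size us).+1%:R * Psi us) ->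
  (forall us, valid us -> size us = N -> cyl us `&` E !=set0 -> 1 <= Psi us) ->
  (forall us, valid us -> 0 <= Psi us) ->
  (P E <= (Psi [::])%:E)%E.
Proof.
move=> mE hstep hend h0.
have key r us : valid us -> (size us + r = N)%N ->
    (P (cyl us `&` E) <= (bst_path_prob R us * Psi us)%:E)%E.
  elim: r us => [|r IH] us vu; first last.
    move=> szN; have [ne|/set0P/negP/negPn/eqP ->] := pselect (cyl us `&` E !=set0); last first.
      by rewrite measure0 lee_fin mulr_ge0 ?path_prob_ge0 ?h0.
    have lt : (size us < N)%N by rewrite -szN addnS ltnS leq_addr.
    have lv v : v \in leaves (tree_of us) -> valid (rcons us v).
      by rewrite mem_leaves valid_rcons vu.
    have n0 : (size us).+1%:R != 0 :> R by rewrite pnatr_eq0.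
    have [_ hP] := hU.
    apply: le_trans (@measure_le_split (cyl us) (leaves (tree_of us))
      (fun v => cyl (rcons us v)) (leaves_uniq _) (measurable_cyl us)
      (fun v => measurable_cyl _) _ _ _ E mE) _.
    - by move=> v w /cyl_rcons[].
    - by move=> u v w /cyl_rcons[_ <-] /cyl_rcons[_ <-].
    - rewrite hP; under eq_bigr do rewrite hP; rewrite sumEFin; congr (_%:E).
      rewrite (eq_big_seq (fun=> bst_path_prob R us * (size us).+1%:R^-1)) => [|v].
        by rewrite big_const_seq count_predT size_leaves // iter_addr addr0 -[RHS]mulr_natr divfK.
      by rewrite mem_leaves path_prob_rcons // => ->.
    apply: (@le_trans _ _ (\sum_(v <- leaves (tree_of us))
      (bst_path_prob R us * (size us).+1%:R^-1 * Psi (rcons us v))%:E)%E).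
      rewrite big_seq [leRHS]big_seq; apply: lee_sum => v vl.
      have e : bst_path_prob R (rcons us v) = bst_path_prob R us * (size us).+1%:R^-1.
        by rewrite path_prob_rcons //; move: vl; rewrite mem_leaves => ->.
      rewrite -e; apply: IH; first exact: lv.
      by rewrite size_rcons addSnnS.
    rewrite sumEFin lee_fin -big_distrr /= -mulrA ler_wpM2l ?path_prob_ge0 //.
    by rewrite ler_pdivrMl ?ltr0n // hstep.
  rewrite addn0 => szN; have [ne|/set0P/negP/negPn/eqP ->] := pselect (cyl us `&` E !=set0); last first.
    by rewrite measure0 lee_fin mulr_ge0 ?path_prob_ge0 ?h0.
  apply: (@le_trans _ _ (P (cyl us))); first by apply: measureIl => //; exact: measurable_cyl.
  have [_ ->] := hU; rewrite lee_fin ler_peMr ?path_prob_ge0 //.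
  exact: hend.
have := key N [::] isT (add0n _).
have -> : cyl [::] `&` E = E by apply/seteqP; split=> [w []//|w Ew]; split.
by rewrite /bst_path_prob big_ord0 mul1r.
Qed.
End Law.

(** * First moments and products over leaves *)

Section Moments.
Context d (T : measurableType d) (R : realType) (P : probability T R).
Variable U : nat -> T -> node.
Hypothesis hU : is_bst_process P U.

Lemma bst_tree_cyl us n w : cyl U us w -> n.-1 = size us -> bst_tree U n w = tree_of us.
Proof. by move=> /cylP h e; rewrite /bst_tree e -/(prefix U (size us) w) h. Qed.

Lemma measurable_bst_tree n (p : set (seq node)) : measurable [set w | p (bst_tree U n w)].
Proof. exact: (measurable_prefix hU n.-1 (fun us => p (tree_of us))). Qed.

(** Truncating the sum over the leaves at 1 implements the killing at the barrier: as soon as one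
    leaf has weight at least 1, the truncated sum equals 1 and cannot increase. So the recursion for
    g is needed only where g < 1. *)
Lemma first_moment_bound_aux (g : nat -> nat -> R) N k : (0 < N)%N ->
  (forall n i, 0 <= g n i) ->
  (forall n i, (0 < n < N)%N -> 1 <= g n i \/
     (1 - n%:R^-1) * g n.+1 i + 2 * n%:R^-1 * g n.+1 i.+1 <= g n i) ->
  (forall i, (i < k)%N -> 1 <= g N i) ->
  (P [set w | (sat_level (bst_tree U N w) < k)%N] <= (g 1 0)%:E)%E.
Proof.
move=> N0 g0 grec gend.
pose S us := \sum_(v <- leaves (tree_of us)) g (size us).+1 (size v).
pose Psi us : R := Num.min 1 (S us).
have S0 us : 0 <= S us by apply: sumr_ge0.
have P0 us : 0 <= Psi us by rewrite le_min ler01 S0.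
have P1 us : Psi us <= 1 by rewrite ge_min lexx.
apply: (@le_trans _ _ (Psi [::])%:E); last first.
  by rewrite lee_fin ge_min /S /= big_seq1 lexx orbT.
apply: (@law_le _ _ _ P U hU _ N.-1 Psi) => //.
- exact: (measurable_bst_tree N (fun t => (sat_level t < k)%N)).
- move=> us vu lt _; set n := (size us).+1.
  have nN : (0 < n < N)%N by rewrite -(prednK N0).
  have n0 : 0 < n%:R :> R by rewrite ltr0n.
  have Sn : \sum_(v <- leaves (tree_of us)) Psi (rcons us v) <= n%:R.
    rewrite /n -(size_leaves vu).
    apply: (@le_trans _ _ (\sum_(v <- leaves (tree_of us)) 1)); first exact: ler_sum.
    by rewrite big_const_seq count_predT iter_addr addr0.
  have [/hasP[v vl gv]|/hasPn no] := boolP (has (fun v => 1 <= g n (size v)) (leaves (tree_of us))).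
  + have -> : Psi us = 1.
      apply/min_idPl; rewrite /S (bigD1_seq v) ?leaves_uniq //= -[leLHS]addr0.
      by rewrite lerD // sumr_ge0.
    by rewrite mulr1.
  + rewrite -ler_pdivrMl // [leRHS]/Psi le_min !ler_pdivrMl //; apply/andP; split.
      by rewrite mulr1.
    pose G (v : node) := g n.+1 (size v); pose H (v : node) := g n.+1 (size v).+1.
    apply: (@le_trans _ _ (\sum_(u <- leaves (tree_of us))
        (2 * H u + (\sum_(v <- leaves (tree_of us)) G v - G u)))).
      rewrite big_seq [leRHS]big_seq; apply: ler_sum => u ul.
      rewrite ge_min; apply/orP; right; rewrite /S size_rcons.
      rewrite (sum_leaves_rcons (fun v => G v)) // -?mem_leaves // [in leRHS](bigD1_seq u) ?leaves_uniq //=.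
      by rewrite /G !size_rcons -/(H u); lra.
    rewrite big_split /= -big_distrr /= sumrB big_const_seq count_predT size_leaves // iter_addr addr0.
    rewrite -[X in _ + (X - _)]mulr_natl -/n.
    apply: (@le_trans _ _ (n%:R * \sum_(v <- leaves (tree_of us))
        ((1 - n%:R^-1) * G v + 2 * n%:R^-1 * H v))).
      rewrite big_split /= -!big_distrr /=.
      set a := \sum_(i <- _) _; set b := \sum_(i <- _) _.
      rewrite le_eqVlt; apply/orP; left; apply/eqP; field; lra.
    apply: ler_wpM2l; first exact: ltW.
    rewrite /S big_seq [leRHS]big_seq; apply: ler_sum => v vl.
    have [h|//] := grec n (size v) nN.
    by have := no _ vl; rewrite h.
- move=> us vu szN [w [cw /= lt]].
  have e : bst_tree U N w = tree_of us by apply: bst_tree_cyl.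
  rewrite e in lt; have [v vl vk] := unsaturated_leaf (tree_ok_valid vu) lt.
  rewrite le_min lexx /= /S szN prednK // (bigD1_seq v) ?leaves_uniq //= -[leLHS]addr0.
  by rewrite lerD ?gend // sumr_ge0.
Qed.

(** The supersolutions involve ln (n - 2) and start at n = 3. The third tree always has one leaf of
    generation 1 and two of generation 2, whence the right-hand side. *)
Lemma first_moment_bound (f : nat -> nat -> R) N k : (3 <= N)%N ->
  (forall n i, 0 <= f n i) ->
  (forall n i, (3 <= n < N)%N -> 1 <= f n i \/
     (1 - n%:R^-1) * f n.+1 i + 2 * n%:R^-1 * f n.+1 i.+1 <= f n i) ->
  (forall i, (i < k)%N -> 1 <= f N i) ->
  (P [set w | (sat_level (bst_tree U N w) < k)%N] <= (f 3 1 + 2 * f 3 2)%:E)%E.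
Proof.
move=> N3 f0 frec fend.
pose g2 i := 2^-1 * f 3 i + f 3 i.+1.
pose g n i := if (3 <= n)%N then f n i else if n == 2 then g2 i else 2 * g2 i.+1.
have -> : f 3 1 + 2 * f 3 2 = g 1 0 by rewrite /g /= /g2; lra.
have g20 i : 0 <= g2 i by rewrite addr_ge0 ?mulr_ge0.
apply: first_moment_bound_aux.
- exact: leq_trans N3.
- by move=> n i; rewrite /g; case: ifP => // _; case: ifP => _ //; rewrite mulr_ge0.
- move=> [//|[|[|n]]] i /andP[_ nN]; last by rewrite /g; apply: frec.
  + by right; rewrite /g /= invr1; lra.
  + by right; rewrite /g /= /g2; lra.
- by move=> i ik; rewrite /g N3; exact: fend.
Qed.

Variable late : nat -> nat -> bool.

(* Probability that no late leaf appears up to time n + r among the descendants of a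
   leaf of generation i at time n, if leaves split independently, with probability
   1/m at time m. *)
Fixpoint on_time (n r i : nat) : R :=
  if late n i then 0 else
  if r is r'.+1 then (1 - n%:R^-1) * on_time n.+1 r' i + n%:R^-1 * on_time n.+1 r' i.+1 ^+ 2
  else 1.

Hypothesis late_down : forall n i, late n i.+1 -> late n i.

Lemma invn_itv n : (0 < n)%N -> 0 <= (n%:R^-1 : R) <= 1.
Proof. by move=> n0; rewrite invr_ge0 ler0n /= invf_le1 ?ler1n ?ltr0n. Qed.

Lemma on_time_itv n r i : (0 < n)%N -> 0 <= on_time n r i <= 1.
Proof.
elim: r n i => [|r IH] n i n0 /=; case: ifP => _; rewrite ?lexx ?ler01 //.
have /andP[a0 a1] := IH n.+1 i isT; have /andP[b0 b1] := IH n.+1 i.+1 isT.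
have /andP[c0 c1] := invn_itv n0.
set a := on_time _ _ _ in a0 a1 *; set b := on_time _ _ _ in b0 b1 *; set c := _^-1 in c0 c1 *.
have : 0 <= b ^+ 2 <= 1 by rewrite exprn_ge0 // exprn_ile1.
by case/andP; set s := b ^+ 2 => s0 s1; apply/andP; split; nra.
Qed.

(** Splitting at once can only help, since by [late_down] a shallower leaf is late no later than a
    deeper one. The induction compares the recursions at i and i.+1 term by term. *)
Lemma on_time_sqr n r i : (0 < n)%N -> on_time n r i <= on_time n r i.+1 ^+ 2.
Proof.
elim: r n i => [|r IH] n i n0 /=.
  case: ifP => [li|/negbT li]; first by rewrite sqr_ge0.
  by rewrite (negPf (contra (@late_down _ _) li)) expr1n.
case: ifP => [li|/negbT li]; first by rewrite sqr_ge0.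
rewrite (negPf (contra (@late_down _ _) li)).
have /andP[c0 c1] := invn_itv n0.
have h1 := IH n.+1 i isT; have h2 := IH n.+1 i.+1 isT.
have /andP[a0 a1] := on_time_itv r i (isT : (0 < n.+1)%N).
have /andP[b0 b1] := on_time_itv r i.+1 (isT : (0 < n.+1)%N).
set a := on_time _ _ i in h1 a0 a1 *; set b := on_time _ _ i.+1 in h1 h2 b0 b1 *.
set e := on_time _ _ i.+2 ^+ 2 in h2 *; set c := _^-1 in c0 c1 *.
apply: (@le_trans _ _ (b ^+ 2)).
  have := ler_wpM2l (_ : 0 <= 1 - c) h1; rewrite subr_ge0 => /(_ c1).
  by set b2 := b ^+ 2; nra.
rewrite lerXn2r ?nnegrE //; first by nra.
have := ler_wpM2l c0 h2; nra.
Qed.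

Lemma on_time_pow n r i m : (0 < n)%N -> on_time n r i <= on_time n r (i + m) ^+ (2 ^ m).
Proof.
move=> n0; elim: m => [|m IH]; first by rewrite addn0 expr1.
apply: le_trans IH _; rewrite expnS addnS exprM lerXn2r ?nnegrE ?sqr_ge0 ?on_time_sqr //.
by have /andP[] := on_time_itv r (i + m) n0.
Qed.

Lemma on_time_step n r i : (0 < n)%N -> on_time n r.+1 i <= on_time n.+1 r i.+1 ^+ 2.
Proof.
move=> n0 /=; case: ifP => _; first by rewrite sqr_ge0.
have /andP[c0 c1] := invn_itv n0; have := on_time_sqr r i (isT : (0 < n.+1)%N).
set a := on_time _ _ i; set b := on_time _ _ i.+1 ^+ 2; set c := _^-1 in c0 c1 *.
by nra.
Qed.

(** Two forced splittings per line lead to time 3, where the moment recursions begin, with 4 leaves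
    of generation 2; [on_time_pow] multiplies them up to generation m. *)
Lemma on_time_bound r m : (2 <= m)%N -> on_time 1 r.+2 0 <= on_time 3 r m ^+ (2 ^ m).
Proof.
move=> m2; apply: le_trans (@on_time_step 1 r.+1 0 isT) _.
apply: (@le_trans _ _ (on_time 3 r 2 ^+ 4)).
  rewrite (_ : 4 = 2 * 2)%N // exprM lerXn2r ?nnegrE ?sqr_ge0 //; last exact: on_time_step.
  by have /andP[] := on_time_itv r.+1 1 (isT : (0 < 2)%N).
rewrite -(subnKC m2); set j := (m - 2)%N; rewrite expnD mulnC exprM lerXn2r ?nnegrE //.
- by have /andP[] := on_time_itv r 2 (isT : (0 < 3)%N).
- by rewrite exprn_ge0 //; have /andP[] := on_time_itv r (2 + j) (isT : (0 < 3)%N).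
- exact: on_time_pow.
Qed.

Lemma on_time_law r : (P [set w | forall n i, (0 < n <= r.+1)%N -> late n i ->
   (i < sat_level (bst_tree U n w))%N] <= (on_time 1 r 0)%:E)%E.
Proof.
set E := [set w | _].
pose Psi us := \prod_(v <- leaves (tree_of us)) on_time (size us).+1 (r - size us) (size v).
have -> : on_time 1 r 0 = Psi [::] by rewrite /Psi /= big_seq1 subn0.
have late_no us w v : valid us -> (size us <= r)%N -> cyl U us w -> E w ->
    v \in leaves (tree_of us) -> late (size us).+1 (size v) = false.
  move=> vu szr cw Ew vl; apply/negP => lt.
  have := Ew (size us).+1 (size v); rewrite andTb => /(_ szr lt).
  rewrite (bst_tree_cyl cw) // ltnNge => /negP; apply.
  by apply: sat_level_le_leaf => //; exact: tree_ok_valid.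
apply: (@law_le _ _ _ P U hU _ r Psi) => //.
- have -> : E = \bigcap_(n in setT) [set w | forall i, (0 < n <= r.+1)%N -> late n i ->
       (i < sat_level (bst_tree U n w))%N].
    by apply/seteqP; split=> [w Ew n _ i|w Ew n i]; [exact: Ew|exact: (Ew n I)].
  apply: bigcap_measurableType => n _.
  exact: (measurable_bst_tree n (fun t => forall i, (0 < n <= r.+1)%N -> late n i -> (i < sat_level t)%N)).
- move=> us vu lt [w [cw Ew]]; set n := (size us).+1.
  have n0 : 0 < n%:R :> R by rewrite ltr0n.
  have szr : (r - size us = (r - n).+1)%N by rewrite /n subnS prednK // subn_gt0.
  (* a and b are the factors of a leaf that stays, respectively splits, at time n. On cylinders that
     meet [E] no leaf is late, so [on_time] unfolds to a + (b - a) / n, the form required by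
     [sum_prod_le]. *)
  pose a (v : node) := on_time n.+1 (r - n) (size v).
  pose b (v : node) := on_time n.+1 (r - n) (size v).+1 ^+ 2.
  have ab v : 0 <= a v <= b v.
    have /andP[-> _] /= := on_time_itv (r - n) (size v) (isT : (0 < n.+1)%N).
    exact: on_time_sqr.
  have c0 : 0 <= n%:R^-1 :> R by rewrite invr_ge0 ltW.
  have := sum_prod_le (leaves_uniq (tree_of us)) c0 ab.
  rewrite [X in _ <= X -> _](_ : _ = Psi us); last first.
    rewrite /Psi szr; apply: eq_big_seq => v vl /=.
    by rewrite (late_no us w) ?(ltnW lt) // -/n -/(a v) -/(b v); ring.
  move/(ler_wpM2l (ltW n0)); apply: le_trans.
  rewrite mulrDr mulrA divff ?gt_eqF // mul1r.
  set A := \prod_(v <- _) a v.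
  rewrite -[X in X * A](_ : (size (leaves (tree_of us)))%:R = n%:R); last by rewrite size_leaves.
  have -> : (size (leaves (tree_of us)))%:R * A = \sum_(u <- leaves (tree_of us)) A.
    by rewrite big_const_seq count_predT iter_addr addr0 mulr_natl.
  rewrite -big_split /= big_seq [leRHS]big_seq; apply: ler_sum => u ul.
  rewrite /Psi size_rcons -/n (prod_leaves_rcons (fun v => a v)) // -?mem_leaves //.
  have -> : a (rcons u false) * a (rcons u true) = b u by rewrite /a /b !size_rcons expr2.
  rewrite /A [in leRHS](bigD1_seq u) ?leaves_uniq //=.
  by rewrite le_eqVlt; apply/orP; left; apply/eqP; ring.
- move=> us vu szr [w [cw Ew]]; rewrite /Psi szr subnn big_seq big1 // => v vl.
  by rewrite /= -{1}szr (late_no us w) ?szr.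
- move=> us vu; apply: prodr_ge0 => v _.
  by have /andP[] := on_time_itv (r - size us) (size v) (isT : (0 < (size us).+1)%N).
Qed.
End Moments.

(** * Supersolutions and early saturation *)

Section Supersolution.
Variable R : realType.
Implicit Types (y x X : R).

Definition lnr (n : nat) : R := ln (n%:R : R).

Lemma lnrS n : (0 < n)%N -> lnr n.+1 = lnr n + ln (1 + n%:R^-1).
Proof.
move=> n0; have n1 : 0 < n%:R :> R by rewrite ltr0n.
rewrite /lnr -lnM ?posrE ?addr_gt0 ?invr_gt0 //; congr ln.
by rewrite mulrDr mulr1 divff ?gt_eqF // natr1.
Qed.

Lemma lnr_step_ub n : (0 < n)%N -> lnr n.+1 - lnr n <= n%:R^-1.
Proof.
move=> n0; rewrite lnrS // addrAC subrr add0r.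
have n1 : 0 < n%:R^-1 :> R by rewrite invr_gt0 ltr0n.
by apply: le_ln1Dx; lra.
Qed.

Lemma lnr_step_lb n : (0 < n)%N -> n.+1%:R^-1 <= lnr n.+1 - lnr n.
Proof.
move=> n0; have n1 : 0 < n%:R :> R by rewrite ltr0n.
have e : n.+1%:R = n%:R + 1 :> R by rewrite natr1.
have n2 : 0 < n.+1%:R :> R by rewrite ltr0n.
have : ln (n%:R / n.+1%:R) <= - n.+1%:R^-1 :> R.
  have -> : n%:R / n.+1%:R = 1 + - n.+1%:R^-1 :> R by rewrite e; field; lra.
  apply: le_ln1Dx; rewrite ltrN2 invf_lt1 // e; lra.
by move=> h; rewrite -[leRHS]opprB lerNr /lnr -ln_div ?posrE.
Qed.

Lemma lnr_le n m : (0 < n)%N -> (n <= m)%N -> lnr n <= lnr m.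
Proof.
by move=> n0 nm; rewrite /lnr ler_ln ?posrE ?ltr0n ?ler_nat // (leq_trans n0).
Qed.

(** The clock is delayed to ln (n - 2), so that its step from n to n + 1 is at least 1 / (n - 1),
    the side that a supersolution needs. *)
Definition supX (y X0 : R) n i : R := X0 + i%:R * y - lnr n.-2.

(* Up to normalisation, the expected number of descendants reaching generation J at time
   e ^ X0 of a leaf of generation i at time n, when leaves are killed as X becomes negative. *)
Definition supF (y X0 : R) J n i : R :=
  if (i <= J)%N && (0 <= supX y X0 n i) then
    n.-1%:R * 2 ^- i * abel y (J - i) (supX y X0 n i) else 0.

Lemma supF_ge0 y X0 J n i : 0 <= y -> 0 <= supF y X0 J n i.
Proof.
move=> y0; rewrite /supF; case: ifP => // /andP[_ x0].
by rewrite !mulr_ge0 ?invr_ge0 ?exprn_ge0 ?abel_ge0.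
Qed.

Lemma supX_succ y X0 n i : supX y X0 n i.+1 = supX y X0 n i + y.
Proof. by rewrite /supX -natr1; ring. Qed.

Lemma supX_step y X0 n i : (3 <= n)%N ->
  supX y X0 n.+1 i = supX y X0 n i - (lnr n.-1 - lnr n.-2).
Proof. by move=> n3; rewrite /supX /=; case: n n3 => [|[|n]] //= _; ring. Qed.

Lemma supF_super y X0 J n i : 0 <= y -> (3 <= n)%N ->
  lnr n.-1 - lnr n.-2 <= supX y X0 n i ->
  (1 - n%:R^-1) * supF y X0 J n.+1 i + 2 * n%:R^-1 * supF y X0 J n.+1 i.+1
    <= supF y X0 J n i.
Proof.
move=> y0; case: n => [|[|n]] // n3; set m := n.+2 in n3 *.
have nE : m%:R = n.+1%:R + 1 :> R by rewrite natr1.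
have n1 : 0 < n.+1%:R :> R by rewrite ltr0n.
have n2 : (0 < n)%N by [].
set r := lnr _ - _ => rX; have r1 : n.+1%:R^-1 <= r by apply: lnr_step_lb.
have r0 : 0 <= r by apply: le_trans r1; rewrite invr_ge0 ltW.
have eX : supX y X0 m.+1 i = supX y X0 m i - r by exact: supX_step.
rewrite /supF supX_succ eX.
set X := supX y X0 m i in rX *.
have X0' : 0 <= X by lra.
have Xr : 0 <= X - r by lra.
have Xry : 0 <= X - r + y by lra.
rewrite X0' Xr Xry !andbT /=.
have e1 : (1 - m%:R^-1) * m%:R = n.+1%:R :> R by rewrite nE; field; lra.
have e2 k : 2 * m%:R^-1 * (m%:R * 2 ^- k.+1) = 2 ^- k :> R.
  by rewrite exprS invfM; field; rewrite ?expf_neq0 ?pnatr_eq0.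
have [iJ|Ji] := ltnP i J; last first.
  rewrite mulr0 addr0; case: ifP => [iJ|_]; last by rewrite mulr0.
  have -> : (J - i = 0)%N by apply/eqP; rewrite subn_eq0.
  by rewrite /= !mulr1 mulrA e1.
rewrite ltnW // -[in X in X <= _](subnSK iJ) -[in X in _ <= X](subnSK iJ).
rewrite [X in X + _]mulrA [_ * (m%:R / 2 ^+ i)]mulrA e1 [X in _ + X]mulrA e2.
have := abel_super (J - i.+1) y0 r0 rX.
set A := abel y _.+1 X; set B := abel y _.+1 (X - r); set C := abel y _ (X - r + y).
have C0 : 0 <= C by apply: abel_ge0.
move=> h; have h' : B + n.+1%:R^-1 * C <= A by apply: le_trans h; rewrite lerD2l ler_wpM2r.
have : 0 <= 2 ^- i :> R by rewrite invr_ge0 exprn_ge0.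
move: (2 ^- i) => p p0.
have -> : n.+1%:R * p * B + p * C = n.+1%:R * p * (B + n.+1%:R^-1 * C) by field; lra.
by rewrite ler_wpM2l // mulr_ge0 // ltW.
Qed.

(** The exponent of [ah], x + (J - i) y = X0 + J y - ln (n - 2), does not depend on i; so the
    weights differ only by the constant in J and the ratio (n - 1) / (n - 2). *)
Lemma supF_ah y X0 J n i : (3 <= n)%N -> (i <= J)%N -> 0 <= supX y X0 n i ->
  supF y X0 J n i = n.-1%:R / n.-2%:R * (2 ^- J * expR (X0 + J%:R * y)) *
    ah y (J - i) (supX y X0 n i).
Proof.
move=> n3 iJ x0; rewrite /supF iJ x0 /= /ah.
have -> : expR (- (supX y X0 n i + (J - i)%:R * y)) = expR (- (X0 + J%:R * y)) * n.-2%:R.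
  have n0 : 0 < n.-2%:R :> R by rewrite ltr0n; case: n n3 {x0} => [|[|[|n]]].
  rewrite -(@lnK _ n.-2%:R) ?posrE // -expRD; congr expR.
  by rewrite /supX natrB // /lnr; ring.
have -> : 2 ^- i = 2 ^- J * 2 ^+ (J - i) :> R.
  by rewrite -[in 2 ^- J](subnK iJ) exprD; field; rewrite !expf_neq0 ?pnatr_eq0.
have n0 : n.-2%:R != 0 :> R by rewrite pnatr_eq0; case: n n3 {x0} => [|[|[|n]]].
have e := expRxMexpNx_1 (X0 + J%:R * y).
move: (expR _) (expR (- _)) e (abel _ _ _) => a b ab c.
rewrite (_ : _ * c * (b * _) = 2 ^+ (J - i) * c * b * n.-2%:R); last by ring.
transitivity (n.-1%:R * (2 ^- J * 2 ^+ (J - i)) * c * (a * b)).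
  by rewrite ab mulr1.
by field; rewrite n0 expf_neq0 ?pnatr_eq0.
Qed.
End Supersolution.

(** * The critical slope 1 + alpha and the upper bound for the probability of late saturation *)

Section Alpha.
Variables (R : realType) (alpha : R).
Hypotheses (ha : 0 < alpha) (halpha : 2 * (alpha + 1) * expR (- alpha) - 1 = 0).

Lemma expR_alpha : 2 * (alpha + 1) * expR (- alpha) = 1.
Proof. by apply/eqP; rewrite -subr_eq0 halpha. Qed.

(** Provides the slope 1 + alpha >= 2 assumed in the Abel estimates. If alpha <= 1, the bound e^(-
    alpha) > (1 - alpha / 2)^2 contradicts the equation. *)
Lemma alpha_gt1 : 1 < alpha.
Proof.
have a0 := ha; rewrite ltNge; apply/negP => a1.
have h : 1 - alpha / 2 < expR (- (alpha / 2)).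
  by apply: expR_gt1Dx; rewrite oppr_eq0 gt_eqF // divr_gt0.
have e : expR (- alpha) = expR (- (alpha / 2)) ^+ 2.
  by rewrite -expRM_natl; congr expR; field.
have : (1 - alpha / 2) ^+ 2 < expR (- alpha).
  have p : 0 <= 1 - alpha / 2 by lra.
  by rewrite e ltr_pXn2r ?nnegrE ?expR_ge0.
have := expR_alpha; move: (expR (- alpha)) => u eu hu.
have : 2 * (alpha + 1) * (1 - alpha / 2) ^+ 2 < 1 by rewrite -[ltRHS]eu ltr_pM2l //; lra.
have : 0 <= (1 - alpha) * (1 + alpha - alpha ^+ 2 / 2) by rewrite mulr_ge0; nra.
rewrite expr2; nra.
Qed.

Lemma expR_alphaE : expR (- alpha) = (2 * (alpha + 1))^-1.
Proof.
have a0 := ha.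
by apply: (@mulfI _ (2 * (alpha + 1))); rewrite ?expR_alpha ?divff // gt_eqF; lra.
Qed.

(** beta written as 1 - 1 / y at y = 1 + alpha, the exponential rate in [ahE]. *)
Definition beta_ : R := 1 - (1 + alpha)^-1.

Lemma betaE : 2 * alpha * expR (- alpha) = beta_.
Proof. by have a0 := ha; rewrite expR_alphaE /beta_; field; lra. Qed.

Lemma beta_mul : beta_ * (1 + alpha) = alpha.
Proof. by have a0 := ha; rewrite /beta_; field; lra. Qed.

Lemma beta_itv : 1/2 < beta_ < 1.
Proof.
have a1 := alpha_gt1; have : 0 < (1 + alpha)^-1 by rewrite invr_gt0; lra.
have : (1 + alpha)^-1 < 2^-1 by rewrite ltf_pV2 ?posrE; lra.
by rewrite /beta_ => *; apply/andP; split; lra.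
Qed.

Lemma theta_star : theta (1 + alpha) = 1.
Proof.
by rewrite /theta opprD addrA subrr add0r [1 + _]addrC expR_alpha.
Qed.

(** e^(- alpha i) n^beta is the critical additive martingale, up to discretisation: since 2 e^(-
    alpha) = 1 - beta, one step multiplies the mean of e^(- alpha i) by 1 - beta / n, which the
    growth of n^beta compensates. *)
Lemma weight_super n i : (0 < n)%N ->
  (1 - n%:R^-1) * (expR (- (alpha * i%:R)) * expR (beta_ * lnr R n.+1)) +
  2 * n%:R^-1 * (expR (- (alpha * i.+1%:R)) * expR (beta_ * lnr R n.+1))
  <= expR (- (alpha * i%:R)) * expR (beta_ * lnr R n).
Proof.
move=> n0; have a0 := ha; have n1 : 0 < n%:R :> R by rewrite ltr0n.
have -> : expR (- (alpha * i.+1%:R)) = expR (- (alpha * i%:R)) * expR (- alpha).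
  by rewrite -expRD -natr1; congr expR; ring.
have e : 2 * expR (- alpha) = 1 - beta_ by rewrite expR_alphaE /beta_; field; lra.
set w := expR (- (alpha * _)); set z := expR (beta_ * lnr R n.+1).
have -> : (1 - n%:R^-1) * (w * z) + 2 / n%:R * (w * expR (- alpha) * z) =
  w * ((1 - beta_ / n%:R) * z).
  rewrite (_ : 1 - beta_ / n%:R = 1 - n%:R^-1 + (1 - beta_) / n%:R); last by ring.
  by rewrite -e; ring.
rewrite ler_wpM2l ?expR_ge0 //.
have /andP[b0 b1] := beta_itv.
apply: (@le_trans _ _ (expR (- (beta_ / n%:R)) * z)).
  by rewrite ler_wpM2r ?expR_ge0 //; exact: expR_ge1Dx.
rewrite -expRD ler_expR; have := lnr_step_ub R n0.
have b : 0 <= beta_ by lra.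
move=> h; have := ler_wpM2l b h; lra.
Qed.

Lemma upper_start (L : R) J n : (3 <= n)%N -> (n <= J)%N -> 0 <= L -> (0 < n)%N ->
  forall i, (i <= 2)%N ->
  2 ^+ J * expR (- (L + J%:R * (1 + alpha))) * supF (1 + alpha) L J 3 i <=
  4 * (1 + L + 2 * (1 + alpha)) * isq R n.-1 ^+ 3 * expR (- (beta_ * L)).
Proof.
move=> n3 nJ L0 n0 i i2; have a1 := alpha_gt1.
have iJ : (i <= J)%N by apply: leq_trans i2 (leq_trans _ nJ); apply: ltnW.
have i0 : 0 <= i%:R * (1 + alpha) by rewrite mulr_ge0 //; lra.
have Xe : supX (1 + alpha) L 3 i = L + i%:R * (1 + alpha).
  by rewrite /supX /= /lnr ln1 subr0.
have X0 : 0 <= supX (1 + alpha) L 3 i by rewrite Xe; lra.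
rewrite supF_ah //= divr1 Xe.
have -> : forall a, 2 ^+ J * expR (- (L + J%:R * (1 + alpha))) *
   (2 * (2 ^- J * expR (L + J%:R * (1 + alpha))) * a) = 2 * a.
  move=> a; have := expRxMexpNx_1 (L + J%:R * (1 + alpha)).
  move: (expR _) (expR (- _)) => u v uv.
  transitivity (2 * (2 ^+ J * 2 ^- J) * (u * v) * a); first by ring.
  by rewrite uv divff ?expf_neq0 ?pnatr_eq0 // !mulr1.
have y2 : 2 <= 1 + alpha by lra.
have := @ah_ub R (1 + alpha) (J - i) _ y2 (_ : 0 <= L + i%:R * (1 + alpha)).
rewrite -Xe => /(_ X0); rewrite Xe theta_star expr1n mulr1 => h.
apply: le_trans (ler_wpM2l (ler0n R 2) h) _.
have s1 : isq R (J - i).+1 ^+ 3 <= isq R n.-1 ^+ 3.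
  by rewrite lerXn2r ?nnegrE ?isq_ge0 // isq_le //; lia.
have s0 : 0 <= isq R (J - i).+1 ^+ 3 by rewrite exprn_ge0 ?isq_ge0.
have i2' : i%:R <= 2 :> R by rewrite (ler_nat R i 2).
have ee : expR (- (beta_ * (L + i%:R * (1 + alpha)))) <= expR (- (beta_ * L)).
  rewrite ler_expR lerN2; have /andP[b0 b1] := beta_itv; rewrite ler_wpM2l //; lra.
rewrite -/beta_.
have := expR_ge0 (- (beta_ * (L + i%:R * (1 + alpha)))).
move: (isq R _ ^+ 3) (isq R _ ^+ 3) s0 s1 (expR _) (expR _) ee => s s' s0 s1 e e' ee e0.
rewrite !mulrA (_ : 2 * 2 = 4 :> R); last by lra.
apply: ler_pM => //.
  by rewrite !mulr_ge0 //; lra.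
by apply: ler_pM => //; nra.
Qed.

Definition upper_const : R := 2 * (1 + alpha) * expR 2.

(** The supersolution has two parts. [lam * W] is at least 1 wherever [supX] < 1 and pays for leaves
    that come near the barrier; the multiple of [supF] pays for leaves that stay above it and end at
    a generation below k. *)
Lemma sat_level_lt_bound d (T : measurableType d) (P : probability T R) U
    (hU : is_bst_process P U) (N k l : nat) (L : R) :
  (3 <= N)%N -> (3 <= k)%N -> (0 < l)%N -> 0 <= L ->
  (forall x, 1 <= x -> x <= supX (1 + alpha) L N k.-1 -> x ^+ 2 <= l%:R) ->
  (P [set w | (sat_level (bst_tree U N w) < k)%N] <=
    (9 * expR (- (beta_ * (L - 2))) +
     12 * upper_const * (1 + L + 2 * (1 + alpha)) * isq R k.-1 ^+ 3 *
       isq R (2 * l) ^- 3 * expR (alpha * k.-1%:R - beta_ * lnr R N.-2))%:E)%E.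
Proof.
move=> N3 k3 l0 L0 hl.
have a1 := alpha_gt1; have /andP[b0 b1] := beta_itv; have bm := beta_mul.
have y0 : 0 <= 1 + alpha by lra.
set y := 1 + alpha in y0 *.
(* Aiming l generations beyond k.-1 leaves J - i >= l for each final leaf, so that [ah_lb] applies
   to all positions X with X ^+ 2 <= l. *)
pose J := (k.-1 + l)%N; pose lam := expR (- (beta_ * (L - 2))).
(* A cancels the constant of [supF_ah]; A' is the inverse of the lower bound of [ah_lb] over the
   admissible final positions, where X >= 1. *)
pose A := 2 ^+ J * expR (- (L + J%:R * y)).
pose A' := upper_const * isq R (2 * l) ^- 3 * expR (beta_ * supX y L N k.-1).
pose W n i := expR (- (alpha * i%:R)) * expR (beta_ * lnr R n).
pose f n i := lam * W n i + A' * (A * supF y L J n i).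
have W0 n i : 0 <= W n i by rewrite mulr_ge0 ?expR_ge0.
have lam0 : 0 <= lam by rewrite expR_ge0.
have A0 : 0 <= A by rewrite mulr_ge0 ?expR_ge0 ?exprn_ge0.
have A'0 : 0 <= A'.
  by rewrite !mulr_ge0 ?expR_ge0 ?invr_ge0 ?exprn_ge0 ?isq_ge0 //; lra.
have S0 n i : 0 <= supF y L J n i by apply: supF_ge0.
have viol n i : (3 <= n)%N -> supX y L n i < 1 -> 1 <= lam * W n i.
  move=> n3 X1; rewrite /W /lam -!expRD -[leLHS]expR0 ler_expR.
  have : lnr R n.-2 <= lnr R n.
    by apply: lnr_le; move: n3; clear; lia.
  move: X1; rewrite /supX => X1 h.
  have h1 : 0 <= beta_ * (2 - L - i%:R * y + lnr R n) by rewrite mulr_ge0 //; lra.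
  apply: le_trans h1 _; rewrite -{1}bm -/y le_eqVlt; apply/orP; left; apply/eqP; ring.
have rec n i : (3 <= n < N)%N -> 1 <= f n i \/
     (1 - n%:R^-1) * f n.+1 i + 2 * n%:R^-1 * f n.+1 i.+1 <= f n i.
  move=> /andP[n3 _]; have [X1|X1] := ltP (supX y L n i) 1.
    left; rewrite -[leLHS]addr0; apply: lerD; first exact: viol.
    by apply: mulr_ge0 => //; exact: mulr_ge0.
  right; have n0 : (0 < n)%N by apply: leq_trans n3.
  have h1 := ler_wpM2l lam0 (weight_super i n0).
  have rX : lnr R n.-1 - lnr R n.-2 <= supX y L n i.
    apply: le_trans X1; have n2 : (0 < n.-2)%N by move: n3; clear; lia.
    have := lnr_step_ub R n2; rewrite prednK; last by move: n3; clear; lia.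
    by move=> h; apply: le_trans h _; rewrite invf_le1 ?ler1n ?ltr0n.
  have h2 := ler_wpM2l (mulr_ge0 A'0 A0) (supF_super J y0 n3 rX).
  rewrite -/(W n.+1 i) -/(W n.+1 i.+1) -/(W n i) in h1.
  have := lerD h1 h2; rewrite -[A' * A * supF y L J n i]mulrA; apply: le_trans.
  by rewrite le_eqVlt; apply/orP; left; apply/eqP; rewrite /f; ring.
have fend i : (i < k)%N -> 1 <= f N i.
  move=> ik; have [X1|X1] := ltP (supX y L N i) 1.
    rewrite -[leLHS]addr0; apply: lerD; first exact: viol.
    by apply: mulr_ge0 => //; exact: mulr_ge0.
  rewrite -[leLHS]add0r; apply: lerD; first by rewrite mulr_ge0.
  have iJ : (i <= J)%N by rewrite /J; move: ik k3; clear; lia.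
  have X0 : 0 <= supX y L N i by lra.
  rewrite supF_ah //.
  have N2 : 0 < N.-2%:R :> R by rewrite ltr0n; move: N3; clear; lia.
  have -> : A * (N.-1%:R / N.-2%:R * (2 ^- J * expR (L + J%:R * y)) * ah y (J - i) (supX y L N i))
     = N.-1%:R / N.-2%:R * ah y (J - i) (supX y L N i).
    rewrite /A; have := expRxMexpNx_1 (L + J%:R * y).
    move: (expR _) (expR (- _)) (N.-1%:R / _) (ah _ _ _) => u v p q uv.
    transitivity (p * q * (2 ^+ J * 2 ^- J) * (u * v)); first by ring.
    by rewrite uv divff ?expf_neq0 ?pnatr_eq0 // !mulr1.
  have Xk : supX y L N i <= supX y L N k.-1.
    by rewrite /supX lerD2r lerD2l ler_wpM2r // ler_nat; move: ik; clear; lia.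
  have X2 : supX y L N i ^+ 2 <= l%:R by apply: hl.
  have lJ : (l <= J - i)%N by rewrite /J; move: ik; clear; lia.
  have l2 : (J - i <= 2 * l)%N.
    have : (k.-1 - i)%:R <= l%:R :> R.
      have Xi : supX y L N k.-1 = supX y L N i + (k.-1 - i)%:R * y.
        by rewrite /supX natrB; [ring|move: ik; clear; lia].
      have x1 : 1 <= supX y L N k.-1 by lra.
      have := hl _ x1 (lexx _); apply: le_trans.
      have : (k.-1 - i)%:R <= supX y L N k.-1.
        have y1 : 1 <= y by rewrite /y; lra.
        rewrite Xi; have : (k.-1 - i)%:R <= (k.-1 - i)%:R * y by rewrite ler_peMr.
        by move: X0; clear; lra.
      move: (supX _ _ _ _) (_%:R) x1 => z c z1 cz; nra.
    rewrite ler_nat /J; move: ik; clear; lia.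
  have := @ah_lb R y (J - i) (supX y L N i) _ _ X0 _.
  rewrite theta_star expr1n mulr1 => /(_ ltac:(rewrite /y; lra) (leq_trans l0 lJ)) h.
  have {}h := h (le_trans X2 _); rewrite ler_nat in h; have {}h := h lJ.
  have i0 : 0 < isq R (2 * l) by rewrite isq_gt0 // muln_gt0.
  have i1 : isq R (2 * l) ^+ 3 <= isq R (J - i) ^+ 3.
    by rewrite lerXn2r ?nnegrE ?isq_ge0 // isq_le // (leq_trans l0).
  have p1 : 1 <= N.-1%:R / N.-2%:R :> R.
    by rewrite ler_pdivlMr // mul1r ler_nat; move: N3; clear; lia.
  have ah0 : 0 <= ah y (J - i) (supX y L N i) by rewrite ah_ge0.
  rewrite -/beta_ in h.
  have h2 : expR (- 2) / (2 * y) * isq R (2 * l) ^+ 3 * expR (- (beta_ * supX y L N k.-1))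
      <= ah y (J - i) (supX y L N i).
    have c0 : 0 <= expR (- 2) / (2 * y) by rewrite divr_ge0 ?expR_ge0 // mulr_ge0.
    have s0 : 0 <= isq R (2 * l) ^+ 3 by rewrite exprn_ge0 // ltW.
    have bX : expR (- (beta_ * supX y L N k.-1)) <= expR (- (beta_ * supX y L N i)).
      by rewrite ler_expR lerN2 ler_wpM2l //; lra.
    apply: le_trans h; apply: ler_pM => //; first exact: mulr_ge0.
    by apply: ler_pM => //; rewrite ler_peMr.
  apply: (@le_trans _ _ (A' * ah y (J - i) (supX y L N i))); last first.
    by rewrite ler_wpM2l // ler_peMl.
  apply: le_trans (ler_wpM2l A'0 h2).
  rewrite /A' /upper_const -/y.
  have e1 := expRxMexpNx_1 (beta_ * supX y L N k.-1); have e2 := expRxMexpNx_1 (2 : R).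
  move: (expR (beta_ * _)) (expR (- (beta_ * _))) (expR 2) (expR (- 2)) e1 e2 => u v p q uv pq.
  have j0 : isq R (2 * l) ^+ 3 != 0 by rewrite expf_neq0 // gt_eqF.
  move: (isq R _ ^+ 3) j0 => z z0.
  have yn : y != 0 by rewrite gt_eqF // /y; lra.
  move: (y) yn => Y Y0.
  have -> : 2 * Y * p / z * u * (q / (2 * Y) * z * v) = (Y / Y) * (z / z) * (u * v) * (p * q).
    by field; rewrite z0.
  by rewrite uv pq !divff ?mulr1.
have := @first_moment_bound _ _ _ P U hU f N k N3 _ rec fend.
have f0 n i : 0 <= f n i.
  by apply: addr_ge0; apply: mulr_ge0 => //; exact: mulr_ge0.
move=> /(_ f0); move=> h; apply: le_trans h _; rewrite lee_fin.
(* The initial sum has three terms: each contributes at most 3 lam and 4 upper_const (...), which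
   gives the factors 9 and 12. *)
have W3 i : W 3 i <= 3.
  rewrite /W; have : expR (- (alpha * i%:R)) <= 1 by rewrite expR_le1 oppr_le0 mulr_ge0 // ltW.
  have : expR (beta_ * lnr R 3) <= 3.
    rewrite -[leRHS](@lnK _ 3) ?posrE // ler_expR -/(lnr R 3).
    have : 0 <= lnr R 3 by rewrite ln_ge0 // ler1n.
    by nra.
  have := expR_ge0 (- (alpha * i%:R)); have := expR_ge0 (beta_ * lnr R 3).
  by move: (expR _) (expR _) => p q; nra.
have kJ : (k <= J)%N by rewrite /J; move: k3 l0; clear; lia.
have k0 : (0 < k)%N by exact: leq_trans k3.
pose B := 4 * (1 + L + 2 * y) * isq R k.-1 ^+ 3 * expR (- (beta_ * L)).
have S3 i : (i <= 2)%N -> A' * (A * supF y L J 3 i) <= A' * B.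
  by move=> i2; rewrite ler_wpM2l // /A /B; exact: upper_start.
have eB : A' * B = 4 * upper_const * (1 + L + 2 * y) * isq R k.-1 ^+ 3 *
       isq R (2 * l) ^- 3 * expR (alpha * k.-1%:R - beta_ * lnr R N.-2).
  rewrite /A' /B.
  have -> : alpha * k.-1%:R - beta_ * lnr R N.-2 = beta_ * supX y L N k.-1 + - (beta_ * L).
    by rewrite /supX -{1}bm -/y; ring.
  by rewrite expRD; ring.
have := ler_wpM2l lam0 (W3 1%N); have := ler_wpM2l lam0 (W3 2).
have := S3 1%N isT; have := S3 2 isT; rewrite /f.
rewrite (_ : 12 * _ * _ * _ * _ * _ = 3 * (A' * B)); last by rewrite eB; ring.
rewrite -/lam; move: (A' * B) (A' * (A * supF y L J 3 1)) (A' * (A * supF y L J 3 2)) => *; lra.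
Qed.
End Alpha.

(** * The second moment method *)

Section SecondMoment.
Variable R : realType.

(* Second moment method in recursive form: eta * phi - eta^2 * gam is the
   Bonferroni lower bound after thinning by eta. *)
Lemma late_prob_lb (late : nat -> nat -> bool) (phi gam : nat -> nat -> R) (eta : R) n0 :
  0 <= eta <= 1 ->
  (forall n i, 0 <= phi n i) -> (forall n i, 0 <= gam n i) ->
  (forall n i, late n i -> phi n i <= 1) ->
  (forall n i, (3 <= n < n0)%N -> ~~ late n i -> phi n i != 0 ->
     phi n i <= (1 - n%:R^-1) * phi n.+1 i + 2 * n%:R^-1 * phi n.+1 i.+1) ->
  (forall n i, (3 <= n < n0)%N -> ~~ late n i -> phi n i != 0 ->
     (1 - n%:R^-1) * gam n.+1 i + 2 * n%:R^-1 * gam n.+1 i.+1 +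
       n%:R^-1 * phi n.+1 i.+1 ^+ 2 <= gam n i) ->
  (forall i, ~~ late n0 i -> phi n0 i = 0) ->
  forall n r i, (3 <= n)%N -> (n + r = n0)%N ->
    on_time R late n r i <= 1 - (eta * phi n i - eta ^+ 2 * gam n i).
Proof.
move=> /andP[e0 e1] phi0 gam0 hl hphi hgam hend.
(* The positive part keeps the claim within probabilities, and it is 0 where phi is 0; thus the
   recursions for phi and gam are used only where phi is nonzero. *)
pose w n i : R := Num.max 0 (eta * phi n i - eta ^+ 2 * gam n i).
have w0 n i : 0 <= w n i by rewrite le_max lexx.
have e20 : 0 <= eta ^+ 2 by rewrite sqr_ge0.
have wphi n i : w n i <= eta * phi n i.
  rewrite ge_max mulr_ge0 //= lerBlDr lerDl; exact: mulr_ge0.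
have ww n i : eta * phi n i - eta ^+ 2 * gam n i <= w n i by rewrite le_max lexx orbT.
have wz n i : phi n i = 0 -> w n i = 0.
  move=> pz; apply/le_anti; rewrite w0 andbT; apply: le_trans (wphi n i) _.
  by rewrite pz mulr0.
suff H n r i : (3 <= n)%N -> (n + r = n0)%N -> on_time R late n r i <= 1 - w n i.
  move=> n r i n3 nr; apply: le_trans (H n r i n3 nr) _.
  by rewrite lerD2l lerN2.
elim: r n i => [|r IH] n i n3 nr /=.
  rewrite addn0 in nr; case: ifP => [li|/negbT li].
    have := wphi n i; have := hl _ _ li; have := phi0 n i; nra.
  by rewrite wz ?subr0 // nr hend // -nr.
case: ifP => [li|/negbT li].
  have := wphi n i; have := hl _ _ li; have := phi0 n i; nra.
have nn : (3 <= n < n0)%N by rewrite n3 -nr -addSnnS leq_addr.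
have q1 := IH n.+1 i (leqW n3) (etrans (addSnnS n r) nr).
have q2 := IH n.+1 i.+1 (leqW n3) (etrans (addSnnS n r) nr).
have := @on_time_itv R late n.+1 r i.+1 isT; set b := on_time _ _ _ _ i.+1 in q2 *.
set a := on_time _ _ _ _ i in q1 *; move=> /andP[b0 b1].
have n0' : (0 < n)%N by apply: leq_trans n3.
have := invn_itv R n0'; set c := n%:R^-1 => /andP[c0 c1].
have w2 := w0 n.+1 i.+1; have w1 := w0 n.+1 i.
have bb : b ^+ 2 <= (1 - w n.+1 i.+1) ^+ 2 by rewrite lerXn2r ?nnegrE //; lra.
have step1 : (1 - c) * a + c * b ^+ 2 <= (1 - c) * (1 - w n.+1 i) + c * (1 - w n.+1 i.+1) ^+ 2.
  by apply: lerD; rewrite ler_wpM2l // subr_ge0.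
apply: le_trans step1 _.
have [pz|pn] := eqVneq (phi n i) 0.
  rewrite (wz n i pz) subr0; move: q2 w1 w2; move: (w _ _) (w _ _) => u v q2 u0 v0.
  have : 0 <= c * (v * (2 - v)) by apply: mulr_ge0 => //; apply: mulr_ge0; lra.
  have : 0 <= (1 - c) * u by rewrite mulr_ge0 // subr_ge0.
  by rewrite expr2; lra.
have h1 := ler_wpM2l e0 (hphi n i nn li pn).
have h2 := ler_wpM2l e20 (hgam n i nn li pn).
rewrite -/c in h1 h2.
have h3 : w n i <= (1 - c) * w n.+1 i + 2 * c * w n.+1 i.+1 - c * w n.+1 i.+1 ^+ 2.
  rewrite {1}/w ge_max; apply/andP; split.
    move: q2 w1 w2; move: (w _ _) (w _ _) => u v q2 u0 v0.
    have : 0 <= c * (v * (2 - v)) by apply: mulr_ge0 => //; apply: mulr_ge0; lra.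
    have : 0 <= (1 - c) * u by rewrite mulr_ge0 // subr_ge0.
    by rewrite expr2; lra.
  have s1 : (1 - c) * (eta * phi n.+1 i - eta ^+ 2 * gam n.+1 i) <= (1 - c) * w n.+1 i.
    by rewrite ler_wpM2l // subr_ge0.
  have s2 : c * (eta * phi n.+1 i.+1 - eta ^+ 2 * gam n.+1 i.+1) <= c * w n.+1 i.+1.
    by rewrite ler_wpM2l.
  have s3 : c * w n.+1 i.+1 ^+ 2 <= c * (eta * phi n.+1 i.+1) ^+ 2.
    by rewrite ler_wpM2l // lerXn2r ?nnegrE // mulr_ge0.
  rewrite exprMn in s3; lra.
by rewrite (expr2 (1 - _)); rewrite expr2 in h3; lra.
Qed.

Variables (y x0 : R) (K M : nat).
Hypothesis y2 : 2 <= y.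

Definition sub_arg n i : R := x0 + i%:R * y - lnr R n.

(* A leaf of generation at most J is late once ln n has passed the barrier x0 + J y. *)
Definition window_late n i : bool :=
  has (fun J => (i <= J)%N && (sub_arg n J <= 0)) (iota K M.+1).

Lemma window_late_down n i : window_late n i.+1 -> window_late n i.
Proof.
move=> /hasP[J JK /andP[iJ XJ]]; apply/hasP; exists J => //.
by rewrite (ltnW iJ).
Qed.

(** A subsolution of the first moment recursion with boundary value (i == J) on the barrier. The
    factor 2^J e^(-(x0 + J y)) keeps the value at i = J below 1 up to the time e^(x0 + J y) at which
    the barrier reaches J. *)
Definition subT J n i : R :=
  if sub_arg n i <= 0 then (i == J)%:R
  else if (i <= J)%N then n.-1%:R * 2 ^- i * abel y (J - i) (sub_arg n i) *
    (2 ^+ J * expR (- (x0 + J%:R * y))) else 0.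

Definition sub_phi n i : R := \sum_(J <- iota K M.+1) subT J n i.

Lemma subT_ge0 J n i : 0 <= subT J n i.
Proof.
have y0 : 0 <= y by have := y2; lra.
rewrite /subT; case: ifP => [_ //|/negbT]; rewrite -ltNge => X0; case: ifP => // _.
by rewrite !mulr_ge0 ?invr_ge0 ?exprn_ge0 ?expR_ge0 ?abel_ge0 // ltW.
Qed.

Lemma sub_phi_ge0 n i : 0 <= sub_phi n i.
Proof. by apply: sumr_ge0 => J _; exact: subT_ge0. Qed.

Lemma subX_le n i j : (i <= j)%N -> sub_arg n i <= sub_arg n j.
Proof.
move=> ij; rewrite /sub_arg lerD2r lerD2l ler_wpM2r ?ler_nat //.
by have := y2; lra.
Qed.

(** On the barrier the summands reduce to the indicators of i = J, at most one of which is
    nonzero. *)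
Lemma sub_phi_late n i : window_late n i -> sub_phi n i <= 1.
Proof.
move=> /hasP[J JK /andP[iJ XJ]].
have Xi : sub_arg n i <= 0 by apply: le_trans XJ; exact: subX_le.
rewrite /sub_phi /subT Xi.
rewrite (eq_bigr (fun J' => if J' == i then 1 else 0)); last first.
  by move=> j _; rewrite eq_sym; case: eqP.
rewrite -big_mkcond /= big_const_seq iter_addr addr0.
rewrite -[leRHS]/(1 *+ 1) ler_pMn2l // (count_uniq_mem i (iota_uniq K M.+1)).
by case: (_ \in _).
Qed.

Lemma sub_phi_not_late n i : ~~ window_late n i -> sub_phi n i != 0 -> 0 < sub_arg n i.
Proof.
move=> nl; apply: contraR; rewrite -leNgt => Xi; apply/eqP.
rewrite /sub_phi big_seq big1 // => J JK; rewrite /subT Xi.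
have [iJ|//] := eqVneq i J; case/negP: nl; apply/hasP; exists J => //.
by rewrite -iJ leqnn.
Qed.

Lemma subX_succ n i : sub_arg n i.+1 = sub_arg n i + y.
Proof. by rewrite /sub_arg -natr1; ring. Qed.

Lemma subT_lin J n i : (2 <= n)%N -> 0 < sub_arg n i ->
  subT J n i <= (1 - n%:R^-1) * subT J n.+1 i + 2 * n%:R^-1 * subT J n.+1 i.+1.
Proof.
move=> n2 X0; have yy := y2; have n0 : (0 < n)%N by apply: ltnW.
have nE : n%:R = n.-1%:R + 1 :> R by rewrite natr1 prednK.
have n1 : 1 <= n.-1%:R :> R by rewrite ler1n; move: n2; clear; lia.
pose r := lnr R n.+1 - lnr R n.
have r1 : r <= n%:R^-1 by exact: lnr_step_ub.
have r0 : 0 <= r by rewrite subr_ge0 lnr_le.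
have nV : n%:R^-1 <= 2^-1 :> R by rewrite lef_pV2 ?posrE ?ltr0n // ler_nat.
have nV0 : 0 <= n%:R^-1 :> R by rewrite invr_ge0.
have c1 : 0 <= 1 - n%:R^-1 :> R by lra.
have eX : sub_arg n.+1 i = sub_arg n i - r by rewrite /sub_arg /r; ring.
have T1 := subT_ge0 J n.+1 i; have T2 := subT_ge0 J n.+1 i.+1.
have D0 : 0 <= 2 * n%:R^-1 * subT J n.+1 i.+1 by rewrite !mulr_ge0.
have D1 : 0 <= (1 - n%:R^-1) * subT J n.+1 i by rewrite mulr_ge0.
rewrite {1}/subT (lt_geF X0); case: leqP => iJ; last by rewrite addr_ge0.
have e1 : (1 - n%:R^-1) * n%:R = n.-1%:R :> R by rewrite nE; field; lra.
have C0 : 0 <= 2 ^+ J * expR (- (x0 + J%:R * y)) by rewrite mulr_ge0 ?expR_ge0 ?exprn_ge0.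
have p0 : 0 <= 2 ^- i :> R by rewrite invr_ge0 exprn_ge0.
move: iJ; rewrite leq_eqVlt => /orP[/eqP iJ|iJ].
  subst J; rewrite subnn /= mulr1; rewrite -[leLHS]addr0; apply: lerD => //.
  rewrite /subT; case: ifP => [X1|_].
    rewrite eqxx mulr1 -e1.
    have -> : (1 - n%:R^-1) * n%:R / 2 ^+ i * (2 ^+ i * expR (- (x0 + i%:R * y))) =
       (1 - n%:R^-1) * (n%:R * expR (- (x0 + i%:R * y))) :> R.
      by field; rewrite expf_neq0 ?pnatr_eq0 //= gt_eqF // ltr0n.
    rewrite -[leRHS]mulr1 ler_wpM2l // -[X in X * _](@lnK _ n%:R) ?posrE ?ltr0n //.
    rewrite -expRD expR_le1 -/(lnr R n); move: X0; rewrite /sub_arg; lra.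
  rewrite leqnn subnn /= mulr1 -e1 le_eqVlt; apply/orP; left; apply/eqP; ring.
have e2 : 2 * n%:R^-1 * (n%:R * 2 ^- i.+1) = 2 ^- i :> R.
  by rewrite exprS invfM; field; rewrite ?expf_neq0 ?pnatr_eq0 // gtn_eqF.
have Xy : (sub_arg n.+1 i.+1 <= 0) = false by rewrite subX_succ eX; apply/negP/negP; rewrite -ltNge; lra.
(* [abel_sub] with r' = 1 / (n - 1): its condition r <= r' * (1 - r) says r <= 1 / n, which the
   undelayed clock satisfies. *)
have hA : abel y (J - i) (sub_arg n i) <=
  (if r < sub_arg n i then abel y (J - i) (sub_arg n i - r) else 0) +
    n.-1%:R^-1 * abel y (J - i.+1) (sub_arg n i - r + y).
  rewrite -(subnSK iJ); apply: abel_sub => //; [lra| |exact: ltW].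
  rewrite ler_pdivlMl; last by lra.
  have := ler_wpM2l (ltW (lt_le_trans ltr01 (_ : 1 <= n%:R))) r1.
  rewrite ler1n => /(_ n0); rewrite divff ?gt_eqF ?ltr0n // nE; lra.
have {}D1 : (1 - n%:R^-1) * (if r < sub_arg n i then n%:R * 2 ^- i * abel y (J - i) (sub_arg n i - r) *
    (2 ^+ J * expR (- (x0 + J%:R * y))) else 0) <= (1 - n%:R^-1) * subT J n.+1 i.
  rewrite ler_wpM2l //; case: ltP => // rX.
  have Xr : (sub_arg n i - r <= 0) = false by apply/negP/negP; rewrite -ltNge subr_gt0.
  by rewrite /subT eX Xr (ltnW iJ).
apply: le_trans (lerD D1 (lexx _)).
rewrite /subT Xy iJ subX_succ eX /=.
move: (2 ^+ J * expR _) C0 => C C0.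
rewrite [X in _ + X](_ : _ = 2 * n%:R^-1 * (n%:R * 2 ^- i.+1) *
   (abel y (J - i.+1) (sub_arg n i - r + y) * C)); last by ring.
rewrite e2; move: hA; set A := abel y _ (sub_arg n i); set B := abel y _ (sub_arg n i - r + y).
set A' := abel y _ (sub_arg n i - r) => hA.
have -> : (1 - n%:R^-1) * (if r < sub_arg n i then n%:R / 2 ^+ i * A' * C else 0) =
   n.-1%:R / 2 ^+ i * (if r < sub_arg n i then A' else 0) * C.
  by case: ifP => _; rewrite ?mulr0 ?mul0r // -e1; ring.
have -> : 2 ^- i * (B * C) = n.-1%:R / 2 ^+ i * (n.-1%:R^-1 * B) * C.
  have m0 : n.-1%:R != 0 :> R by rewrite gt_eqF //; lra.
  have q0 : 2 ^+ i != 0 :> R by rewrite expf_neq0 ?pnatr_eq0.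
  by field; rewrite m0 q0.
rewrite -mulrDl -mulrDr ler_wpM2r // ler_wpM2l // mulr_ge0 //; lra.
Qed.

Lemma sub_phi_lin n i : (2 <= n)%N -> 0 < sub_arg n i ->
  sub_phi n i <= (1 - n%:R^-1) * sub_phi n.+1 i + 2 * n%:R^-1 * sub_phi n.+1 i.+1.
Proof.
move=> n2 X0; rewrite /sub_phi !big_distrr -big_split /=.
by apply: ler_sum => J _; exact: subT_lin.
Qed.
End SecondMoment.

Section SecondMomentBounds.
Variable R : realType.
Variables (y x0 : R) (K M : nat).
Hypothesis y2 : 2 <= y.
Local Notation subX := (sub_arg y x0).
Local Notation phi := (sub_phi y x0 K M).

Lemma sub_phi_out n i : 0 < subX n i -> (K + M < i)%N -> phi n i = 0.
Proof.
move=> X0 iK; rewrite /sub_phi big_seq big1 // => J; rewrite mem_iota addnS ltnS => /andP[_ JK].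
by rewrite /subT (lt_geF X0) leqNgt (leq_ltn_trans JK iK).
Qed.

Variable D : nat -> R.
Hypothesis D0 : forall s, 0 <= D s.

(* Second moment bound: s is the generation at which the ancestral lines of two late leaves separate. *)
Definition sup_gam n i : R :=
  \sum_(s <- iota 1 (K + M) | (i < s)%N) D s * supF y (x0 + 1) s n i.

Lemma sup_gam_ge0 n i : 0 <= sup_gam n i.
Proof.
have yy := y2; apply: sumr_ge0 => s _; apply: mulr_ge0 => //; apply: supF_ge0; lra.
Qed.

Hypothesis hD : forall n s, (3 <= n)%N -> 0 < subX n s ->
  phi n s ^+ 2 <= D s * (n.-1%:R * 2 ^- s).

(** The offset 1 leaves room for a whole step of the delayed clock, so [supF_super] applies wherever
    [sub_arg] is positive. *)
Lemma subX_supX n i : (3 <= n)%N -> subX n i + 1 <= supX y (x0 + 1) n i.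
Proof.
move=> n3; rewrite /supX /sub_arg.
have : lnr R n.-2 <= lnr R n by apply: lnr_le; move: n3; clear; lia.
lra.
Qed.

(** The summand s = i.+1 disappears when i becomes i.+1. The decrease it would have contributed, 2 /
    n times its value, pays for the source phi ^+ 2 / n through [hD]; the other summands obey
    [supF_super]. *)
Lemma sup_gam_lin n i : (3 <= n)%N -> 0 < subX n i ->
  (1 - n%:R^-1) * sup_gam n.+1 i + 2 * n%:R^-1 * sup_gam n.+1 i.+1 +
    n%:R^-1 * phi n.+1 i.+1 ^+ 2 <= sup_gam n i.
Proof.
move=> n3 X0; have yy := y2; have y0 : 0 <= y by lra.
have n0 : (0 < n)%N by apply: leq_trans n3.
have nV0 : 0 <= n%:R^-1 :> R by rewrite invr_ge0.
have nV1 : n%:R^-1 <= 1 :> R by rewrite invf_le1 ?ltr0n // ler1n.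
have Xc : 0 < subX n.+1 i.+1.
  have : lnr R n.+1 - lnr R n <= n%:R^-1 by exact: lnr_step_ub.
  move: X0; rewrite /sub_arg -[i.+1%:R]natr1; lra.
have rX : lnr R n.-1 - lnr R n.-2 <= supX y (x0 + 1) n i.
  have n2 : (0 < n.-2)%N by move: n3; clear; lia.
  have n21 : n.-2.+1 = n.-1 by move: n3; clear; lia.
  have := lnr_step_ub R n2; rewrite n21 => h; apply: le_trans h _.
  apply: le_trans (subX_supX _ n3); have : n.-2%:R^-1 <= 1 :> R by rewrite invf_le1 ?ltr0n // ler1n.
  by move: X0; lra.
have sup s := supF_super s y0 n3 rX.
have Sf s m j : 0 <= supF y (x0 + 1) s m j by apply: supF_ge0.
rewrite /sup_gam; have [iS|Si] := ltnP i (K + M); last first.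
  rewrite (sub_phi_out Xc) ?ltnS // expr0n /= mulr0 addr0.
  have z j (F : nat -> R) : (i <= j)%N -> \sum_(s <- iota 1 (K + M) | (j < s)%N) F s = 0.
    move=> ij; rewrite big_seq_cond big1 // => s; rewrite mem_iota => /andP[/andP[_ h1] h2].
    by exfalso; move: h1 h2 Si ij; clear; lia.
  by rewrite !z ?mulr0 ?addr0.
have iin : i.+1 \in iota 1 (K + M) by rewrite mem_iota /= add1n ltnS.
have split (F : nat -> R) : \sum_(s <- iota 1 (K + M) | (i < s)%N) F s =
    F i.+1 + \sum_(s <- iota 1 (K + M) | (i.+1 < s)%N) F s.
  rewrite (big_rem i.+1) //= ltnSn; congr (_ + _).
  rewrite rem_filter ?iota_uniq // big_filter_cond; apply: eq_bigl => s /=.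
  by rewrite andbC [in RHS]ltn_neqAle eq_sym andbC.
rewrite !split.
set A := \sum_(s <- _ | _) _; set B := \sum_(s <- _ | _) _; set C := \sum_(s <- _ | _) _.
have h1 : (1 - n%:R^-1) * A + 2 * n%:R^-1 * B <= C.
  rewrite /A /B /C !big_distrr -big_split /=; apply: ler_sum => s _.
  by have := ler_wpM2l (D0 s) (sup s); lra.
have h2 := ler_wpM2l (D0 i.+1) (sup i.+1).
have h3 : n%:R^-1 * phi n.+1 i.+1 ^+ 2 <= 2 * n%:R^-1 * (D i.+1 * supF y (x0 + 1) i.+1 n.+1 i.+1).
  have -> : supF y (x0 + 1) i.+1 n.+1 i.+1 = n%:R * 2 ^- i.+1.
    rewrite /supF leqnn subnn /= mulr1 ifT //.
    by apply: le_trans (subX_supX _ (leqW n3)); lra.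
  have := ler_wpM2l nV0 (hD (leqW n3) Xc); rewrite /=.
  have : 0 <= n%:R^-1 * (D i.+1 * (n%:R * 2 ^- i.+1)).
    by rewrite !mulr_ge0 ?invr_ge0 ?exprn_ge0.
  lra.
by move: h1 h2 h3; rewrite -/B; lra.
Qed.

Lemma on_time_le_second_moment (eta : R) r : 0 <= eta <= 1 -> subX (3 + r) (K + M) <= 0 ->
  on_time R (window_late y x0 K M) 3 r 0 <=
    1 - (eta * phi 3 0 - eta ^+ 2 * sup_gam 3 0).
Proof.
move=> e01 XN; apply: (@late_prob_lb R (window_late y x0 K M) phi sup_gam eta (3 + r)) => //.
- by move=> n i; apply: sub_phi_ge0.
- by move=> n i; apply: sup_gam_ge0.
- by move=> n i; apply: sub_phi_late.
- move=> n i /andP[n3 _] nl pn; apply: sub_phi_lin => //; first exact: ltnW.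
  exact: sub_phi_not_late nl pn.
- move=> n i /andP[n3 _] nl pn; apply: sup_gam_lin => //.
  exact: sub_phi_not_late nl pn.
- move=> i nl; have [//|pn] := eqVneq (phi (3 + r) i) 0.
  have X0 := sub_phi_not_late nl pn.
  have [iK|iK] := leqP i (K + M); last by rewrite sub_phi_out.
  have := lt_le_trans X0 (le_trans (subX_le x0 y2 (3 + r) iK) XN).
  by rewrite ltxx.
Qed.
End SecondMomentBounds.

(** * Explicit bounds for the first and second moments *)

Section PointwiseBounds.
Variable R : realType.
Variables (y x0 kappa : R) (K M : nat).
Hypotheses (y2 : 2 <= y) (k0 : 0 < kappa) (k1 : kappa <= 1) (ky : kappa <= 1 - 2 / y).
Local Notation subX := (sub_arg y x0).
Local Notation phi := (sub_phi y x0 K M).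

Lemma subT_ah J n i : (0 < n)%N -> (i <= J)%N -> 0 < subX n i ->
  subT y x0 J n i = n.-1%:R / n%:R * ah y (J - i) (subX n i).
Proof.
move=> n0 iJ X0; rewrite /subT (lt_geF X0) iJ /ah.
have np : 0 < n%:R :> R by rewrite ltr0n.
have -> : expR (- (subX n i + (J - i)%:R * y)) = expR (- (x0 + J%:R * y)) * n%:R.
  rewrite -(@lnK _ n%:R) ?posrE // -expRD; congr expR.
  by rewrite /sub_arg natrB // /lnr; ring.
have -> : 2 ^+ J = 2 ^+ i * 2 ^+ (J - i) :> R by rewrite -exprD subnKC.
have q0 : 2 ^+ i != 0 :> R by rewrite expf_neq0 ?pnatr_eq0.
have m0 : n%:R != 0 :> R by rewrite gt_eqF.
by field; rewrite m0 q0.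
Qed.

(** The factor of the bound on [sub_phi] at generation s that does not depend on time. *)
Definition branch_sum s : R :=
  \sum_(J <- iota K M.+1 | (s <= J)%N) isq R (J - s).+1 ^+ 3 * theta y ^+ (J - s).

Lemma branch_sum_ge0 s : 0 <= branch_sum s.
Proof.
have yy := y2; apply: sumr_ge0 => J _; rewrite mulr_ge0 ?exprn_ge0 ?isq_ge0 ?theta_ge0 //; lra.
Qed.

Lemma sub_phi_ub n s : (0 < n)%N -> 0 < subX n s ->
  phi n s <= 2 * (1 + subX n s) * expR (- ((1 - y^-1) * subX n s)) * branch_sum s.
Proof.
move=> n0 X0; rewrite /branch_sum big_distrr /= big_mkcond /=.
apply: ler_sum => J _; case: ifP => [sJ|/negbT nsJ]; last first.
  by rewrite /subT (lt_geF X0) (negPf nsJ).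
rewrite subT_ah //; have yy := y2.
have a0 : 0 <= ah y (J - s) (subX n s) by rewrite ah_ge0 //; lra.
apply: (@le_trans _ _ (ah y (J - s) (subX n s))).
  by rewrite ler_piMl // ler_pdivrMr ?ltr0n // mul1r ler_nat leq_pred.
apply: le_trans (ah_ub _ y2 (ltW X0)) _.
rewrite le_eqVlt; apply/orP; left; apply/eqP; ring.
Qed.

(** Squaring doubles the rate to 2 - 2 / y = 1 + (1 - 2 / y); the surplus over 1 is at least kappa
    and absorbs the polynomial factor. This needs y > 2 strictly. *)
Lemma one_plus_sqr_le (X : R) : 0 <= X ->
  ((1 + X) * expR (- ((1 - y^-1) * X))) ^+ 2 <= 4 / kappa ^+ 2 * expR (- X).
Proof.
move=> X0; have kk := k0; have kk1 := k1; have kky := ky.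
have h : 1 + X <= 2 / kappa * expR (kappa * X / 2).
  apply: (@le_trans _ _ (2 / kappa * (1 + kappa * X / 2))).
    rewrite mulrDr mulr1 (_ : 2 / kappa * (kappa * X / 2) = X); last by field; lra.
    have : 1 <= kappa^-1 by rewrite -invr1 lef_pV2 ?posrE //; lra.
    lra.
  by rewrite ler_wpM2l ?expR_ge1Dx // divr_ge0 // ltW.
rewrite exprMn; apply: (@le_trans _ _ ((2 / kappa * expR (kappa * X / 2)) ^+ 2 *
    expR (- ((1 - y^-1) * X)) ^+ 2)).
  rewrite ler_wpM2r ?sqr_ge0 // lerXn2r ?nnegrE //; first by lra.
  by rewrite mulr_ge0 ?expR_ge0 // divr_ge0 // ltW.
rewrite exprMn -!expRM_natl (_ : (2 / kappa) ^+ 2 = 4 / kappa ^+ 2); last first.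
  by rewrite exprMn exprVn; congr (_ / _); rewrite expr2; lra.
rewrite -[leLHS]mulrA -expRD ler_wpM2l ?divr_ge0 ?sqr_ge0 // ler_expR.
have := ler_wpM2r X0 kky; lra.
Qed.

Definition second_moment_weight s : R :=
  2 ^+ s * expR (- (x0 + s%:R * y)) * (32 / kappa ^+ 2 * branch_sum s ^+ 2).

Lemma second_moment_weight_ge0 s : 0 <= second_moment_weight s.
Proof.
by rewrite !mulr_ge0 ?exprn_ge0 ?expR_ge0 ?branch_sum_ge0 // invr_ge0 sqr_ge0.
Qed.

(** e^(- X) = n e^(-(x0 + s y)) is linear in n, like [supF] at i = J = s. Hence the weight can be
    independent of n; 32 is 4 * 4 * 2, the last factor from n <= 2 (n - 1). *)
Lemma sub_phi_sqr_le n s : (3 <= n)%N -> 0 < subX n s ->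
  phi n s ^+ 2 <= second_moment_weight s * (n.-1%:R * 2 ^- s).
Proof.
move=> n3 X0; have n0 : (0 < n)%N by apply: leq_trans n3.
have np : 0 < n%:R :> R by rewrite ltr0n.
have b0 := branch_sum_ge0 s.
have p0 : 0 <= phi n s by apply: sub_phi_ge0.
have h1 := sub_phi_ub n0 X0.
have h2 := one_plus_sqr_le (ltW X0).
apply: (@le_trans _ _ ((2 * (1 + subX n s) * expR (- ((1 - y^-1) * subX n s)) * branch_sum s) ^+ 2)).
  by rewrite lerXn2r ?nnegrE // (le_trans p0).
rewrite (_ : (2 * _ * _ * _) ^+ 2 = 4 * branch_sum s ^+ 2 *
  ((1 + subX n s) * expR (- ((1 - y^-1) * subX n s))) ^+ 2); last by ring.
apply: le_trans (ler_wpM2l _ h2) _; first by rewrite mulr_ge0 ?sqr_ge0.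
have -> : expR (- subX n s) = expR (- (x0 + s%:R * y)) * n%:R.
  rewrite -(@lnK _ n%:R) ?posrE // -expRD; congr expR.
  by rewrite /sub_arg /lnr; ring.
rewrite /second_moment_weight.
have -> : 2 ^+ s * expR (- (x0 + s%:R * y)) * (32 / kappa ^+ 2 * branch_sum s ^+ 2) *
   (n.-1%:R / 2 ^+ s) = branch_sum s ^+ 2 * (16 / kappa ^+ 2) * expR (- (x0 + s%:R * y)) * (2 * n.-1%:R).
  by field; rewrite expf_neq0 ?pnatr_eq0 //= gt_eqF.
have nn : n%:R <= 2 * n.-1%:R :> R by rewrite -natrM ler_nat; move: n3; clear; lia.
have c0 : 0 <= branch_sum s ^+ 2 * (16 / kappa ^+ 2) * expR (- (x0 + s%:R * y)).
  by rewrite !mulr_ge0 ?expR_ge0 ?invr_ge0 ?sqr_ge0.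
apply: le_trans (ler_wpM2l c0 nn); rewrite le_eqVlt; apply/orP; left; apply/eqP.
by ring.
Qed.

Lemma sup_gam_start : 0 <= x0 ->
  sup_gam y x0 K M second_moment_weight 3 0 <=
   128 / kappa ^+ 2 * expR 1 * (2 + x0) *
     \sum_(s <- iota 1 (K + M)) branch_sum s ^+ 2 * isq R s.+1 ^+ 3 * theta y ^+ s.
Proof.
move=> x00; rewrite /sup_gam big_distrr /= big_seq_cond [leRHS]big_seq.
rewrite [leRHS](eq_bigl (fun s => (s \in iota 1 (K + M)) && (0 < s)%N)); last first.
  by move=> s /=; rewrite mem_iota; case: s => //= s; rewrite andbT.
apply: ler_sum => s _; have yy := y2.
have Xe : supX y (x0 + 1) 3 0 = x0 + 1 by rewrite /supX /= mul0r addr0 /lnr ln1 subr0.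
rewrite supF_ah //= ?Xe ?subn0; last by lra.
have h := @ah_ub R y s (x0 + 1) y2 (_ : 0 <= x0 + 1).
have {}h : ah y s (x0 + 1) <= 2 * (2 + x0) * isq R s.+1 ^+ 3 * theta y ^+ s.
  apply: le_trans (h _) _; first by lra.
  rewrite -[leRHS]mulr1 (_ : 1 + (x0 + 1) = 2 + x0); last by lra.
  rewrite ler_wpM2l //.
    by rewrite !mulr_ge0 ?exprn_ge0 ?isq_ge0 ?theta_ge0 //; lra.
  rewrite expR_le1 oppr_le0 mulr_ge0 //; last by lra.
  by rewrite subr_ge0 invf_le1; lra.
rewrite divr1 /second_moment_weight.
have -> : expR (x0 + 1 + s%:R * y) = expR (x0 + s%:R * y) * expR 1 by rewrite -expRD; congr expR; ring.
have e := expRxMexpNx_1 (x0 + s%:R * y).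
move: (expR (x0 + _)) (expR (- _)) e => u v uv.
have -> : 2 ^+ s * v * (32 / kappa ^+ 2 * branch_sum s ^+ 2) *
   (2 * (2 ^- s * (u * expR 1)) * ah y s (x0 + 1)) =
   (u * v) * (64 / kappa ^+ 2 * expR 1 * branch_sum s ^+ 2 * ah y s (x0 + 1)).
  by have kk := k0; field; rewrite expf_neq0 ?pnatr_eq0 //= gt_eqF.
rewrite uv mul1r.
have c0 : 0 <= 64 / kappa ^+ 2 * expR 1 * branch_sum s ^+ 2.
  apply: mulr_ge0; last exact: sqr_ge0.
  by apply: mulr_ge0; [rewrite divr_ge0 ?sqr_ge0 | exact: expR_ge0].
apply: le_trans (ler_wpM2l c0 h) _; rewrite le_eqVlt; apply/orP; left; apply/eqP; ring.
Qed.

Lemma sub_phi_start : x0 = 1 + lnr R 3 -> (0 < K)%N ->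
  expR (- 3) / (3 * y) * \sum_(J <- iota K M.+1) isq R J ^+ 3 * theta y ^+ J <= phi 3 0.
Proof.
move=> x0E K0; have yy := y2.
(* x0 is chosen so that the root line starts at distance 1 from the barrier at time 3. *)
have Xe : subX 3 0 = 1 by rewrite /sub_arg x0E mul0r; ring.
rewrite /sub_phi big_distrr [leLHS]big_seq [leRHS]big_seq; apply: ler_sum => J.
rewrite mem_iota => /andP[KJ _]; have J0 := leq_trans K0 KJ.
rewrite subT_ah ?Xe // subn0.
have := @ah_lb R y J 1 y2 J0 ler01; rewrite expr1n ler1n => /(_ J0).
rewrite !mulr1.
have th0 : 0 <= isq R J ^+ 3 * theta y ^+ J.
  by rewrite mulr_ge0 ?exprn_ge0 ?isq_ge0 ?theta_ge0 //; lra.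
have c0 : 0 <= expR (- 2) / (2 * y) by rewrite divr_ge0 ?expR_ge0 // mulr_ge0 //; lra.
have e1 : expR (- 1) <= expR (- (1 - y^-1)).
  by rewrite ler_expR lerN2 lerBlDr lerDl invr_ge0; lra.
move=> h; have h2 := le_trans (ler_wpM2l (mulr_ge0 c0 th0) e1).
have {}h : expR (- 2) / (2 * y) * (isq R J ^+ 3 * theta y ^+ J) * expR (- 1) <= ah y J 1.
  by apply: h2; apply: le_trans h; rewrite !mulrA.
have := ler_wpM2l (_ : 0 <= 2 / 3 :> R) h; rewrite divr_ge0 // => /(_ isT).
apply: le_trans; rewrite (_ : expR (- 3) = expR (- 2) * expR (- 1)); last first.
  by rewrite -expRD; congr expR; ring.
by rewrite /= le_eqVlt; apply/orP; left; apply/eqP; field; lra.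
Qed.
End PointwiseBounds.

(** * Numerical estimates *)

Section NumericSums.
Variable R : realType.
Local Notation isq := (isq R).

Lemma isq_cube_step n : (0 < n)%N -> isq n.+1 ^+ 3 <= 2 * (isq n - isq n.+1).
Proof.
move=> n0; have p0 := isq_gt0 R n0; have q0 := isq_gt0 R (ltn0Sn n).
have n1 : 0 < n%:R :> R by rewrite ltr0n.
have e : isq n ^+ 2 * (1 - isq n.+1 ^+ 2) = isq n.+1 ^+ 2.
  by rewrite !isq_sqr -natr1; field; rewrite ?gt_eqF //; lra.
have q1 : isq n.+1 ^+ 2 <= 1 by rewrite isq_sqr invf_le1 ?ler1n ?ltr0n.
move: (isq n) (isq n.+1) p0 q0 e q1 => p q p0 q0 e q1.
rewrite leNgt; apply/negP => h.
have pq : p < q + q ^+ 3 / 2 by lra.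
have : p ^+ 2 <= (q + q ^+ 3 / 2) ^+ 2 by rewrite lerXn2r ?nnegrE ?ltW // (lt_trans p0).
have q2 : 0 <= 1 - q ^+ 2 by lra.
move/(ler_wpM2r q2); rewrite e.
have -> : (q + q ^+ 3 / 2) ^+ 2 * (1 - q ^+ 2) = q ^+ 2 - q ^+ 6 * (3 / 4 + q ^+ 2 / 4) by field.
have : 0 < q ^+ 6 * (3 / 4 + q ^+ 2 / 4).
  by rewrite mulr_gt0 ?exprn_gt0 // addr_gt0 // divr_gt0 ?exprn_gt0.
lra.
Qed.

Lemma sum_isq_cube v k : (0 < v)%N -> \sum_(j <- iota v k) isq j ^+ 3 <= 3 * isq v.
Proof.
move=> v0; case: k => [|k]; first by rewrite big_nil mulr_ge0 ?isq_ge0.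
have h : \sum_(j <- iota v.+1 k) isq j ^+ 3 <= 2 * (isq v - isq (v + k)).
  elim: k => [|k IH]; first by rewrite big_nil addn0 subrr mulr0.
  rewrite -[k.+1]addn1 iotaD big_cat big_seq1 /= addn1 addnS addSn.
  have := isq_cube_step (ltn_addr k v0); lra.
rewrite /= big_cons.
have : isq v ^+ 3 <= isq v.
  have i1 : isq v <= 1 by rewrite -(isq1 R) isq_le.
  by rewrite -[leRHS]expr1 ler_wiXn2l // isq_ge0.
have := isq_ge0 R (v + k); lra.
Qed.

Lemma sum_isq_cube_filter K M s : \sum_(J <- iota K M.+1 | (s <= J)%N) isq (J - s).+1 ^+ 3
  <= 3 * isq (K - s).+1.
Proof.
have [sK|Ks] := leqP s K.
  rewrite big_seq_cond (eq_bigl (fun J => J \in iota K M.+1)); last first.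
    move=> J /=; apply: andb_idr; rewrite -/(iota K M.+1) mem_iota => /andP[KJ _].
    exact: leq_trans KJ.
  rewrite -big_seq.
  have -> : iota K M.+1 = [seq (s + i)%N | i <- iota (K - s) M.+1] by rewrite -iotaDl subnKC.
  rewrite big_map.
  have -> : \sum_(i <- iota (K - s) M.+1) isq (s + i - s).+1 ^+ 3 =
     \sum_(j <- iota (K - s).+1 M.+1) isq j ^+ 3.
    rewrite -[(K - s).+1]add1n iotaDl big_map; apply: eq_bigr => i _.
    by rewrite addKn.
  exact: sum_isq_cube.
have -> : (K - s = 0)%N by apply/eqP; rewrite subn_eq0 ltnW.
have [sM|Ms] := leqP s (K + M).
  have e : (K + (s - K) = s)%N by rewrite subnKC // ltnW.
  rewrite (_ : M.+1 = (s - K) + (K + M - s).+1)%N; last by move: Ks sM; clear; lia.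
  rewrite iotaD e big_cat /= [X in X + _]big_seq_cond [X in X + _]big1 ?add0r; last first.
    by move=> J; rewrite mem_iota e => /andP[/andP[_ h1] h2]; exfalso; move: h1 h2; clear; lia.
  rewrite -/(iota s (K + M - s).+1).
  rewrite big_seq_cond (eq_bigl (fun J => J \in iota s (K + M - s).+1)); last first.
    by move=> J /=; apply: andb_idr; rewrite -/(iota s _.+1) mem_iota => /andP[].
  rewrite -big_seq.
  have -> : iota s (K + M - s).+1 = [seq (s + i)%N | i <- iota 0 (K + M - s).+1].
    by rewrite -iotaDl addn0.
  rewrite big_map.
  have -> : \sum_(i <- iota 0 (K + M - s).+1) isq (s + i - s).+1 ^+ 3 =
     \sum_(j <- iota 1 (K + M - s).+1) isq j ^+ 3.
    rewrite -[1%N]addn0 iotaDl big_map; apply: eq_bigr => i _.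
    by rewrite addKn.
  exact: sum_isq_cube.
rewrite big_seq_cond big1 ?mulr_ge0 ?isq_ge0 // => J.
by rewrite mem_iota => /andP[/andP[_ h1] h2]; exfalso; move: h1 h2 Ms; clear; lia.
Qed.

(** The squared form is 1 / (s w) = (1 / K) (1 / s + 1 / w). *)
Lemma isq_split s w K : (0 < s)%N -> (0 < w)%N -> (s + w = K)%N ->
  isq s * isq w <= isq K * (isq s + isq w).
Proof.
move=> s0 w0 e; have K0 : (0 < K)%N by rewrite -e ltn_addr.
have a := isq_ge0 R s; have b := isq_ge0 R w; have c := isq_ge0 R K.
rewrite -(@ler_pXn2r _ 2) ?nnegrE ?mulr_ge0 ?addr_ge0 //.
rewrite !exprMn; apply: (@le_trans _ _ (isq K ^+ 2 * (isq s ^+ 2 + isq w ^+ 2))).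
  rewrite !isq_sqr -e natrD.
  have s1 : 0 < s%:R :> R by rewrite ltr0n.
  have w1 : 0 < w%:R :> R by rewrite ltr0n.
  rewrite le_eqVlt; apply/orP; left; apply/eqP; field; rewrite ?gt_eqF //; lra.
rewrite ler_wpM2l ?sqr_ge0 // sqrrD.
have := mulr_ge0 a b; lra.
Qed.

Lemma isq_conv_term b s w K : b \in [:: 1%N; 3%N] -> (0 < s)%N -> (0 < w)%N -> (s + w = K)%N ->
  isq s ^+ 3 * isq w ^+ b <= 4 * isq K ^+ b * (isq s ^+ 3 + isq w ^+ 3).
Proof.
move=> hb s0 w0 e; have h := isq_split s0 w0 e.
have := isq_ge0 R s; have := isq_ge0 R w; have := isq_ge0 R K.
move: (isq s) (isq w) (isq K) h => p q P h P0 q0 p0.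
have p3 : 0 <= p ^+ 3 by rewrite exprn_ge0.
have q3 : 0 <= q ^+ 3 by rewrite exprn_ge0.
have cub : p ^+ 2 * q <= p ^+ 3 + q ^+ 3.
  have [pq|qp] := leP p q.
    have : p ^+ 2 * q <= q ^+ 2 * q by rewrite ler_wpM2r // lerXn2r.
    by rewrite -[q ^+ 2 * q]exprSr; lra.
  have : p ^+ 2 * q <= p ^+ 2 * p by rewrite ler_wpM2l ?sqr_ge0 // ltW.
  by rewrite -[p ^+ 2 * p]exprSr; lra.
have cub' : p * q ^+ 2 <= p ^+ 3 + q ^+ 3.
  have [pq|qp] := leP p q.
    have : p * q ^+ 2 <= q * q ^+ 2 by rewrite ler_wpM2r ?sqr_ge0.
    by rewrite -exprS; lra.
  have : p * q ^+ 2 <= p * p ^+ 2 by rewrite ler_wpM2l // lerXn2r ?nnegrE // ltW.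
  by rewrite -exprS; lra.
move: hb; rewrite !inE => /orP[]/eqP->.
  rewrite !expr1; have := ler_wpM2l (sqr_ge0 p) h.
  have -> : p ^+ 2 * (p * q) = p ^+ 3 * q by ring.
  move/le_trans; apply.
  rewrite (_ : p ^+ 2 * (P * (p + q)) = P * (p ^+ 3 + p ^+ 2 * q)); last by ring.
  rewrite (_ : 4 * P * _ = P * (4 * (p ^+ 3 + q ^+ 3))); last by ring.
  by rewrite ler_wpM2l //; lra.
rewrite -exprMn; apply: (@le_trans _ _ ((P * (p + q)) ^+ 3)).
  by rewrite lerXn2r ?nnegrE ?mulr_ge0 ?addr_ge0.
rewrite exprMn (_ : 4 * P ^+ 3 * _ = P ^+ 3 * (4 * (p ^+ 3 + q ^+ 3))); last by ring.
rewrite ler_wpM2l ?exprn_ge0 //.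
have -> : (p + q) ^+ 3 = p ^+ 3 + 3 * (p ^+ 2 * q) + 3 * (p * q ^+ 2) + q ^+ 3 by ring.
have : p ^+ 2 * q + p * q ^+ 2 <= p ^+ 3 + q ^+ 3.
  rewrite -subr_ge0 (_ : _ - _ = (p - q) ^+ 2 * (p + q)); last by ring.
  by rewrite mulr_ge0 ?sqr_ge0 ?addr_ge0.
lra.
Qed.

(** Convolution with the summable sequence s^(-3/2) preserves the decay K^(-b/2): in every term one
    of the two indices is of order K. *)
Lemma sum_isq_conv b K : b \in [:: 1%N; 3%N] ->
  \sum_(s <- iota 1 K) isq s ^+ 3 * isq (K.+1 - s) ^+ b <= 24 * isq K.+1 ^+ b.
Proof.
move=> hb; have K3 := @sum_isq_cube 1 K isT; rewrite isq1 mulr1 in K3.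
have rev : \sum_(s <- iota 1 K) isq (K.+1 - s) ^+ 3 = \sum_(s <- iota 1 K) isq s ^+ 3.
  have -> : iota 1 K = index_iota 1 K.+1 by rewrite /index_iota subSS subn0.
  rewrite [RHS]big_nat_rev; apply: eq_big_nat => i _.
  by congr (isq _ ^+ 3); rewrite add1n subSS.
apply: (@le_trans _ _ (\sum_(s <- iota 1 K) 4 * isq K.+1 ^+ b * (isq s ^+ 3 + isq (K.+1 - s) ^+ 3))).
  rewrite big_seq [leRHS]big_seq; apply: ler_sum => s; rewrite mem_iota => /andP[s1 sK].
  apply: isq_conv_term => //; move: s1 sK; clear; lia.
rewrite -big_distrr /= big_split /= rev.
rewrite (_ : 24 * _ = 4 * isq K.+1 ^+ b * (3 + 3)); last by ring.
by rewrite ler_wpM2l ?mulr_ge0 ?exprn_ge0 ?isq_ge0 // lerD.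
Qed.

(** Weighted arithmetic-geometric inequality: with t = w / K, K^t 1^(1 - t) <= t K + (1 - t) <= w +
    1. The proof adds the two tangent inequalities of the exponential at t ln K. *)
Lemma lnr_concave w K : (0 < K)%N -> (w <= K)%N -> w%:R / K%:R * lnr R K <= lnr R w.+1.
Proof.
move=> K0 wK; have K1 : 0 < K%:R :> R by rewrite ltr0n.
set a := lnr R K; set t := w%:R / K%:R.
have t0 : 0 <= t by rewrite divr_ge0.
have t1 : t <= 1 by rewrite ler_pdivrMr // mul1r ler_nat.
rewrite -ler_expR (@lnK _ w.+1%:R) ?posrE ?ltr0n //.
set p := t * a; have ep := expR_gt0 p.
have h1 : expR p * (1 + (a - p)) <= K%:R.
  rewrite -[K%:R](@lnK _ _) ?posrE // -/(lnr R K) -/a.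
  have -> : expR a = expR p * expR (a - p) by rewrite -expRD; congr expR; ring.
  by rewrite ler_wpM2l ?expR_ge1Dx // ltW.
have h2 : expR p * (1 - p) <= 1.
  rewrite -[leRHS](expRxMexpNx_1 p).
  by rewrite ler_wpM2l ?expR_ge1Dx // ltW.
have h3 := ler_wpM2l t0 h1.
have h4 := ler_wpM2l (_ : 0 <= 1 - t) h2; rewrite subr_ge0 in h4; have {}h4 := h4 t1.
have e : t * K%:R = w%:R by rewrite divfK // gt_eqF.
have : expR p * (t * a - p) = 0 by rewrite subrr mulr0.
rewrite e in h3; rewrite -natr1; lra.
Qed.


(** * The lowered slope y = (1 + alpha)(1 - eps) and the two moment sums *)

Variables (alpha eps kappa : R) (b K M : nat).
Hypotheses (ha : 0 < alpha) (halpha : 2 * (alpha + 1) * expR (- alpha) - 1 = 0).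
Hypotheses (hb : (b == 1%N) || (b == 3%N) && (M == 0%N)) (K0 : (0 < K)%N) (MK : (M <= K)%N).
Hypothesis epsE : alpha * eps = b%:R / 2 * lnr R K / K%:R.
Hypotheses (eps0 : 0 <= eps) (eps1 : (1 + alpha) * eps <= (alpha - 1) / 2).
Hypothesis epsK : K%:R * eps ^+ 2 <= 1 / 2.
Hypothesis epsM : M%:R * (alpha * eps) <= 2.

Let y := (1 + alpha) * (1 - eps).
Let vt := expR (alpha * eps).

Lemma theta_shift : theta y = (1 - eps) * expR ((1 + alpha) * eps).
Proof.
have := theta_star halpha; rewrite /theta /y => h.
have -> : expR (1 - (1 + alpha) * (1 - eps)) = expR (1 - (1 + alpha)) * expR ((1 + alpha) * eps).
  by rewrite -expRD; congr expR; ring.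
transitivity (2 * (1 + alpha) * expR (1 - (1 + alpha)) *
  ((1 - eps) * expR ((1 + alpha) * eps))); first by ring.
by rewrite h mul1r.
Qed.

Lemma eps_half : eps <= 1 / 2.
Proof.
have e0 := eps0; have e1 := eps1; have a1 := alpha_gt1 ha halpha.
rewrite leNgt; apply/negP => h; nra.
Qed.

Lemma theta_le_vt : theta y <= vt.
Proof.
rewrite theta_shift /vt (_ : alpha * eps = - eps + (1 + alpha) * eps); last by ring.
by rewrite expRD ler_wpM2r ?expR_ge0 ?expR_ge1Dx.
Qed.

(** [theta] and [vt] agree up to second order in eps; with K eps^2 <= 1/2 their K-th powers differ
    by at most a factor e. *)
Lemma theta_ge : expR (alpha * eps - 2 * eps ^+ 2) <= theta y.
Proof.
have e0 := eps0; have e1 := eps_half.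
rewrite theta_shift (_ : alpha * eps - 2 * eps ^+ 2 = (- eps - 2 * eps ^+ 2) + (1 + alpha) * eps);
  last by ring.
rewrite expRD ler_wpM2r ?expR_ge0 //.
have p : 0 < 1 - eps by lra.
rewrite -[leRHS]invrK -[leLHS]invrK lef_pV2 ?posrE ?invr_gt0 ?expR_gt0 // -expRN.
have -> : (1 - eps)^-1 = 1 + eps / (1 - eps) by field; lra.
apply: le_trans (expR_ge1Dx _) _; rewrite ler_expR.
by rewrite ler_pdivrMr //; rewrite expr2; nra.
Qed.

Lemma theta_ge1 : 1 <= theta y.
Proof.
apply: le_trans theta_ge; rewrite -[leLHS]expR0 ler_expR.
have e0 := eps0; have e1 := eps_half; have a1 := alpha_gt1 ha halpha.
rewrite (_ : _ - _ = eps * (alpha - 2 * eps)); last by ring.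
by rewrite mulr_ge0 //; lra.
Qed.

Lemma vt_ge1 : 1 <= vt.
Proof. by rewrite -[leLHS]expR0 ler_expR mulr_ge0 // ltW. Qed.

(** This is the reason for [epsE]: the tilt gains K^(b/2) over K generations, offsetting K^(-3/2)
    entirely for b = 3 and down to 1 / K for b = 1. *)
Lemma vt_pow_K : vt ^+ K * isq K ^+ b = 1.
Proof.
rewrite isqE // -/(lnr R K) /vt -!expRM_natl -expRD -[RHS]expR0; congr expR.
rewrite epsE; field; rewrite gt_eqF // ltr0n //.
Qed.

Lemma vt_pow_le w : (w <= K)%N -> vt ^+ w * isq w.+1 ^+ b <= 1.
Proof.
move=> wK; rewrite isqE // -/(lnr R w.+1) /vt -!expRM_natl -expRD expR_le1.
have := lnr_concave K0 wK; have bb : 0 <= b%:R / 2 :> R by [].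
move/(ler_wpM2l bb); rewrite epsE; lra.
Qed.

Lemma vt_pow_M k : (k <= 2 * M)%N -> vt ^+ k <= expR 4.
Proof.
move=> kM; rewrite /vt -expRM_natl ler_expR.
have : k%:R <= 2 * M%:R :> R by rewrite -natrM ler_nat.
have e := epsM; have : 0 <= alpha * eps by rewrite mulr_ge0 // ltW.
nra.
Qed.

Lemma theta_pow_le j : theta y ^+ j <= vt ^+ j.
Proof.
rewrite lerXn2r ?nnegrE ?expR_ge0 ?theta_le_vt //.
by have := theta_ge1; lra.
Qed.

Lemma branch_sum_le s : (s <= K + M)%N ->
  branch_sum y K M s <= vt ^+ (K + M - s) * (3 * isq (K - s).+1 ^+ b).
Proof.
move=> sKM; have v1 := vt_ge1; have v0 : 0 <= vt by lra.
have h : branch_sum y K M s <= vt ^+ (K + M - s) *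
    \sum_(J <- iota K M.+1 | (s <= J)%N) isq (J - s).+1 ^+ 3.
  rewrite /branch_sum big_distrr [leLHS]big_seq_cond [leRHS]big_seq_cond.
  apply: ler_sum => J; rewrite mem_iota => /andP[/andP[_ JK] sJ].
  rewrite [leRHS]mulrC ler_wpM2l ?exprn_ge0 ?isq_ge0 //.
  apply: le_trans (theta_pow_le _) _; rewrite ler_weXn2l //.
  by move: JK; clear; lia.
apply: le_trans h _; rewrite ler_wpM2l ?exprn_ge0 //.
have := hb => /orP[/eqP->|/andP[/eqP-> /eqP M0]].
  by rewrite expr1; exact: sum_isq_cube_filter.
rewrite M0 addn0 in sKM *; rewrite big_cons sKM /= big_nil addr0.
have : 0 <= isq (K - s).+1 ^+ 3 by rewrite exprn_ge0 ?isq_ge0.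
lra.
Qed.

(** For s <= K the exponent of [vt] splits as K + 2 M + (K - s): the last part is cancelled by the
    decay of [branch_sum], the middle one costs e^4, and [vt ^+ K] is cancelled by the convolution
    bound. *)
Lemma second_moment_sum_le :
  \sum_(s <- iota 1 (K + M)) branch_sum y K M s ^+ 2 * isq s.+1 ^+ 3 * theta y ^+ s
    <= 225 * expR 4.
Proof.
have v1 := vt_ge1; have v0 : 0 <= vt by lra.
have th1 := theta_ge1; have y0 : 0 <= y.
  by have := eps_half; have a0 := ha; rewrite /y => ?; rewrite mulr_ge0 //; lra.
have e4 := expR_ge0 (4 : R).
have term s : (0 < s)%N -> (s <= K + M)%N ->
    branch_sum y K M s ^+ 2 * isq s.+1 ^+ 3 * theta y ^+ s <=
    9 * (vt ^+ (2 * (K + M - s) + s) * isq (K - s).+1 ^+ (2 * b)) * isq s ^+ 3.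
  move=> s0 sKM; have h := branch_sum_le sKM.
  have hs : branch_sum y K M s ^+ 2 <= (vt ^+ (K + M - s) * (3 * isq (K - s).+1 ^+ b)) ^+ 2.
    have bs : 0 <= branch_sum y K M s.
      by apply: sumr_ge0 => J _; rewrite mulr_ge0 ?exprn_ge0 ?isq_ge0 //; lra.
    by rewrite lerXn2r ?nnegrE // (le_trans bs).
  have is3 : isq s.+1 ^+ 3 <= isq s ^+ 3 by rewrite lerXn2r ?nnegrE ?isq_ge0 // isq_le.
  have tp := theta_pow_le s.
  have t0 : 0 <= theta y ^+ s by rewrite exprn_ge0 //; lra.
  have b0 : 0 <= branch_sum y K M s ^+ 2 by exact: sqr_ge0.
  have i0 : 0 <= isq s.+1 ^+ 3 by rewrite exprn_ge0 ?isq_ge0.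
  have := ler_pM (mulr_ge0 b0 i0) t0 (ler_pM b0 i0 hs is3) tp.
  move/le_trans; apply; rewrite le_eqVlt; apply/orP; left; apply/eqP.
  rewrite exprD (mulnC 2 (K + M - s)%N) (mulnC 2 b) !exprM.
  by move: (vt ^+ _) (isq (K - s).+1 ^+ b) (isq s) (vt ^+ s) => p q i v; ring.
have low : \sum_(s <- iota 1 K) branch_sum y K M s ^+ 2 * isq s.+1 ^+ 3 * theta y ^+ s
    <= 216 * expR 4.
  apply: (@le_trans _ _ (\sum_(s <- iota 1 K)
     9 * expR 4 * vt ^+ K * (isq s ^+ 3 * isq (K.+1 - s) ^+ b))).
    rewrite big_seq [leRHS]big_seq; apply: ler_sum => s; rewrite mem_iota => /andP[s1 sK].
    have sK' : (s <= K)%N by move: sK; clear; lia.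
    apply: le_trans (term s s1 (leq_trans sK' (leq_addr _ _))) _.
    have -> : (K.+1 - s = (K - s).+1)%N by rewrite subSn.
    have -> : (2 * (K + M - s) + s = K + (2 * M) + (K - s))%N by move: sK'; clear; lia.
    rewrite mul2n -addnn exprD !exprD.
    have i0 : 0 <= isq (K - s).+1 ^+ b by rewrite exprn_ge0 ?isq_ge0.
    have h1 := vt_pow_le (leq_subr s K); have h2 := vt_pow_M (leqnn (2 * M)).
    have p0 : 0 <= vt ^+ K by rewrite exprn_ge0.
    have p1 : 0 <= vt ^+ (2 * M) by rewrite exprn_ge0.
    have p2 : 0 <= vt ^+ (K - s) by rewrite exprn_ge0.
    have j0 : 0 <= isq s ^+ 3 by rewrite exprn_ge0 ?isq_ge0.
    rewrite mul2n -addnn exprD in h2 p1.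
    move: (vt ^+ K) (vt ^+ M * vt ^+ M) (vt ^+ (K - s)) (isq _ ^+ b) (isq s ^+ 3) h1 h2 p0 p1 p2 i0 j0.
    move=> A B C D E h1 h2 p0 p1 p2 i0 j0.
    rewrite (_ : 9 * _ * E = 9 * A * D * E * (B * (C * D))); last by ring.
    rewrite (_ : 9 * expR 4 * A * (E * D) = 9 * A * D * E * (expR 4 * 1)); last by ring.
    rewrite ler_wpM2l ?mulr_ge0 //; apply: ler_pM => //; exact: mulr_ge0.
  rewrite -big_distrr /=.
  have c0 : 0 <= 9 * expR 4 * vt ^+ K by rewrite !mulr_ge0 ?exprn_ge0.
  have hb' : b \in [:: 1%N; 3%N].
    by rewrite !inE; have := hb => /orP[->//|/andP[-> _]]; rewrite orbT.
  apply: le_trans (ler_wpM2l c0 (sum_isq_conv K hb')) _.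
  have ib : isq K.+1 ^+ b <= isq K ^+ b by rewrite lerXn2r ?nnegrE ?isq_ge0 // isq_le.
  have := ler_wpM2l (_ : 0 <= 216 * expR 4 * vt ^+ K) ib; rewrite !mulr_ge0 ?exprn_ge0 // => /(_ isT).
  rewrite -(mulrA _ _ (isq K ^+ b)) vt_pow_K mulr1; lra.
(* Beyond K there are terms only for b = 1: at most M <= K of them, each at most 9 e^4 / K. *)
have high : \sum_(s <- iota K.+1 M) branch_sum y K M s ^+ 2 * isq s.+1 ^+ 3 * theta y ^+ s
    <= 9 * expR 4.
  have := hb => /orP[/eqP b1|/andP[_ /eqP ->]]; last by rewrite big_nil mulr_ge0.
  apply: (@le_trans _ _ (\sum_(s <- iota K.+1 M) 9 * expR 4 * K%:R^-1)).
    rewrite big_seq [leRHS]big_seq; apply: ler_sum => s; rewrite mem_iota => /andP[s1 sK].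
    have s0 : (0 < s)%N by apply: leq_ltn_trans s1.
    have sKM : (s <= K + M)%N by move: sK; clear; lia.
    apply: le_trans (term s s0 sKM) _.
    have -> : (K - s = 0)%N by move: s1; clear; lia.
    rewrite isq1 expr1n mulr1.
    have h1 : vt ^+ (2 * (K + M - s) + s) <= vt ^+ K * expR 4.
      apply: (@le_trans _ _ (vt ^+ (K + 2 * M))).
        by rewrite ler_weXn2l //; move: s1 sKM; clear; lia.
      by rewrite exprD ler_wpM2l ?exprn_ge0 // vt_pow_M.
    have h2 : isq s ^+ 3 <= isq K ^+ 3.
      by rewrite lerXn2r ?nnegrE ?isq_ge0 // isq_le // ltnW.
    have h3 : vt ^+ K * isq K ^+ 3 = K%:R^-1.
      by have := vt_pow_K; rewrite b1 expr1 -isq_sqr exprSr mulrCA => ->; rewrite mulr1.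
    have := ler_pM (exprn_ge0 _ v0) (exprn_ge0 3 (isq_ge0 R s)) h1 h2.
    rewrite (_ : vt ^+ K * expR 4 * isq K ^+ 3 = expR 4 * (vt ^+ K * isq K ^+ 3)); last by ring.
    by rewrite h3 -!mulrA => h; rewrite ler_wpM2l // mulrA.
  rewrite big_const_seq count_predT size_iota iter_addr addr0 -[leLHS]mulr_natr.
  rewrite -[leRHS]mulr1 -mulrA ler_wpM2l ?mulr_ge0 //.
  by rewrite ler_pdivrMl ?ltr0n // mulr1 ler_nat.
rewrite iotaD add1n big_cat /=; lra.
Qed.

Lemma first_moment_sum_ge :
  expR (- 1) / 8 * (M.+1%:R * isq K ^+ 3 * vt ^+ K) <=
  \sum_(J <- iota K M.+1) isq J ^+ 3 * theta y ^+ J.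
Proof.
have v1 := vt_ge1; have v0 : 0 <= vt by lra.
have th1 := theta_ge1.
have hth : expR (- 1) * vt ^+ K <= theta y ^+ K.
  apply: (@le_trans _ _ (expR (alpha * eps - 2 * eps ^+ 2) ^+ K)); last first.
    rewrite lerXn2r ?nnegrE ?expR_ge0 ?theta_ge //; lra.
  by rewrite /vt -!expRM_natl -expRD ler_expR; have := epsK; lra.
apply: (@le_trans _ _ (\sum_(J <- iota K M.+1) expR (- 1) / 8 * isq K ^+ 3 * vt ^+ K)).
  rewrite big_const_seq count_predT size_iota iter_addr addr0 -[leRHS]mulr_natr.
  rewrite le_eqVlt; apply/orP; left; apply/eqP; ring.
rewrite big_seq [leRHS]big_seq; apply: ler_sum => J; rewrite mem_iota => /andP[KJ JK].
have i1 : isq K <= 2 * isq J.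
  apply: (@le_trans _ _ (2 * isq (2 * K))); last first.
    rewrite ler_wpM2l // isq_le //; first exact: leq_trans KJ.
    by move: JK MK; clear; lia.
  rewrite -(@ler_pXn2r _ 2) ?nnegrE ?mulr_ge0 ?isq_ge0 // exprMn !isq_sqr natrM.
  have k0 : 0 < K%:R :> R by rewrite ltr0n.
  have : 0 < K%:R^-1 :> R by rewrite invr_gt0.
  rewrite invfM expr2; lra.
have i3 : isq K ^+ 3 <= 8 * isq J ^+ 3.
  have -> : 8 * isq J ^+ 3 = (2 * isq J) ^+ 3 by rewrite exprMn; congr (_ * _); ring.
  by rewrite lerXn2r ?nnegrE ?mulr_ge0 ?isq_ge0.
have h4 : theta y ^+ K <= theta y ^+ J by rewrite ler_weXn2l.
have -> : expR (- 1) / 8 * isq K ^+ 3 * vt ^+ K = isq K ^+ 3 / 8 * (expR (- 1) * vt ^+ K) by ring.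
apply: ler_pM; rewrite ?mulr_ge0 ?exprn_ge0 ?expR_ge0 ?isq_ge0 //; lra.
Qed.

Hypotheses (k0 : 0 < kappa) (k1 : kappa <= 1) (ky : kappa <= 1 - 2 / y).

(** The maximum p^2 / (4 G) of eta p - eta^2 G over eta, for the constant parts of the first moment
    p and the second moment bound G. *)
Definition window_const : R := (expR (- 4) / (24 * (1 + alpha))) ^+ 2 /
  (4 * (128 / kappa ^+ 2 * expR 1 * (2 + (1 + lnr R 3)) * (225 * expR 4))).

Lemma on_time_window r : sub_arg y (1 + lnr R 3) (3 + r) (K + M) <= 0 ->
  on_time R (window_late y (1 + lnr R 3) K M) 3 r 0 <=
    1 - window_const * (M.+1%:R * isq K ^+ (3 - b)) ^+ 2.
Proof.
move=> Xr; have a1 := alpha_gt1 ha halpha; have e0 := eps0; have e1 := eps1; have a0 := ha.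
have y2 : 2 <= y by rewrite /y; lra.
have yu : y <= 1 + alpha by rewrite /y ler_piMr; lra.
set x0 := 1 + lnr R 3 in Xr *.
have x00 : 0 <= x0 by rewrite /x0 addr_ge0 // ln_ge0 // ler1n.
set G := 128 / kappa ^+ 2 * expR 1 * (2 + x0) * (225 * expR 4).
pose p := expR (- 4) / (24 * (1 + alpha)) * (M.+1%:R * isq K ^+ (3 - b)).
have p0 : 0 <= p.
  by rewrite !mulr_ge0 ?expR_ge0 ?invr_ge0 ?exprn_ge0 ?isq_ge0 //; lra.
have hphi : p <= sub_phi y x0 K M 3 0.
  apply: le_trans (@sub_phi_start R y x0 K M y2 (erefl _) K0).
  have h := first_moment_sum_ge.
  have c0 : 0 <= expR (- 3) / (3 * y) by rewrite divr_ge0 ?expR_ge0 //; lra.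
  apply: le_trans (ler_wpM2l c0 h).
  rewrite /p; have -> : isq K ^+ (3 - b) = isq K ^+ 3 * vt ^+ K.
    have b3 : (b <= 3)%N by have := hb => /orP[/eqP->|/andP[/eqP-> _]].
    by rewrite -{2}(subnK b3) exprD -mulrA [isq K ^+ b * _]mulrC vt_pow_K mulr1.
  have -> : expR (- 3) / (3 * y) * (expR (- 1) / 8 * (M.+1%:R * isq K ^+ 3 * vt ^+ K)) =
      expR (- 4) / (24 * y) * (M.+1%:R * (isq K ^+ 3 * vt ^+ K)).
    rewrite (_ : expR (- 4) = expR (- 3) * expR (- 1)); last by rewrite -expRD; congr expR; ring.
    by field; lra.
  rewrite ler_wpM2r ?mulr_ge0 ?exprn_ge0 ?isq_ge0 ?expR_ge0 //.
  by rewrite ler_wpM2l ?expR_ge0 // lef_pV2 ?posrE; lra.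
have G1 : 1 <= G.
  have kk : 1 <= (kappa ^+ 2)^-1.
    by rewrite -invr1 lef_pV2 ?posrE ?exprn_gt0 // exprn_ile1 // ltW.
  have ee1 : 1 <= expR 1 :> R by rewrite -[leLHS]expR0 ler_expR.
  have ee4 : 1 <= expR 4 :> R by rewrite -[leLHS]expR0 ler_expR.
  rewrite /G; move: (kappa ^+ 2)^-1 (expR 1) (expR 4) kk ee1 ee4 => A B C A1 B1 C1.
  have AB : 1 <= A * B by rewrite -[leLHS]mulr1 ler_pM.
  have ABC : 1 <= A * B * C by rewrite -[leLHS]mulr1 ler_pM.
  rewrite (_ : 128 * _ * _ * _ * _ = (128 * 225) * (2 + x0) * (A * B * C)); last by ring.
  nra.
have hgam : sup_gam y x0 K M (second_moment_weight y x0 kappa K M) 3 0 <= G.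
  apply: le_trans (sup_gam_start K M y2 k0 x00) _.
  rewrite /G ler_wpM2l ?second_moment_sum_le //.
  apply: mulr_ge0; last by lra.
  by apply: mulr_ge0; rewrite ?expR_ge0 // divr_ge0 ?sqr_ge0.
have p1 : p <= 1.
  have i1 : isq K <= 1 by rewrite -(isq1 R) isq_le.
  have hM : M.+1%:R * isq K ^+ (3 - b) <= 2.
    have := hb => /orP[/eqP->|/andP[/eqP-> /eqP->]]; last by rewrite subnn expr0 mulr1; lra.
    rewrite isq_sqr ler_pdivrMr ?ltr0n // -natrM ler_nat; move: MK K0; clear; lia.
  have c1 : expR (- 4) / (24 * (1 + alpha)) <= 1 / 2.
    have e4 : expR (- 4) <= 1 :> R by rewrite expR_le1; lra.
    rewrite ler_pdivrMr; lra.
  have c0 : 0 <= expR (- 4) / (24 * (1 + alpha)) by rewrite divr_ge0 ?expR_ge0; lra.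
  have h0 : 0 <= M.+1%:R * isq K ^+ (3 - b) by rewrite mulr_ge0 ?exprn_ge0 ?isq_ge0.
  by rewrite /p; nra.
(* The maximiser; p <= 1 <= G makes it an admissible thinning probability. *)
pose eta := p / (2 * G).
have eta01 : 0 <= eta <= 1.
  rewrite divr_ge0 //=; last by lra.
  by rewrite ler_pdivrMr; lra.
have /andP[eta0 eta1] := eta01.
have hD s : 0 <= second_moment_weight y x0 kappa K M s by apply: second_moment_weight_ge0.
have hS n s : (3 <= n)%N -> 0 < sub_arg y x0 n s -> sub_phi y x0 K M n s ^+ 2 <=
    second_moment_weight y x0 kappa K M s * (n.-1%:R * 2 ^- s).
  by move=> n3 Xs; apply: sub_phi_sqr_le.
have := on_time_le_second_moment y2 hD hS eta01 Xr; move/le_trans; apply.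
rewrite lerD2l lerN2.
have -> : window_const * (M.+1%:R * isq K ^+ (3 - b)) ^+ 2 = eta * p - eta ^+ 2 * G.
  rewrite /window_const -/x0 -/G /eta /p; move: (isq K ^+ _) (expR (- 4)) => u v.
  field; lra.
apply: lerB; first by rewrite ler_wpM2l.
by rewrite ler_wpM2l ?sqr_ge0.
Qed.
End NumericSums.

(** * Probability bounds at a fixed time *)

Section UpperAsymptotics.
Context (d : measure_display) (T : measurableType d) (R : realType).
Variables (P : probability T R) (U : nat -> T -> node) (alpha : R).
Hypotheses (hU : is_bst_process P U) (ha : 0 < alpha).
Hypothesis halpha : 2 * (alpha + 1) * expR (- alpha) - 1 = 0.
Local Notation beta := (beta_ alpha).
Local Notation h n w := (sat_level (bst_tree U n w)).

Definition excess n w : R := alpha * (h n w)%:R - beta * lnr R n.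
Definition lln n : R := ln (lnr R n).

Lemma lln_large (A : R) : exists n0, forall n, (n0 <= n)%N -> A <= lln n /\ (3 < n)%N.
Proof.
exists (maxn 4 (Num.truncn (expR (expR A))).+1) => n; rewrite geq_max => /andP[n4 nA].
split=> //; have n0 : 0 < n%:R :> R by rewrite ltr0n (leq_trans _ n4).
have e1 : expR (expR A) <= n%:R.
  apply/ltW; have := truncnS_gt (expR (expR A)); move/lt_le_trans; apply.
  by rewrite ler_nat.
have e2 : expR A <= lnr R n by rewrite -ler_expR lnK.
rewrite /lln -ler_expR lnK // posrE; apply: lt_le_trans e2; exact: expR_gt0.
Qed.

Lemma expR_lln n : 0 < lnr R n -> expR (lln n) = lnr R n.
Proof. by move=> l0; rewrite lnK. Qed.

Lemma lnr_pos n : (1 < n)%N -> 0 < lnr R n.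
Proof. by move=> n1; rewrite ln_gt0 // ltr1n. Qed.

Lemma lnr_sub2 n : (3 < n)%N -> lnr R n - 1 <= lnr R n.-2.
Proof.
case: n => [|[|n]] //= n3; have n1 : (0 < n)%N by move: n3; clear; lia.
have h1 := lnr_step_ub R n1; have h2 := lnr_step_ub R (ltn0Sn n).
have i1 : n%:R^-1 <= 2^-1 :> R by rewrite lef_pV2 ?posrE ?ltr0n // ler_nat; move: n3; clear; lia.
have i2 : n.+1%:R^-1 <= 2^-1 :> R by rewrite lef_pV2 ?posrE ?ltr0n // ler_nat; move: n3; clear; lia.
by move: h1 h2 i1 i2; move: (n%:R^-1) (n.+1%:R^-1) => u v; lra.
Qed.

(** 101 comes from rounding up (10 t)^2 when t >= 1, and 15^2 >= 2 * 101. *)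
Lemma isq_inv_cube_le l (t : R) : 1 <= t -> l%:R <= 101 * t ^+ 2 -> isq R (2 * l) ^- 3 <= 15 ^+ 3 * t ^+ 3.
Proof.
move=> t1 lt; rewrite -exprVn /isq invrK.
rewrite -exprMn.
rewrite lerXn2r ?nnegrE ?sqrtr_ge0 ?mulr_ge0 //; first by lra.
have t15 : 0 <= 15 * t by lra.
rewrite -[leRHS]ger0_norm // -sqrtr_sqr ler_wsqrtr // natrM exprMn.
have : 0 <= t ^+ 2 by rewrite sqr_ge0.
by move: (t ^+ 2) lt => u; rewrite -[15 ^+ 2]/(15 * 15); lra.
Qed.


Lemma isq_cube_le c t k : 0 < c -> expR t / c <= k%:R -> isq R k ^+ 3 <= expR (3 / 2 * ln c) * expR (- (3 / 2) * t).
Proof.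
move=> c0 hk; have k0 : 0 < k%:R :> R by apply: lt_le_trans hk; rewrite divr_gt0 ?expR_gt0.
have : t - ln c <= ln k%:R.
  rewrite -[t in t - _]expRK -ln_div ?posrE ?expR_gt0 //.
  by rewrite ler_ln ?posrE ?divr_gt0 ?expR_gt0.
rewrite isqE -?(ltr0n R) // -expRM_natl -expRD ler_expR.
by move: (ln k%:R) (ln c) => u v h; lra.
Qed.

Lemma upper_mul_le (u X x I i J j E e : R) : 0 <= u -> 0 <= X <= x -> 0 <= I <= i -> 0 <= J <= j ->
  0 <= E <= e -> 12 * u * X * I * J * E <= 12 * u * x * i * j * e.
Proof.
move=> u0 /andP[X0 Xx] /andP[I0 Ii] /andP[J0 Jj] /andP[E0 Ee].
by rewrite !ler_pM // ?mulr_ge0.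
Qed.

Lemma mixed_bound_le (c F Y G : R) : 0 <= c -> 0 <= F -> 0 <= Y -> G <= c * Y ->
  9 * F + G <= (9 + c) * (F + Y).
Proof.
move=> c0 F0 Y0 h; have hF : 0 <= c * F by apply: mulr_ge0.
by rewrite mulrDl !mulrDr; lra.
Qed.

End UpperAsymptotics.

(** The power t^4, with t = ln ln n, collects one factor t from the barrier height L and t^3 from
    the admissible final range, of width of order t. The decay (ln n)^(-3/2) comes from k being of
    order ln n. *)
Lemma excess_upper (d : measure_display) (T : measurableType d) (R : realType)
    (P : probability T R) (U : nat -> T -> node) (alpha : R) :
  is_bst_process P U -> 0 < alpha -> 2 * (alpha + 1) * expR (- alpha) - 1 = 0 ->
  exists (C : R) n0, 0 <= C /\ forall n (a : R), (n0 <= n)%N -> 0 <= a <= 3 / 2 ->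
  (P [set w | (excess U alpha n w <= a * lln R n)%R] <=
    (C * (expR (- 2 * lln R n) + lln R n ^+ 4 * expR ((a - 3 / 2) * lln R n)))%:E)%E.
Proof.
move=> hU ha halpha.
have a1 := alpha_gt1 ha halpha; have a0 := ha; have bm := beta_mul ha.
have /andP[b0 b1] := beta_itv ha halpha.
pose c1 := expR (3 / 2 * ln (2 * (1 + alpha))).
have uc0 : 0 <= upper_const alpha.
  by rewrite /upper_const; apply: mulr_ge0; [lra|exact: expR_ge0].
pose c2 := 12 * upper_const alpha * (9 + 2 * alpha) * c1 * 15 ^+ 3 * expR 1.
have c20 : 0 <= c2.
  rewrite /c2; apply: mulr_ge0; last exact: expR_ge0.
  apply: mulr_ge0; last by apply: exprn_ge0; lra.
  apply: mulr_ge0; last exact: expR_ge0.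
  by apply: mulr_ge0; [apply: mulr_ge0|lra].
have [n0 hn0] := lln_large (1 + 6 * (1 + alpha)).
exists (9 + c2), n0; split; first by lra.
move=> n a nn /andP[aa0 aa1]; have [t0 n4] := hn0 n nn.
have l0 : 0 < lnr R n by apply: lnr_pos; move: n4; clear; lia.
have tE := expR_lln l0.
have ls := lnr_sub2 R n4.
move: t0 tE; set t := lln R n => t0 tE.
have t1 : 1 <= t by lra.
have lt : 1 + t <= lnr R n by rewrite -tE expR_ge1Dx.
move: l0 ls tE lt; set l := lnr R n => l0 ls tE lt.
have at0 : 0 <= a * t by apply: mulr_ge0; lra.
have at1 : a * t <= 3 / 2 * t by rewrite ler_wpM2r; clear -t1 aa1; lra.
pose A := beta_ alpha * l + a * t.
have bl0 : 0 <= beta_ alpha * l by apply: mulr_ge0; lra.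
have A0 : 0 <= A by rewrite /A; lra.
(* The least level with alpha k > A, so that the event forces the saturation level below k. *)
pose k := (Num.truncn (A / alpha)).+1.
have Aa0 : 0 <= A / alpha by rewrite divr_ge0 // ltW.
have kA : alpha * k.-1%:R <= A.
  by rewrite mulrC -ler_pdivlMr //= truncn_le.
have Ak : A < alpha * k%:R.
  by rewrite mulrC -ltr_pdivrMr //; exact: truncnS_gt.
have kS : k%:R = k.-1%:R + 1 :> R by rewrite natr1.
have y0 : 0 < 1 + alpha by lra.
have kl : l / (2 * (1 + alpha)) <= k.-1%:R.
  rewrite ler_pdivrMr; last by lra.
  have h : l * alpha <= (k.-1%:R + 1) * (1 + alpha) * alpha.
    rewrite -[in X in X <= _]bm; have : A <= alpha * (k.-1%:R + 1) by rewrite -kS ltW.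
    rewrite -(ler_pM2r y0) /A => h.
    have : 0 <= a * t * (1 + alpha) by rewrite mulr_ge0 // ltW.
    by move: h; move: (a * t) (k.-1%:R) => u v; clear; lra.
  have {}h : l <= (k.-1%:R + 1) * (1 + alpha) by rewrite -(ler_pM2r a0).
  have : 2 * (1 + alpha) <= l by lra.
  by move: h; move: (k.-1%:R) => v; lra.
have k2 : (2 < k)%N.
  have : 3 <= l / (2 * (1 + alpha)) by rewrite ler_pdivlMr; clear -t0 lt a0; lra.
  by move=> h3; have := le_trans h3 kl; rewrite ler_nat; clear; lia.
pose L := 2 / beta_ alpha * t + 2.
have bi : beta_ alpha * (2 / beta_ alpha) = 2 by rewrite mulrC divfK //; lra.
have bi2 : 0 <= 2 / beta_ alpha <= 4.
  apply/andP; split; first by rewrite divr_ge0 //; lra.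
  by rewrite ler_pdivrMr; clear -b0; lra.
have L0 : 2 <= L by rewrite lerDr; apply: mulr_ge0; [case/andP: bi2|clear -t1; lra].
have L1 : L <= 4 * t + 2 by rewrite lerD2r; apply: ler_wpM2r; [clear -t1; lra|case/andP: bi2].
have eL : beta_ alpha * (L - 2) = 2 * t by rewrite /L addrK mulrA bi.
(* The largest final position is at most 4 t + 2 + 2 a t + 1 <= 10 t, and q dominates its square. *)
pose q := (Num.truncn ((10 * t) ^+ 2)).+1.
have q1 : (10 * t) ^+ 2 <= q%:R by apply/ltW; exact: truncnS_gt.
have q2 : q%:R <= 101 * t ^+ 2.
  rewrite /q -natr1; have : (Num.truncn ((10 * t) ^+ 2))%:R <= (10 * t) ^+ 2 by rewrite truncn_le sqr_ge0.
  have : 1 <= t ^+ 2 by rewrite exprn_ege1.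
  rewrite exprMn; have -> : 10 ^+ 2 = 100 :> R by rewrite -natrX.
  by move: (t ^+ 2) (_%:R) => u v; clear; lra.
have hX x : 1 <= x -> x <= supX (1 + alpha) L n k.-1 -> x ^+ 2 <= q%:R.
  move=> x1 xs; apply: le_trans q1; apply: lerXn2r; rewrite ?nnegrE; [by clear -x1; lra|by clear -t1; lra|].
  apply: le_trans xs _; rewrite /supX.
  have h : k.-1%:R * (1 + alpha) <= l + 2 * (a * t).
    rewrite -(ler_pM2r a0); have : alpha * k.-1%:R * (1 + alpha) <= A * (1 + alpha) by rewrite ler_wpM2r // ltW.
    rewrite /A; have : a * t * (1 + alpha) <= a * t * (2 * alpha).
      by apply: ler_wpM2l => //; clear -a1; lra.
    have : beta_ alpha * l * (1 + alpha) = l * alpha by rewrite mulrAC bm mulrC.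
    by move: (a * t) (k.-1%:R) => u v; clear; lra.
  by move: h L1 ls t1; move: (a * t) at0 at1 (k.-1%:R) => u at0 at1 v; clear -at0 at1; lra.
have mA : (P [set w | (excess U alpha n w <= a * t)%R] <= P [set w | (sat_level (bst_tree U n w) < k)%N])%E.
  apply: le_measure.
  - rewrite inE; exact: (measurable_bst_tree hU n (fun s => (alpha * (sat_level s)%:R - beta_ alpha * lnr R n <= a * t) : Prop)).
  - rewrite inE; exact: (measurable_bst_tree hU n (fun s => ((sat_level s) < k)%N : Prop)).
  - move=> w /= hw; rewrite -(ltr_nat R) -(ltr_pM2l a0); apply: le_lt_trans Ak.
    by move: hw; rewrite /excess /A -/l; clear; lra.
apply: le_trans mA _; apply: le_trans (sat_level_lt_bound ha halpha hU _ k2 _ _ hX) _ => //.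
- by move: n4; clear; lia.
- by clear -L0; lra.
rewrite lee_fin eL [-2 * t]mulNr.
have t3 : 0 <= t ^+ 3 by apply: exprn_ge0; clear -t1; lra.
have h := @upper_mul_le R (upper_const alpha) (1 + L + 2 * (1 + alpha)) ((9 + 2 * alpha) * t)
  (isq R k.-1 ^+ 3) (c1 * expR (- (3 / 2) * t)) (isq R (2 * q) ^- 3) (15 ^+ 3 * t ^+ 3)
  (expR (alpha * k.-1%:R - beta_ alpha * lnr R n.-2)) (expR (a * t) * expR 1) uc0.
have Y0 : 0 <= t ^+ 4 * expR ((a - 3 / 2) * t).
  by apply: mulr_ge0; [apply: exprn_ge0; clear -t1; lra|exact: expR_ge0].
have F0 := expR_ge0 (- (2 * t)).
have {}h : 12 * upper_const alpha * (1 + L + 2 * (1 + alpha)) * isq R k.-1 ^+ 3 /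
    isq R (2 * q) ^+ 3 * expR (alpha * k.-1%:R - beta_ alpha * lnr R n.-2) <=
   c2 * (t ^+ 4 * expR ((a - 3 / 2) * t)).
  apply: le_trans (h _ _ _ _) _.
  - apply/andP; split; first by clear -L0 a0; lra.
    have ta : 0 <= (t - 1) * alpha by apply: mulr_ge0; [rewrite subr_ge0|exact: ltW].
    by clear -t1 L1 a0 ta; lra.
  - apply/andP; split; first by apply: exprn_ge0; exact: isq_ge0.
    by apply: isq_cube_le; [clear -a0; lra|rewrite tE].
  - apply/andP; split; first by rewrite invr_ge0; apply: exprn_ge0; exact: isq_ge0.
    exact: isq_inv_cube_le.
  - apply/andP; split; first exact: expR_ge0.
    rewrite -expRD ler_expR; have bl : beta_ alpha * (l - 1) <= beta_ alpha * lnr R n.-2.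
      by apply: ler_wpM2l => //; clear -b0; lra.
    by move: kA; rewrite /A; clear -b1 bl; lra.
  have -> : (a - 3 / 2) * t = - (3 / 2) * t + a * t by ring.
  rewrite expRD /c2; clearbody c1; move: (expR _) (expR _) (expR _) => u v e.
  by rewrite le_eqVlt; apply/orP; left; apply/eqP; ring.
exact: mixed_bound_le.
Qed.

Section LatePropagation.
Context (R : realType) (late : nat -> nat -> bool).

Lemma on_time_shift m n r i :
  on_time R (fun n i => late n (i - m)) n r (i + m) = on_time R late n r i.
Proof.
elim: r n i => [|r IH] n i /=; first by rewrite addnK.
by rewrite addnK IH -addSn IH.
Qed.

End LatePropagation.

Section Growth.
Context (R : realType).
Implicit Types (c delta s : R).

Lemma pow_le_expR k c delta : 0 < c -> 0 < delta ->
  exists s0 : R, forall s, s0 <= s -> s ^+ k <= c * expR (delta * s).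
Proof.
move=> c0 d0; pose e := delta / k.+1%:R.
have e0 : 0 < e by rewrite divr_gt0 // ltr0n.
exists (1 + e ^- k.+1 / c) => s hs.
have q0 : 0 <= e ^- k.+1 / c by rewrite divr_ge0 ?invr_ge0 ?exprn_ge0 // ltW.
have s0 : 0 < s by lra.
have h1 : (e * s) ^+ k.+1 <= expR (delta * s).
  have -> : delta * s = k.+1%:R * (e * s) by rewrite mulrA /e mulrC [_ * (_ / _)]mulrC divfK ?pnatr_eq0 // mulrC.
  rewrite expRM_natl lerXn2r ?nnegrE ?expR_ge0 ?mulr_ge0 ?ltW //.
  by apply: lt_le_trans (expR_ge1Dx _); rewrite ltrDr.
rewrite exprMn [s ^+ _]exprSr in h1.
have h2 : e ^- k.+1 <= c * s by rewrite mulrC -ler_pdivrMr //; lra.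
have sk : 0 <= s ^+ k by rewrite exprn_ge0 // ltW.
have ek : 0 < e ^+ k.+1 by rewrite exprn_gt0.
rewrite -(ler_pM2r s0); apply: le_trans (_ : e ^- k.+1 * expR (delta * s) <= _).
  by rewrite ler_pdivlMl.
by rewrite mulrAC ler_wpM2r // expR_ge0.
Qed.

Lemma exp2_ge s : expR ((s - 1) / 2) <= 2 ^+ Num.truncn s.
Proof.
have h2 : expR (1 / 2) <= 2 :> R.
  have := expR_ge1Dx (- (1 / 2) : R); rewrite expRN => h.
  have e0 := expR_gt0 (1 / 2 : R).
  by move: h; rewrite -(ler_pM2l e0) mulfV ?gt_eqF //; lra.
apply: le_trans (_ : expR (1 / 2) ^+ Num.truncn s <= _).
  rewrite -expRM_natl ler_expR; have := truncnS_gt s; rewrite -natr1.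
  by move: (_%:R) => v; lra.
by rewrite lerXn2r ?nnegrE ?expR_ge0.
Qed.

End Growth.

(** * Amplification over the subtrees at generation m *)

Section LowerAsymptotics.
Context (d : measure_display) (T : measurableType d) (R : realType).
Variables (P : probability T R) (U : nat -> T -> node) (alpha : R).
Hypotheses (hU : is_bst_process P U) (ha : 0 < alpha).
Hypothesis halpha : 2 * (alpha + 1) * expR (- alpha) - 1 = 0.
Local Notation beta := (beta_ alpha).
Local Notation h n w := (sat_level (bst_tree U n w)).

Lemma sat_level_mono n m w : (n <= m)%N -> (h n w <= h m w)%N.
Proof.
move=> nm; have sub : {subset bst_tree U n w <= bst_tree U m w} /\
    (size (bst_tree U n w) <= size (bst_tree U m w))%N.
  rewrite /bst_tree -(subnKC (_ : n.-1 <= m.-1)%N); last by move: nm; clear; lia.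
  rewrite iotaD map_cat; move: [seq U i w | i <- iota 0 _] [seq U i w | i <- iota (0 + _) _] => s1 s2.
  rewrite /tree_of foldl_cat; move: (foldl _ _ s1) => t.
  elim: s2 t => [|u s2 IH] t /=; first by split.
  have [h1 h2] := IH (t ++ [:: rcons u false; rcons u true]).
  split; first by move=> v vt; apply: h1; rewrite mem_cat vt.
  by apply: leq_trans h2; rewrite size_cat leq_addr.
case: sub; move: (bst_tree U n w) (bst_tree U m w) => s t st sz.
apply/bigmax_leqP => k /forallP sat.
have kt : (k < (size t).+1)%N by rewrite ltnS (leq_trans _ sz) // -ltnS.
by rewrite (leq_bigmax_cond (Ordinal kt)) //; apply/forallP => u; exact: st.
Qed.

(* Saturating a level beyond J + m requires it in each of the 2 ^ m subtrees rooted at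
   generation m; hence the power 2 ^ m of the single-tree bound. *)
Lemma window_prob (eps kappa : R) (b K M m : nat) (E : set T) :
  (b == 1%N) || (b == 3%N) && (M == 0%N) -> (0 < K)%N -> (M <= K)%N ->
  alpha * eps = b%:R / 2 * lnr R K / K%:R -> 0 <= eps ->
  (1 + alpha) * eps <= (alpha - 1) / 2 -> K%:R * eps ^+ 2 <= 1 / 2 ->
  M%:R * (alpha * eps) <= 2 -> 0 < kappa -> kappa <= 1 ->
  kappa <= 1 - 2 / ((1 + alpha) * (1 - eps)) -> (2 <= m)%N -> measurable E ->
  (forall w n J, E w -> (0 < n)%N -> (K <= J <= K + M)%N ->
     1 + lnr R 3 + J%:R * ((1 + alpha) * (1 - eps)) <= lnr R n -> (J + m < h n w)%N) ->
  (P E <= (expR (- (window_const alpha kappa * (M.+1%:R * isq R K ^+ (3 - b)) ^+ 2 * 2 ^+ m)))%:E)%E.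
Proof.
move=> hb K0 MK he e0 h1 h2 h3 k0 k1 k2 m2 mE hE.
set y := (1 + alpha) * (1 - eps) in k2 hE.
set x0 := 1 + lnr R 3 in hE.
pose late n i := window_late y x0 K M n i.
(* Generations are counted from m; truncated subtraction gives the shallower leaves the status of
   generation 0, as monotonicity requires. *)
pose late' n i := late n (i - m)%N.
have down n i : late' n i.+1 -> late' n i.
  rewrite /late'; case: (leqP m i) => im; first by rewrite subSn // => /window_late_down.
  by have -> : (i - m = i.+1 - m)%N by move: im; clear; lia.
(* A horizon by which the barrier has passed the whole window. *)
pose r := (Num.truncn (expR (x0 + (K + M)%:R * y))).+1.
have hr : sub_arg y x0 (3 + r) (K + M) <= 0.
  rewrite /sub_arg subr_le0 -[leLHS]expRK ler_ln ?posrE ?expR_gt0 ?ltr0n //.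
  apply/ltW; apply: lt_le_trans (truncnS_gt _) _.
  by rewrite ler_nat -/r leq_addl.
have hw := on_time_window ha halpha hb K0 MK he e0 h1 h2 h3 k0 k1 k2 hr.
set u := window_const _ _ * _ in hw *.
have ot0 : 0 <= on_time R late 3 r 0 by have /andP[] := on_time_itv R late r 0 (isT : (0 < 3)%N).
apply: le_trans (_ : (on_time R late' 1 r.+2 0)%:E <= _)%E.
  apply: le_trans (on_time_law hU down r.+2).
  apply: le_measure; rewrite ?inE //; last first.
    move=> w Ew n i /andP[n0 _] /hasP[J]; rewrite mem_iota => /andP[KJ JM] /andP[iJ XJ].
    have := hE w n J Ew n0 _ _; rewrite KJ /= => /(_ _ _) hh.
    have : (J + m < h n w)%N.
      by apply: hh; [move: JM; clear; lia|move: XJ; rewrite /sub_arg subr_le0].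
    by move: iJ; clear; lia.
  set F := [set w | _]; have -> : F = \bigcap_(n in setT) [set w | forall i, (0 < n <= r.+3)%N -> late' n i ->
       (i < h n w)%N].
    by apply/seteqP; split=> [w Fw n _ i|w Fw n i]; [exact: Fw|exact: (Fw n I)].
  apply: bigcap_measurableType => n _.
  exact: (measurable_bst_tree hU n (fun t => forall i, (0 < n <= r.+3)%N -> late' n i -> (i < sat_level t)%N)).
rewrite lee_fin; apply: le_trans (on_time_bound R down r m2) _.
rewrite -[X in on_time _ _ _ _ X]add0n on_time_shift.
apply: le_trans (_ : expR (- u) ^+ (2 ^ m) <= _).
  rewrite lerXn2r ?nnegrE ?expR_ge0 //; apply: le_trans hw _.
  exact: expR_ge1Dx.
by rewrite -expRM_natl ler_expR natrX mulrN mulrC.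
Qed.

Lemma window_const_gt0 kappa : 0 < kappa -> 0 < window_const alpha kappa.
Proof.
move=> k0; have a0 := ha; have y0 : 0 < 24 * (1 + alpha) by lra.
have l3 : 0 <= lnr R 3 by rewrite ln_ge0 // ler1n.
rewrite /window_const; apply: divr_gt0.
  by apply: exprn_gt0; apply: divr_gt0 => //; exact: expR_gt0.
apply: mulr_gt0; first by lra.
apply: mulr_gt0; last by apply: mulr_gt0; [rewrite ltr0n|exact: expR_gt0].
apply: mulr_gt0; last by lra.
apply: mulr_gt0; last exact: expR_gt0.
by apply: divr_gt0; [rewrite ltr0n|exact: exprn_gt0].
Qed.

End LowerAsymptotics.

(** The barrier of [window_prob] multiplied by beta, with beta (1 + alpha) = alpha and eps
    eliminated. All smallness conditions on eps follow from (ln K)^2 being small against K, so c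
    depends on alpha only. *)
Lemma window_prob_large (d : measure_display) (T : measurableType d) (R : realType)
    (P : probability T R) (U : nat -> T -> node) (alpha : R) :
  is_bst_process P U -> 0 < alpha -> 2 * (alpha + 1) * expR (- alpha) - 1 = 0 ->
  exists (c : R) K0, 0 < c /\ forall (b K M m : nat) (E : set T),
  (b == 1%N) || (b == 3%N) && (M == 0%N) -> (K0 <= K)%N -> M%:R * lnr R K <= K%:R ->
  (2 <= m)%N -> measurable E ->
  (forall w n J, E w -> (0 < n)%N -> (K <= J <= K + M)%N ->
     beta_ alpha + alpha * J%:R - b%:R / 2 * lnr R K * (J%:R / K%:R) <= beta_ alpha * lnr R n -> (J + m < sat_level (bst_tree U n w))%N) ->
  (P E <= (expR (- (c * (M.+1%:R * isq R K ^+ (3 - b)) ^+ 2 * 2 ^+ m)))%:E)%E.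
Proof.
move=> hU ha halpha.
have a1 := alpha_gt1 ha halpha; have a0 := ha; have bm := beta_mul ha.
have /andP[b0 b1] := beta_itv ha halpha.
(* This is 1 - 2 / y at y = (alpha + 3) / 2, a lower bound for every slope that occurs. *)
pose kappa := (alpha - 1) / (alpha + 3).
pose e0 := (alpha - 1) / (9 * (1 + alpha)).
have e00 : 0 < e0 by rewrite divr_gt0 //; lra.
have e0E : e0 * (1 + alpha) = (alpha - 1) / 9.
  by rewrite /e0; field; rewrite gt_eqF //; lra.
have e01 : e0 <= 1 / 9 by rewrite ler_pdivrMr; lra.
have [s0 hs0] := @pow_le_expR R 2 e0 1 e00 ltr01.
have k0 : 0 < kappa by rewrite divr_gt0 //; lra.
pose K0 := (Num.truncn (expR (1 + `|s0|))).+1.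
exists (window_const alpha kappa), K0; split; first exact: window_const_gt0.
move=> b K M m E hb KK MK m2 mE hE.
have eK : expR (1 + `|s0|) <= K%:R.
  by apply/ltW; apply: lt_le_trans (truncnS_gt _) _; rewrite ler_nat.
have K0' : 0 < K%:R :> R by apply: lt_le_trans eK; exact: expR_gt0.
have sK : 1 + `|s0| <= lnr R K by rewrite -ler_expR lnK.
have s1 : 1 <= lnr R K by apply: le_trans sK; rewrite lerDl.
have := hs0 (lnr R K) _; rewrite mul1r lnK ?posrE // => /(_ _) hK.
have {}hK : lnr R K ^+ 2 <= e0 * K%:R by apply: hK; have := ler_norm s0; lra.
have hK1 : lnr R K <= e0 * K%:R.
  by apply: le_trans hK; rewrite expr2 ler_peMl //; lra.
have b3 : 0 <= (b%:R / 2 : R) <= 3 / 2.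
  by case/orP: hb => [/eqP->|/andP[/eqP-> _]]; apply/andP; split; clear; lra.
pose v := lnr R K / K%:R.
have v0 : 0 <= v by rewrite divr_ge0 //; lra.
have v1 : v <= e0 by rewrite ler_pdivrMr.
have v2 : v ^+ 2 * K%:R <= e0.
  by rewrite /v expr_div_n [K%:R ^+ 2]expr2 invfM mulrA mulfVK ?gt_eqF // ler_pdivrMr.
pose eps := b%:R / 2 * v / alpha.
have aE : alpha * eps = b%:R / 2 * v by rewrite mulrC /eps divfK // gt_eqF.
move: b3 => /andP[b30 b31].
have bv0 : 0 <= b%:R / 2 * v by apply: mulr_ge0.
have bv1 : b%:R / 2 * v <= 3 / 2 * v by rewrite ler_wpM2r.
have eps0 : 0 <= eps by rewrite divr_ge0 // ltW.
have eps1 : eps <= 3 / 2 * v.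
  by rewrite ler_pdivrMr //; apply: le_trans bv1 _; rewrite ler_peMr; clear -v0 a1; lra.
have hy : (1 + alpha) * eps <= (alpha - 1) / 2.
  apply: le_trans (_ : (1 + alpha) * (3 / 2 * e0) <= _); last by clear -e0E a1; lra.
  by apply: ler_wpM2l; clear -a0 eps1 v1; lra.
have KN : (0 < K)%N by rewrite -(ltr0n R).
have ML : M%:R * v <= 1 by rewrite /v mulrA ler_pdivrMr // mul1r.
have y3 : (alpha + 3) / 2 <= (1 + alpha) * (1 - eps) by clear -hy; lra.
have y30 : 0 < (alpha + 3) / 2 by clear -a0; lra.
apply: (window_prob hU ha halpha (eps := eps) (kappa := kappa) (b := b)) => //.
- rewrite -(ler_nat R); apply: le_trans MK.
  by rewrite ler_peMr.
- by rewrite aE /v mulrA.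
- have : eps ^+ 2 <= (3 / 2 * v) ^+ 2 by rewrite lerXn2r ?nnegrE //; clear -v0; lra.
  move/(ler_wpM2l (ltW K0')) => hh; apply: le_trans hh _.
  by rewrite exprMn; clear -v2 e01; lra.
- rewrite aE mulrCA; apply: le_trans (_ : 3 / 2 * 1 <= _); last by clear; lra.
  by rewrite ler_pM // mulr_ge0.
- by rewrite ler_pdivrMr; clear -a0; lra.
- apply: le_trans (_ : 1 - 2 / ((alpha + 3) / 2) <= _).
    by rewrite /kappa le_eqVlt; apply/orP; left; apply/eqP; field; rewrite gt_eqF //; clear -a1; lra.
  rewrite lerD2l lerN2 ler_wpM2l // lef_pV2 ?posrE //.
  by apply: lt_le_trans y3.
- move=> w n J Ew n0 KJ hJ; apply: hE => //.
  have l3 : 0 <= lnr R 3 by rewrite ln_ge0 // ler1n.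
  have bb : 0 <= beta_ alpha by clear -b0; lra.
  have := ler_wpM2l bb hJ; apply: le_trans.
  have bl3 : 0 <= beta_ alpha * lnr R 3 by rewrite mulr_ge0.
  have -> : b%:R / 2 * lnr R K * (J%:R / K%:R) = J%:R * (alpha * eps).
    by rewrite aE /v; ring.
  have -> : beta_ alpha * (1 + lnr R 3 + J%:R * ((1 + alpha) * (1 - eps))) =
    beta_ alpha + beta_ alpha * lnr R 3 + J%:R * ((beta_ alpha * (1 + alpha)) * (1 - eps)) by ring.
  rewrite bm; move: (J%:R) (lnr R 3) bl3 => j l bl3.
  have -> : j * (alpha * (1 - eps)) = alpha * j - j * (alpha * eps) by ring.
  by clear -bl3; lra.
Qed.

Section LowerTails.
Context (d : measure_display) (T : measurableType d) (R : realType).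
Variables (P : probability T R) (U : nat -> T -> node) (alpha : R).
Hypotheses (hU : is_bst_process P U) (ha : 0 < alpha).
Hypothesis halpha : 2 * (alpha + 1) * expR (- alpha) - 1 = 0.
Local Notation beta := (beta_ alpha).
Local Notation h n w := (sat_level (bst_tree U n w)).

(** Shows that a number m of generations proportional to s, hence a shift of the level within the
    eps margin, suffices for 2^m to beat any fixed power of s. *)
Lemma pow_le_exp2 k (c delta : R) : 0 < c -> 0 < delta -> exists s0 : R, forall s, s0 <= s ->
  s ^+ k <= c * 2 ^+ Num.truncn (delta * s) /\ (2 <= Num.truncn (delta * s))%N.
Proof.
move=> c0 d0; have d20 : 0 < delta / 2 by lra.
have c20 : 0 < c * expR (- (1 / 2)) by rewrite mulr_gt0 ?expR_gt0.
have [s0 hs0] := @pow_le_expR R k _ _ c20 d20.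
exists (`|s0| + 2 / delta) => s hs; split.
  apply: le_trans (hs0 _ _) _.
    by apply: le_trans hs; apply: le_trans (ler_norm _) _; rewrite lerDl divr_ge0 // ltW.
  rewrite -mulrA -expRD; apply: ler_wpM2l; first exact: ltW.
  apply: le_trans (exp2_ge _).
  by rewrite ler_expR; lra.
have h2 : 2 <= delta * s.
  rewrite mulrC -ler_pdivrMr //; apply: le_trans hs; rewrite lerDr; exact: normr_ge0.
have := truncnS_gt (delta * s); move/(le_lt_trans h2).
by rewrite (ltr_nat R 2).
Qed.

Lemma lin_cancel (b a v t x x' : R) : 0 <= b -> b + a - 3%N%:R / 2 * v <= x' ->
  x + 3 / 2 * t < a -> v <= t -> x <= x'.
Proof. by move=> *; lra. Qed.

Lemma level_cancel (x t K m q eps : R) : alpha * (K - 1) <= x + 3 / 2 * t ->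
  (3 / 2 + eps) * t < alpha * q - x -> 2 * alpha <= eps * t -> alpha * m <= eps / 2 * t ->
  alpha * (K + m) < alpha * q.
Proof. by move=> *; lra. Qed.

(** A level J >= K is late only at times with ln n >= K. Such times lie beyond any fixed N and
    satisfy ln ln n >= ln K. *)
Lemma late_time_ge (a b K J s x l : R) : 1 <= s -> 1 < a -> 1 / 2 < b -> b * (1 + a) = a -> K <= J ->
  s * x <= s + 1 -> b + a * J - 1%N%:R / 2 * s * x <= b * l -> s + 1 <= K -> K <= l.
Proof.
move=> s1 a1 b0 ba KJ sx hl sK; have bp : 0 < b by lra.
have h1 : a * K <= a * J by rewrite ler_wpM2l //; lra.
have h2 : b * (1 + a) * K <= b * l + (s + 1) / 2 - b.
  rewrite ba; have : 1%N%:R / 2 * s * x <= (s + 1) / 2 by rewrite -mulrA; lra.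
  by lra.
rewrite -(ler_pM2l bp).
have h3 : (s + 1) / 2 <= b * K.
  apply: le_trans (_ : 1 / 2 * K <= _); first by lra.
  by apply: ler_wpM2r; lra.
have : b * K * 1 <= b * K * a by apply: ler_wpM2l; lra.
by lra.
Qed.

Lemma late_level_gt (a b J s x l eps t q m : R) : 0 < eps -> 1 / 2 < b ->
  s * x <= s + 1 -> b + a * J - 1%N%:R / 2 * s * x <= b * l -> s <= t ->
  (1 / 2 + eps) * t < a * q - b * l -> a * m <= eps * s -> a * (J + m) < a * q.
Proof.
move=> e0 b0 sx hl st hq ma.
have h1 : (1 / 2 + eps) * s <= (1 / 2 + eps) * t by rewrite ler_wpM2l //; lra.
have : 1%N%:R / 2 * s * x <= (s + 1) / 2 by rewrite -mulrA; lra.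
by lra.
Qed.

Lemma measurable_excess n (p : set R) : measurable [set w | p (excess U alpha n w)].
Proof. exact: (measurable_bst_tree hU n (fun t => p (alpha * (sat_level t)%:R - beta * lnr R n))). Qed.

End LowerTails.

(** Uses the single level K with b = 3. If the excess is too large at time n, level K + m is
    saturated then; as the barrier reaches K only at times n' >= n, monotonicity gives the event of
    [window_prob_large]. *)
Lemma excess_lower (d : measure_display) (T : measurableType d) (R : realType)
    (P : probability T R) (U : nat -> T -> node) (alpha : R) :
  is_bst_process P U -> 0 < alpha -> 2 * (alpha + 1) * expR (- alpha) - 1 = 0 ->
  forall (eps : R), 0 < eps -> exists n0, forall n, (n0 <= n)%N ->
  (P [set w | ((3 / 2 + eps) * lln R n < excess U alpha n w)%R] <= (expR (- 2 * lln R n))%:E)%E.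
Proof.
move=> hU ha halpha eps.
move=> eps0; have a1 := alpha_gt1 ha halpha; have a0 := ha; have bm := beta_mul ha.
have /andP[b0 b1] := beta_itv ha halpha.
have [c [K0 [c0 hW]]] := window_prob_large hU ha halpha.
pose delta := eps / (2 * alpha).
have d0 : 0 < delta by rewrite divr_gt0 //; lra.
have dE : alpha * delta = eps / 2 by rewrite /delta; field; rewrite gt_eqF.
have c20 : 0 < c / 2 by lra.
have [s0 hs0] := @pow_le_exp2 R 1 _ _ c20 d0.
pose A : R := `|s0| + 12 + (1 + alpha) * K0%:R + 2 * alpha / eps.
have [n0 hn0] := lln_large A.
exists n0 => n nn; have [] := hn0 n nn.
have q1 : 0 <= (1 + alpha) * K0%:R by rewrite mulr_ge0 //; lra.
have q2 : 0 <= 2 * alpha / eps by rewrite divr_ge0 //; lra.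
have q3 := normr_ge0 s0; have q4 := ler_norm s0.
rewrite /A => tA n3; have l0 : 0 < lnr R n by apply: lnr_pos; move: n3; clear; lia.
have tE := expR_lln l0.
have lt : 1 + lln R n <= lnr R n by rewrite -tE expR_ge1Dx.
have t12 : 12 <= lln R n by lra.
have lt2 : 3 * lln R n + 2 <= lnr R n.
  rewrite -tE (_ : lln R n = 2 * (lln R n / 2)); last by lra.
  rewrite expRM_natl expr2; have := expR_ge1Dx (lln R n / 2) => hh.
  apply: le_trans (_ : (1 + lln R n / 2) * (1 + lln R n / 2) <= _); last first.
    by rewrite ler_pM //; clear -hh t12; lra.
  have : 12 * lln R n <= lln R n * lln R n by rewrite ler_wpM2r //; clear -t12; lra.
  by clear -t12; lra.
pose B := beta_ alpha * lnr R n + 3 / 2 * lln R n.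
have bl0 : 0 <= beta_ alpha * lnr R n by apply: mulr_ge0; [clear -b0; lra|exact: ltW].
have B0 : 0 <= B / alpha by apply: divr_ge0; [rewrite /B; clear -bl0 t12; lra|exact: ltW].
pose K := (Num.truncn (B / alpha)).+1.
have KB : B < alpha * K%:R.
  by rewrite mulrC -ltr_pdivrMr //; exact: truncnS_gt.
have KB1 : alpha * (K%:R - 1) <= B.
  rewrite mulrC -ler_pdivlMr // /K -natr1 addrK truncn_le //.
have bp : 0 < beta_ alpha by lra.
have KN : (0 < K)%N by [].
move: K KN KB KB1 => K KN KB KB1.
have b2 : beta_ alpha * lnr R n <= alpha * (lnr R n / 2).
  rewrite -[X in _ <= X * _]bm; have : beta_ alpha * lnr R n * 1 <= beta_ alpha * lnr R n * ((1 + alpha) / 2).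
    by apply: ler_wpM2l => //; clear -a1; lra.
  by clear; lra.
(* Needed to replace ln K by ln ln n in the barrier condition. *)
have Kl : K%:R <= lnr R n.
  rewrite -(ler_pM2l a0); have h1 : 3 / 2 * lln R n <= alpha * (3 / 2 * lln R n).
    by apply: ler_peMl; [clear -t12; lra|exact: ltW].
  have : alpha * (3 * lln R n + 2) <= alpha * lnr R n by rewrite ler_wpM2l // ltW.
  by move: KB1; rewrite /B; clear -h1 b2; lra.
have K00 : (K0 <= K)%N.
  rewrite -(ler_nat R) -(ler_pM2l a0); apply/ltW; apply: le_lt_trans KB.
  have : alpha * K0%:R * (1 + alpha) <= beta_ alpha * lnr R n * (1 + alpha).
    have : (1 + alpha) * K0%:R <= lnr R n by clear -tA lt q2 q3; lra.
    by move/(ler_wpM2l (ltW a0)); rewrite -[X in _ <= X * _ -> _]bm; clear; lra.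
  rewrite ler_pM2r; last by clear -a0; lra.
  by rewrite /B; clear -t12; lra.
have et : 2 * alpha <= eps * lln R n by rewrite [leRHS]mulrC -ler_pdivrMr //; lra.
have ma : (Num.truncn (delta * lln R n))%:R <= delta * lln R n.
  by rewrite truncn_le; apply: mulr_ge0; [exact: ltW|clear -t12; lra].
have {}ma : alpha * (Num.truncn (delta * lln R n))%:R <= eps / 2 * lln R n.
  by rewrite -dE -mulrA; apply: ler_wpM2l => //; exact: ltW.
have st : s0 <= lln R n by clear -tA q1 q2 q4; lra.
have [hm m2] := hs0 (lln R n) st.
move: (Num.truncn _) hm m2 ma => m.
have [p pE] : exists p : R, 2 ^+ m = p by exists (2 ^+ m).
rewrite pE => hm m2 ma.
have mE : measurable [set w | ((3 / 2 + eps) * lln R n < excess U alpha n w)%R].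
  exact: (measurable_excess alpha hU n (fun x => (3 / 2 + eps) * lln R n < x : Prop)).
apply: le_trans (hW 3%N K 0%N m _ (isT) K00 _ m2 mE _) _.
- by rewrite mul0r.
- move=> w n' J Ew n'0; rewrite addn0 -eqn_leq => /eqP <-.
  rewrite divff ?pnatr_eq0 -?lt0n // mulr1 => hb.
  have lK : lnr R K <= lln R n by rewrite ler_ln ?posrE ?ltr0n //.
  have lnn : lnr R n <= lnr R n'.
    rewrite -(ler_pM2l bp).
    exact: (lin_cancel (ltW bp) hb KB lK).
  have nn' : (n <= n')%N.
    by move: lnn; rewrite ler_ln ?posrE ?ltr0n ?ler_nat //; move: n3; clear; lia.
  apply: leq_trans (sat_level_mono _ _ nn').
  move: Ew; rewrite /= /excess; move: (sat_level (bst_tree U n w)) => q Ew.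
  rewrite -(ltr_nat R) natrD -(ltr_pM2l a0).
  by move: KB1 Ew et ma; rewrite /B; exact: level_cancel.
- rewrite lee_fin ler_expR subnn expr0 mulr1 expr1n mulr1 mulNr lerN2 pE.
  by move: hm; rewrite expr1; clear; lra.
Qed.


(** If the excess stays large from N on, no level of any window far out is late, even with m
    generations to spare. The probability of this is at most 1 / K for every large K. *)
Lemma excess_often_small (d : measure_display) (T : measurableType d) (R : realType)
    (P : probability T R) (U : nat -> T -> node) (alpha : R) :
  is_bst_process P U -> 0 < alpha -> 2 * (alpha + 1) * expR (- alpha) - 1 = 0 ->
  forall (eps : R) (N : nat), 0 < eps ->
  P [set w | forall n, (N <= n)%N -> ((1 / 2 + eps) * lln R n < excess U alpha n w)%R] = 0%E.
Proof.
move=> hU ha halpha eps N.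
move=> eps0; have a1 := alpha_gt1 ha halpha; have a0 := ha; have bm := beta_mul ha.
have /andP[b0 b1] := beta_itv ha halpha.
have [c [K0 [c0 hW]]] := window_prob_large hU ha halpha.
pose delta := eps / alpha.
have d0 : 0 < delta by rewrite divr_gt0 //; lra.
have dE : alpha * delta = eps by rewrite mulrC divfK // gt_eqF.
have [s0 hs0] := @pow_le_exp2 R 3 _ _ c0 d0.
set D := [set w | _].
have mD : measurable D.
  have -> : D = \bigcap_(n in setT) [set w | (N <= n)%N -> ((1 / 2 + eps) * lln R n < excess U alpha n w)%R].
    by apply/seteqP; split=> [w Dw n _|w Dw n]; [exact: Dw|exact: (Dw n I)].
  apply: bigcap_measurableType => n _.
  exact: (measurable_excess alpha hU n (fun x => (N <= n)%N -> (1 / 2 + eps) * lln R n < x : Prop)).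
pose K1 := (K0 + N + (Num.truncn (expR (1 + `|s0|))).+1)%N.
have hK K : (K1 <= K)%N -> (P D <= (K%:R^-1)%:E)%E.
  rewrite /K1 => K1K; have K0K : (K0 <= K)%N by move: K1K; clear; lia.
  have NK : (N <= K)%N by move: K1K; clear; lia.
  have eK : expR (1 + `|s0|) <= K%:R.
    apply/ltW; apply: lt_le_trans (truncnS_gt _) _.
    by rewrite ler_nat; apply: leq_trans K1K; rewrite leq_addl.
  have KR : 0 < K%:R :> R by apply: lt_le_trans eK; exact: expR_gt0.
  have sK : 1 + `|s0| <= lnr R K by rewrite -ler_expR lnK.
  have s1 : 1 <= lnr R K by apply: le_trans sK; rewrite lerDl.
  have ss : s0 <= lnr R K by apply: le_trans (ler_norm _) _; lra.
  have sKK : lnr R K + 1 <= K%:R.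
    by rewrite -[leRHS](@lnK _ (K%:R : R)) ?posrE // addrC expR_ge1Dx.
  (* The widest window for which the tilt varies by a bounded factor. It makes (M + 1) / K at least
     1 / ln K, and the loss (ln K)^(-2) is recovered from c 2^m >= (ln K)^3. *)
  pose M := Num.truncn (K%:R / lnr R K).
  have K_s : 0 <= K%:R / lnr R K by rewrite divr_ge0 ?ltW //; lra.
  have MK : M%:R * lnr R K <= K%:R by rewrite -ler_pdivlMr ?truncn_le //; lra.
  have MS : K%:R / lnr R K <= M.+1%:R by apply/ltW; exact: truncnS_gt.
  have ma : (Num.truncn (delta * lnr R K))%:R <= delta * lnr R K.
    by rewrite truncn_le; apply: mulr_ge0; [exact: ltW|clear -s1; lra].
  have {}ma : alpha * (Num.truncn (delta * lnr R K))%:R <= eps * lnr R K.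
    by rewrite -dE -mulrA; apply: ler_wpM2l => //; exact: ltW.
  have [hm m2] := hs0 _ ss.
  move: (Num.truncn (delta * _)) hm m2 ma => m hm m2 ma.
  apply: le_trans (hW 1%N K M m D isT K0K MK m2 mD _) _.
    move=> w n J Dw n0 /andP[KJ JM] hb.
    have jj : lnr R K * (J%:R / K%:R) <= lnr R K + 1.
      rewrite mulrA ler_pdivrMr //; have : J%:R <= K%:R + M%:R :> R by rewrite -natrD ler_nat.
      have sp : 0 <= lnr R K by lra.
      move=> /(ler_wpM2l sp) hh; apply: le_trans hh _.
      by rewrite mulrDr mulrDl mul1r lerD2l mulrC.
    have KJ' : K%:R <= J%:R :> R by rewrite ler_nat.
    have ln_K : K%:R <= lnr R n := @late_time_ge R alpha (beta_ alpha) _ _ _ _ _ s1 a1 b0 bm KJ' jj hb sKK.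
    have nN : (N <= n)%N.
      apply: leq_trans NK _; rewrite -(ler_nat R); apply: le_trans ln_K _.
      have : 0 < n%:R :> R by rewrite ltr0n.
      by move=> nR; have := ln_sublinear nR; exact: ltW.
    have lK : lnr R K <= lln R n.
      by rewrite ler_ln ?posrE //; apply: lt_le_trans ln_K.
    have := Dw n nN; rewrite /excess; move: (sat_level (bst_tree U n w)) => q hq.
    rewrite -(ltr_nat R) natrD -(ltr_pM2l a0).
    exact: (late_level_gt eps0 b0 jj hb lK hq ma).
  rewrite lee_fin -[leRHS]lnK ?posrE ?invr_gt0 // lnV ?posrE // ler_expR lerN2.
  have -> : ((3 - 1) = 2)%N by [].
  rewrite isq_sqr; set X := M.+1%:R * _.
  have hX : (lnr R K)^-1 <= X.
    by rewrite /X -ler_pdivrMr ?invr_gt0 // invrK mulrC.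
  have hX2 : (lnr R K)^-1 ^+ 2 <= X ^+ 2.
    have i0 : 0 <= (lnr R K)^-1 by rewrite invr_ge0; lra.
    by rewrite lerXn2r ?nnegrE //; apply: le_trans hX.
  apply: le_trans (_ : (lnr R K)^-1 ^+ 2 * (c * 2 ^+ m) <= _); last first.
    by rewrite [c * _ * _]mulrAC [leRHS]mulrC; apply: ler_wpM2r => //; rewrite mulr_ge0 ?ltW // exprn_gt0.
  apply: le_trans (_ : (lnr R K)^-1 ^+ 2 * lnr R K ^+ 3 <= _); last first.
    by apply: ler_wpM2l => //; rewrite sqr_ge0.
  by rewrite exprVn [_ ^+ 3]exprS mulrCA mulVf ?mulr1 // expf_neq0 // gt_eqF //; lra.
apply/eqP; rewrite -measure_le0; apply/lee_addgt0Pr => e e0; rewrite add0e.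
pose K := (K1 + (Num.truncn e^-1).+1)%N.
apply: le_trans (hK K (leq_addr _ _)) _; rewrite lee_fin.
have ei : e^-1 <= K%:R.
  by apply/ltW; apply: lt_le_trans (truncnS_gt _) _; rewrite ler_nat leq_addl.
rewrite -[leRHS]invrK lef_pV2 ?posrE ?invr_gt0 //.
by apply: lt_le_trans ei; rewrite invr_gt0.
Qed.

(** * Almost sure limits *)

Section LimitValues.
Context (R : realType).
Implicit Types u x t : nat -> R.

Lemma limn_esup_eqP u (l : R) :
  (forall e, 0 < e -> exists N, forall n, (N <= n)%N -> u n <= l + e) ->
  (forall e N, 0 < e -> exists2 n, (N <= n)%N & l - e <= u n) ->
  limn_esup (fun n => (u n)%:E) = l%:E.
Proof.
move=> hub hlb; apply/eqP; rewrite eq_le; apply/andP; split.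
- apply/lee_addgt0Pr => e e0; have [N hN] := hub e e0.
  apply: le_trans (_ : ereal_sup [set (u n)%:E | n in [set n | (N <= n)%N]] <= _)%E.
    by apply: ereal_inf_lbound; exists [set n | (N <= n)%N] => //; exists N.
  by apply: ge_ereal_sup => _ [n /= Nn <-]; rewrite -EFinD lee_fin; exact: hN.
- apply: le_ereal_inf_tmp => _ [V [N _ NV] <-].
  apply/lee_addgt0Pr => e e0; have [n Nn hn] := hlb e N e0.
  rewrite -leeBlDr //; apply: le_trans (_ : (u n)%:E <= _)%E.
    by rewrite -EFinB lee_fin.
  by apply: ereal_sup_ubound; exists n => //; apply: NV.
Qed.

Lemma limn_einf_eqP u (l : R) :
  (forall e, 0 < e -> exists N, forall n, (N <= n)%N -> l - e <= u n) ->
  (forall e N, 0 < e -> exists2 n, (N <= n)%N & u n <= l + e) ->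
  limn_einf (fun n => (u n)%:E) = l%:E.
Proof.
move=> hlb hub; rewrite -[LHS]oppeK -limn_esupN.
rewrite [X in limn_esup X](_ : _ = (fun n => (- u n)%:E)) //.
rewrite (@limn_esup_eqP (fun n => - u n) (- l)) ?EFinN ?oppeK // => [e e0|e N e0].
  by have [N hN] := hlb e e0; exists N => n /hN; lra.
by have [n Nn hn] := hub e N e0; exists n => //; lra.
Qed.

(** Tolerances 1 / (k + 1) make each hypothesis a countable family of events, so that the almost
    sure statements can be intersected. *)
Lemma ratio_limits x t (a b : R) :
  (exists N, forall n, (N <= n)%N -> 0 < t n) ->
  (forall k, exists N, forall n, (N <= n)%N -> (a - k.+1%:R^-1) * t n <= x n) ->
  (forall k, exists N, forall n, (N <= n)%N -> x n <= (b + k.+1%:R^-1) * t n) ->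
  (forall k N, exists2 n, (N <= n)%N & (b - k.+1%:R^-1) * t n <= x n) ->
  (forall k N, exists2 n, (N <= n)%N & x n <= (a + k.+1%:R^-1) * t n) ->
  limn_einf (fun n => (x n / t n)%:E) = a%:E /\ limn_esup (fun n => (x n / t n)%:E) = b%:E.
Proof.
move=> [N0 t0] hA hB hC hD.
have small (e : R) : 0 < e -> exists k, k.+1%:R^-1 <= e.
  move=> e0; exists (Num.truncn e^-1); rewrite invf_ple ?posrE ?ltr0n //.
  by apply/ltW; exact: truncnS_gt.
split; [apply: limn_einf_eqP => [e e0|e N e0]|apply: limn_esup_eqP => [e e0|e N e0]].
- have [k ke] := small e e0; have [N hN] := hA k; exists (maxn N0 N) => n.
  rewrite geq_max => /andP[/t0 tn /hN hn]; rewrite ler_pdivlMr //.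
  by apply: le_trans hn; rewrite ler_pM2r // lerD2l lerN2.
- have [k ke] := small e e0; have [n] := hD k (maxn N0 N).
  rewrite geq_max => /andP[/t0 tn Nn] hn; exists n => //; rewrite ler_pdivrMr //.
  by apply: le_trans hn _; rewrite ler_pM2r // lerD2l.
- have [k ke] := small e e0; have [N hN] := hB k; exists (maxn N0 N) => n.
  rewrite geq_max => /andP[/t0 tn /hN hn]; rewrite ler_pdivrMr //.
  by apply: le_trans hn _; rewrite ler_pM2r // lerD2l.
- have [k ke] := small e e0; have [n] := hC k (maxn N0 N).
  rewrite geq_max => /andP[/t0 tn Nn] hn; exists n => //; rewrite ler_pdivlMr //.
  by apply: le_trans hn; rewrite ler_pM2r // lerD2l lerN2.
Qed.

End LimitValues.

(** * Borel-Cantelli along powers of 2 *)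

Section DyadicBorelCantelli.
Context (d : measure_display) (T : measurableType d) (R : realType).
Variable P : probability T R.

(** Integral comparison for the series of j^(-(1 + delta)), in telescoping form. *)
Lemma expR_lnr_telescope (delta : R) j : 0 < delta -> (0 < j)%N ->
  expR (- (1 + delta) * lnr R j.+1) <=
  delta^-1 * (expR (- delta * lnr R j) - expR (- delta * lnr R j.+1)).
Proof.
move=> d0 j0; have hu := lnr_step_lb R j0.
rewrite -(ler_pM2l d0) mulrA divff ?gt_eqF // mul1r.
have -> : expR (- delta * lnr R j) =
    expR (- delta * lnr R j.+1) * expR (delta * (lnr R j.+1 - lnr R j)).
  by rewrite -expRD; congr expR; ring.
have -> : - (1 + delta) * lnr R j.+1 = - delta * lnr R j.+1 - lnr R j.+1 by ring.
rewrite expRD expRN lnK ?posrE ?ltr0n //.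
rewrite mulrCA -[X in _ <= _ - X]mulr1 -mulrBr ler_wpM2l ?expR_ge0 //.
apply: le_trans (_ : delta * (lnr R j.+1 - lnr R j) <= _).
  by rewrite ler_wpM2l // ltW.
by rewrite lerBrDl expR_ge1Dx.
Qed.

Lemma sum_expR_lnr_le (delta : R) j n : 0 < delta -> (0 < j)%N ->
  \sum_(0 <= k < n) expR (- (1 + delta) * lnr R (k + j).+1) <= delta^-1.
Proof.
move=> d0 j0; have di : 0 <= delta^-1 by rewrite invr_ge0 ltW.
have l0 i : (0 < i)%N -> 0 <= delta * lnr R i.
  by move=> i0; rewrite mulr_ge0 ?(ltW d0) // ln_ge0 // ler1n.
suff h : \sum_(0 <= k < n) expR (- (1 + delta) * lnr R (k + j).+1) <=
    delta^-1 * (expR (- delta * lnr R j) - expR (- delta * lnr R (n + j))).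
  apply: le_trans h _; rewrite ler_piMr // lerBlDr.
  apply: le_trans (_ : 1 <= _); last by rewrite lerDl expR_ge0.
  by rewrite mulNr -expR0 ler_expR oppr_le0 l0.
elim: n => [|n IH]; first by rewrite big_nil add0n subrr mulr0.
rewrite big_nat_recr //=; apply: le_trans (lerD IH (expR_lnr_telescope d0 _)) _.
  by rewrite addn_gt0 j0 orbT.
by rewrite -mulrDr addrA subrK addSn.
Qed.

Lemma lln_dyadic j : (0 < j)%N -> lln R (2 ^ j) = lnr R j + ln (ln 2).
Proof.
move=> j0; have l2 : 0 < ln 2 :> R by rewrite ln_gt0 // ltr1n.
by rewrite /lln /lnr natrX lnXn // -[_ *+ j]mulr_natl lnM ?posrE ?ltr0n.
Qed.

(** ln ln 2^j = ln j + ln ln 2, so the bound is a constant times j^(-(1 + delta)) along n = 2^j. *)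
Lemma dyadic_borel_cantelli (E : nat -> set T) (C delta : R) n0 :
  (forall n, measurable (E n)) -> 0 <= C -> 0 < delta ->
  (forall n, (n0 <= n)%N -> (P (E n) <= (C * expR (- (1 + delta) * lln R n))%:E)%E) ->
  {ae P, forall w, exists j0, forall j, (j0 <= j)%N -> ~ E (2 ^ j)%N w}.
Proof.
move=> mE C0 d0 hE.
pose F k := E (2 ^ (k + n0.+1).+1)%N.
have mF k : measurable (F k) by exact: mE.
pose D := C * expR (- (1 + delta) * ln (ln 2)).
have D0 : 0 <= D by rewrite mulr_ge0 ?expR_ge0.
have hF k : (P (F k) <= (D * expR (- (1 + delta) * lnr R (k + n0.+1).+1))%:E)%E.
  apply: le_trans (hE _ _) _.
    by apply: leq_trans (ltnW (ltn_expl _ (isT : (1 < 2)%N))); clear; lia.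
  by rewrite lee_fin lln_dyadic // mulrDr expRD /D mulrAC mulrA.
have sF : (\big[+%E/0%R]_(0 <= n <oo) P (F n) < +oo)%E.
  apply: le_lt_trans (ltry (D * delta^-1)).
  apply: lime_le; first exact: is_cvg_nneseries.
  near=> n; apply: le_trans (lee_sum _ (fun k _ => hF k)) _.
  by rewrite sumEFin lee_fin -mulr_sumr ler_wpM2l // sum_expR_lnr_le.
have := lim_sup_set_cvg0 mF sF => h0.
exists (lim_sup_set F); split => //.
  by apply: bigcap_measurableType => n _; exact: bigcup_measurable.
move=> w /= hw; apply/not_notP => hn; apply: hw.
have [n nF] : exists n, forall k, (n <= k)%N -> ~ F k w.
  move/existsNP: hn => [n hn]; exists n => k nk Fk; apply: hn => _; by exists k.
exists (n + n0.+2)%N => j nj; have := nF (j - n0.+2)%N; rewrite /F.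
have -> : ((j - n0.+2 + n0.+1).+1 = j)%N by move: nj; clear; lia.
by apply; move: nj; clear; lia.
Unshelve. all: by end_near.
Qed.

End DyadicBorelCantelli.

(** * Transfer from dyadic times, and the four almost sure bounds *)

Section AlmostSure.
Context (d : measure_display) (T : measurableType d) (R : realType).
Variables (P : probability T R) (U : nat -> T -> node) (alpha : R).
Hypotheses (hU : is_bst_process P U) (ha : 0 < alpha).
Hypothesis halpha : 2 * (alpha + 1) * expR (- alpha) - 1 = 0.
Local Notation beta := (beta_ alpha).
Local Notation V := (excess U alpha).
Local Notation t := (lln R).

Lemma dyadic_step j n : (0 < j)%N -> (2 ^ j <= n)%N -> (n <= 2 ^ j.+1)%N ->
  [/\ t n <= t (2 ^ j) + 1, t (2 ^ j.+1) <= t n + 1,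
    lnr R n <= lnr R (2 ^ j) + 1 & lnr R (2 ^ j.+1) <= lnr R n + 1].
Proof.
move=> j0 jn nj; have l2 : 0 < ln 2 :> R by rewrite ln_gt0 // ltr1n.
have l21 : ln 2 <= 1 :> R by have := @le_ln1Dx R 1 ltac:(lra); rewrite -natr1; lra.
have p0 i : (0 < 2 ^ i)%N by rewrite expn_gt0.
have n0 : (0 < n)%N by apply: leq_trans jn.
have e1 : lnr R (2 ^ j.+1) = lnr R (2 ^ j) + ln 2.
  by rewrite expnS /lnr natrM lnM ?posrE ?ltr0n // addrC.
have h1 := lnr_le R (p0 j) jn; have h2 := lnr_le R n0 nj.
have lj : ln 2 <= lnr R (2 ^ j).
  by rewrite /lnr ler_ln ?posrE ?ltr0n // ler_nat -{1}(expn1 2) leq_exp2l.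
have mul2 (x y : R) : ln 2 <= y -> x <= 2 * y -> 0 < x -> ln x <= ln y + 1.
  move=> y0 xy x0; have yp : 0 < y by lra.
  apply: le_trans (_ : ln (2 * y) <= _); first by rewrite ler_ln ?posrE //; lra.
  by rewrite lnM ?posrE // [ln 2 + _]addrC lerD2l.
by split; [apply: mul2; lra|apply: mul2; lra|lra|lra].
Qed.

Lemma dyadic_index n k : (2 ^ k <= n)%N -> exists j, [/\ (k <= j)%N, (2 ^ j <= n)%N & (n <= 2 ^ j.+1)%N].
Proof.
move=> kn; have n0 : (0 < n)%N by apply: leq_trans kn; rewrite expn_gt0.
have /andP[h1 h2] := trunc_log_bounds (isT : (1 < 2)%N) n0.
exists (trunc_log 2 n); split => //; last exact: ltnW.
by rewrite -ltnS -(ltn_exp2l _ _ (isT : (1 < 2)%N)); exact: leq_ltn_trans h2.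
Qed.

(** The saturation level never decreases, so the excess falls by at most beta <= 1 while ln n grows
    by at most 1. *)
Lemma excess_step n m w : (n <= m)%N -> lnr R m <= lnr R n + 1 -> V n w <= V m w + 1.
Proof.
have /andP[b0 b1] := beta_itv ha halpha.
move=> nm hl; rewrite /excess.
have : alpha * (sat_level (bst_tree U n w))%:R <= alpha * (sat_level (bst_tree U m w))%:R.
  by rewrite ler_pM2l // ler_nat sat_level_mono.
have : beta * (lnr R m - lnr R n) <= beta * 1 by rewrite ler_wpM2l //; lra.
by move: (alpha * _) (alpha * _) => u v; lra.
Qed.

Lemma excess_ge_of_dyadic (a e : R) w : 0 <= a -> 0 < e ->
  (exists j0, forall j, (j0 <= j)%N -> a * t (2 ^ j)%N <= V (2 ^ j)%N w) ->
  exists N, forall n, (N <= n)%N -> (a - e) * t n <= V n w.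
Proof.
(* Passing from 2^j to n costs a for the change of ln ln and 1 for the excess; e ln ln n covers a +
   1. *)
move=> a0 e0 [j0 hj]; have [n0 hn0] := lln_large ((a + 1) / e).
exists (maxn n0 (2 ^ j0.+1)) => n; rewrite geq_max => /andP[/hn0[tn _] nj].
have [j [jj jn nj']] := dyadic_index nj.
have [h1 _ h3 _] := dyadic_step (leq_trans (ltn0Sn _) jj) jn nj'.
have h5 := hj j (ltnW jj); have h6 := excess_step w jn h3.
have h7 : a * t n <= a * (t (2 ^ j) + 1) by rewrite ler_wpM2l.
rewrite ler_pdivrMr // in tn.
by move: h5 h6 h7 tn; move: (V _ _) (V _ _) (t (2 ^ j)%N) (t n) => u v x y; lra.
Qed.

Lemma excess_le_of_dyadic (a e : R) w : 0 <= a -> 0 < e ->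
  (exists j0, forall j, (j0 <= j)%N -> V (2 ^ j)%N w <= a * t (2 ^ j)%N) ->
  exists N, forall n, (N <= n)%N -> V n w <= (a + e) * t n.
Proof.
move=> a0 e0 [j0 hj]; have [n0 hn0] := lln_large ((a + 1) / e).
exists (maxn n0 (2 ^ j0.+1)) => n; rewrite geq_max => /andP[/hn0[tn _] nj].
have [j [jj jn nj']] := dyadic_index nj.
have [_ h1 _ h3] := dyadic_step (leq_trans (ltn0Sn _) jj) jn nj'.
have h5 := hj j.+1 (leqW (ltnW jj)); have h6 := excess_step w nj' h3.
have h7 : a * t (2 ^ j.+1)%N <= a * (t n + 1) by rewrite ler_wpM2l.
rewrite ler_pdivrMr // in tn.
by move: h5 h6 h7 tn; move: (V _ _) (V _ _) (t (2 ^ j.+1)%N) (t n) => u v x y; lra.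
Qed.

Lemma excess_upper_exp (e : R) : 0 < e <= 1 / 2 -> exists (C : R) n0, 0 <= C /\
  forall n a, (n0 <= n)%N -> 0 <= a <= 3 / 2 ->
  (P [set w | (V n w <= a * t n)%R] <= (C * expR ((a - 3 / 2 + e) * t n))%:E)%E.
Proof.
move=> /andP[e0 e1]; have [C [n0 [C0 hC]]] := excess_upper hU ha halpha.
have [s0 hs0] := @pow_le_expR R 4 1 e ltr01 e0; have [n1 hn1] := lln_large (`|s0|).
exists (2 * C), (maxn n0 n1); split; first by rewrite mulr_ge0.
move=> n a; rewrite geq_max => /andP[nn0 /hn1[tn _]] a03.
have /andP[a0 a3] := a03.
apply: le_trans (hC n a nn0 a03) _; rewrite lee_fin -[leRHS]mulrA [leRHS]mulrCA; apply: ler_wpM2l => //.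
have s0t : s0 <= t n by apply: le_trans tn; exact: ler_norm.
have t0 : 0 <= t n by apply: le_trans tn; exact: normr_ge0.
have h1 : t n ^+ 4 * expR ((a - 3 / 2) * t n) <= expR ((a - 3 / 2 + e) * t n).
  rewrite [(a - 3 / 2 + e) * _]mulrDl expRD [leRHS]mulrC ler_wpM2r ?expR_ge0 //.
  by have := hs0 _ s0t; rewrite mul1r.
have h2 : expR (-2 * t n) <= expR ((a - 3 / 2 + e) * t n).
  by rewrite ler_expR ler_wpM2r //; lra.
by rewrite [leRHS]mulr_natl [leRHS]mulr2n; apply: lerD.
Qed.

Lemma expR_lln_small (C delta e : R) : 0 <= C -> 0 < delta -> 0 < e ->
  exists n0, forall n, (n0 <= n)%N -> C * expR (- delta * t n) <= e.
Proof.
move=> C0 d0 e0; have [n0 hn0] := lln_large (C / e / delta).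
exists n0 => n /hn0[tn _]; rewrite mulNr expRN ler_pdivrMr ?expR_gt0 // mulrC -ler_pdivrMr //.
apply: le_trans (_ : delta * t n <= _); first by rewrite [leRHS]mulrC -ler_pdivrMr.
by have := expR_ge1Dx (delta * t n); lra.
Qed.

Lemma excess_eventually_ge (e : R) : 0 < e <= 1 / 4 ->
  {ae P, forall w, exists N, forall n, (N <= n)%N -> (1 / 2 - 2 * e) * t n <= V n w}.
Proof.
move=> /andP[e0 e1]; have e20 : 0 < e / 2 <= 1 / 2 by apply/andP; split; lra.
have [C [n0 [C0 hC]]] := excess_upper_exp e20.
have mE n : measurable [set w | (V n w <= (1 / 2 - e) * t n)%R].
  exact: (measurable_excess alpha hU n (fun x => x <= (1 / 2 - e) * t n : Prop)).
have hP n : (n0 <= n)%N ->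
    (P [set w | (V n w <= (1 / 2 - e) * t n)%R] <= (C * expR (- (1 + e / 2) * t n))%:E)%E.
  move=> nn; apply: le_trans (hC n (1 / 2 - e) nn _) _; first by apply/andP; split; lra.
  by rewrite lee_fin (_ : 1 / 2 - e - 3 / 2 + e / 2 = - (1 + e / 2)) //; lra.
have e2 : 0 < e / 2 by lra.
apply: filterS (dyadic_borel_cantelli mE C0 e2 hP) => w [j0 hj].
have -> : 1 / 2 - 2 * e = 1 / 2 - e - e by lra.
apply: excess_ge_of_dyadic => //; first by lra.
by exists j0 => j /hj /negP; rewrite -ltNge => /ltW.
Qed.

Lemma excess_eventually_le (e : R) : 0 < e ->
  {ae P, forall w, exists N, forall n, (N <= n)%N -> V n w <= (3 / 2 + 2 * e) * t n}.
Proof.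
move=> e0; have [n0 hC] := excess_lower hU ha halpha e0.
have mE n : measurable [set w | ((3 / 2 + e) * t n < V n w)%R].
  exact: (measurable_excess alpha hU n (fun x => (3 / 2 + e) * t n < x : Prop)).
have hP n : (n0 <= n)%N ->
    (P [set w | ((3 / 2 + e) * t n < V n w)%R] <= (1 * expR (- (1 + 1) * t n))%:E)%E.
  by move=> nn; rewrite mul1r; exact: hC.
apply: filterS (dyadic_borel_cantelli mE ler01 ltr01 hP) => w [j0 hj].
have -> : 3 / 2 + 2 * e = 3 / 2 + e + e by lra.
apply: excess_le_of_dyadic => //; first by lra.
by exists j0 => j /hj /negP; rewrite -leNgt.
Qed.

(** The event that the excess stays below (3/2 - e) ln ln n from N on lies in each of its instances
    n >= N, whose probabilities tend to 0. *)
Lemma excess_often_ge (e : R) N : 0 < e <= 1 / 2 ->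
  {ae P, forall w, exists2 n, (N <= n)%N & (3 / 2 - e) * t n <= V n w}.
Proof.
move=> /andP[e0 e1]; have e20 : 0 < e / 2 <= 1 / 2 by apply/andP; split; lra.
have [C [n0 [C0 hC]]] := excess_upper_exp e20.
set D := [set w | forall n, (N <= n)%N -> (V n w <= (3 / 2 - e) * t n)%R].
have mD : measurable D.
  have -> : D = \bigcap_(n in setT) [set w | (N <= n)%N -> (V n w <= (3 / 2 - e) * t n)%R].
    by apply/seteqP; split=> [w Dw n _|w Dw n]; [exact: Dw|exact: (Dw n I)].
  apply: bigcap_measurableType => n _.
  exact: (measurable_excess alpha hU n (fun x => (N <= n)%N -> x <= (3 / 2 - e) * t n : Prop)).
exists D; split => //.
  apply/eqP; rewrite -measure_le0; apply/lee_addgt0Pr => x x0; rewrite add0e.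
  have [n1 hn1] := @expR_lln_small C (e / 2) x C0 ltac:(lra) x0.
  pose n := maxn N (maxn n0 n1).
  have nN : (N <= n)%N by rewrite leq_maxl.
  have nn0 : (n0 <= n)%N by rewrite /n maxnCA leq_maxl.
  have nn1 : (n1 <= n)%N by rewrite /n maxnA leq_maxr.
  apply: le_trans (_ : (P [set w | (V n w <= (3 / 2 - e) * t n)%R] <= _)%E).
    apply: le_measure; rewrite ?inE //; last by move=> w; apply.
    exact: (measurable_excess alpha hU n (fun x => x <= (3 / 2 - e) * t n : Prop)).
  apply: le_trans (hC n (3 / 2 - e) nn0 _) _; first by apply/andP; split; lra.
  rewrite lee_fin (_ : 3 / 2 - e - 3 / 2 + e / 2 = - (e / 2)); last by lra.
  exact: hn1.
move=> w /= hw n nN; rewrite leNgt; apply/negP => hlt; apply: hw.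
by exists n => //; exact: ltW.
Qed.

Lemma excess_often_le (e : R) N : 0 < e ->
  {ae P, forall w, exists2 n, (N <= n)%N & V n w <= (1 / 2 + e) * t n}.
Proof.
move=> e0; have h0 := excess_often_small hU ha halpha N e0.
set D := [set w | _] in h0.
have mD : measurable D.
  have -> : D = \bigcap_(n in setT) [set w | (N <= n)%N -> ((1 / 2 + e) * t n < V n w)%R].
    by apply/seteqP; split=> [w Dw n _|w Dw n]; [exact: Dw|exact: (Dw n I)].
  apply: bigcap_measurableType => n _.
  exact: (measurable_excess alpha hU n (fun x => (N <= n)%N -> (1 / 2 + e) * t n < x : Prop)).
exists D; split => // w /= hw n nN; rewrite ltNge; apply/negP => hle; apply: hw.
by exists n.
Qed.

Lemma excess_in_probability (e : R) : 0 < e ->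
  (fun n => P [set w | (e <= `|V n w / t n - 3 / 2|)%R]) @ \oo --> 0%E.
Proof.
(* Capping at 1 keeps 3/2 - f within the range [0, 3/2] and f / 2 within (0, 1/2], as
   [excess_upper_exp] requires. *)
move=> e0; pose f : R := Num.min e 1.
have f0 : 0 < f by rewrite lt_min e0 ltr01.
have fe : f <= e by rewrite ge_min lexx.
have f1 : f <= 1 by rewrite ge_min lexx orbT.
have mA n : measurable [set w | (e <= `|V n w / t n - 3 / 2|)%R].
  exact: (measurable_excess alpha hU n (fun x => e <= `|x / t n - 3 / 2| : Prop)).
have mB n : measurable [set w | (V n w <= (3 / 2 - f) * t n)%R].
  exact: (measurable_excess alpha hU n (fun x => x <= (3 / 2 - f) * t n : Prop)).
have mC n : measurable [set w | ((3 / 2 + f / 2) * t n < V n w)%R].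
  exact: (measurable_excess alpha hU n (fun x => (3 / 2 + f / 2) * t n < x : Prop)).
have f20 : 0 < f / 2 <= 1 / 2 by apply/andP; split; lra.
have [f2 _] := andP f20.
have [C [n0 [C0 hC]]] := excess_upper_exp f20.
have [n1 hn1] := excess_lower hU ha halpha f2.
have [n2 hn2] := lln_large (1 : R).
apply/fine_cvgP; split; first by near=> n; exact: fin_num_measure.
apply/cvgr0Pnorm_le => x x0; have x20 : 0 < x / 2 by lra.
have [n3 hn3] := expR_lln_small C0 f2 x20.
have [n4 hn4] := @expR_lln_small 1 2 (x / 2) ler01 (ltr0n _ _) x20.
near=> n.
have nn0 : (n0 <= n)%N by near: n; exact: nbhs_infty_ge.
have nn1 : (n1 <= n)%N by near: n; exact: nbhs_infty_ge.
have nn2 : (n2 <= n)%N by near: n; exact: nbhs_infty_ge.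
have nn3 : (n3 <= n)%N by near: n; exact: nbhs_infty_ge.
have nn4 : (n4 <= n)%N by near: n; exact: nbhs_infty_ge.
have [t1 _] := hn2 n nn2.
rewrite /= ger0_norm ?fine_ge0 // -lee_fin fineK ?fin_num_measure //.
apply: le_trans (_ : (P ([set w | (V n w <= (3 / 2 - f) * t n)%R] `|`
   [set w | ((3 / 2 + f / 2) * t n < V n w)%R]) <= _)%E).
  apply: le_measure; rewrite ?inE //; first exact: measurableU.
  move=> w /= hw; have t0 : 0 < t n by lra.
  have vE : V n w = V n w / t n * t n by rewrite divfK // gt_eqF.
  have [vl|vl] := leP (V n w / t n) (3 / 2 - f).
    by left; rewrite vE ler_wpM2r // ltW.
  right; rewrite vE ltr_pM2r //.
  by move: hw vl; move: (V n w / t n) => z; case: (ger0P (z - 3 / 2)) => *; lra.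
apply: le_trans (measureU2 _ (mB n) (mC n)) _.
apply: le_trans (leeD (hC n (3 / 2 - f) nn0 _) (hn1 n nn1)) _.
  by apply/andP; split; lra.
rewrite lee_fin (_ : 3 / 2 - f - 3 / 2 + f / 2 = - (f / 2)); last by lra.
by have := hn3 n nn3; have := hn4 n nn4; rewrite mul1r; lra.
Unshelve. all: by end_near.
Qed.

End AlmostSure.

Theorem theorem2 (d : measure_display) (T : measurableType d) (R : realType)
    (P : probability T R) (U : nat -> T -> node)
    (hU : is_bst_process P U)
    (alpha beta : R) (ha : 0 < alpha)
    (halpha : 2 * (alpha + 1) * expR (- alpha) - 1 = 0)
    (hbeta : beta = 2 * alpha * expR (- alpha)) :
  let Z := fun (n : nat) (w : T) =>
    (alpha * (sat_level (bst_tree U n w))%:R - beta * ln (n%:R : R))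
      / ln (ln (n%:R : R)) in
  {ae P, forall w,
     limn_einf (fun n => (Z n w)%:E) = (1 / 2 : R)%:E /\
     limn_esup (fun n => (Z n w)%:E) = (3 / 2 : R)%:E} /\
  (forall eps : R, 0 < eps ->
     (fun n => P [set w | eps <= `|Z n w - 3 / 2|]) @ \oo --> 0%E).
Proof.
have bE : beta = beta_ alpha by rewrite hbeta; exact: betaE.
rewrite bE => Z; split; last by move=> eps; exact: excess_in_probability.
(* The shift by 4 keeps e k within the bound 1/4 of [excess_eventually_ge], and the 2 in the
   denominator offsets the loss 2 * e in the transfer from dyadic times. *)
pose e k : R := (k.+4%:R)^-1 / 2.
have e0 k : 0 < e k by rewrite divr_gt0 ?invr_gt0 ?ltr0n.
have e4 k : k.+4%:R^-1 <= 1 / 4 :> R by rewrite div1r lef_pV2 ?posrE ?ltr0n // ler_nat.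
have ek k : 2 * e k <= k.+1%:R^-1.
  rewrite mulrC divfK ?pnatr_eq0 // lef_pV2 ?posrE ?ltr0n // ler_nat.
  by clear; lia.
have [n0 hn0] := lln_large (1 : R).
have tpos n : (n0 <= n)%N -> 0 < lln R n by move=> /hn0[h _]; apply: lt_le_trans h.
have h1 : {ae P, forall w, forall k, exists N, forall n, (N <= n)%N ->
    (1 / 2 - 2 * e k) * lln R n <= excess U alpha n w}.
  apply: ae_foralln => k; apply: (excess_eventually_ge hU ha halpha).
  by rewrite e0 /=; move: (e4 k) (e0 k); rewrite /e; move: (_^-1) => z; lra.
have h2 : {ae P, forall w, forall k, exists N, forall n, (N <= n)%N ->
    excess U alpha n w <= (3 / 2 + 2 * e k) * lln R n}.
  by apply: ae_foralln => k; exact: (excess_eventually_le hU ha halpha).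
have h3 : {ae P, forall w, forall k N, exists2 n, (N <= n)%N &
    (3 / 2 - e k) * lln R n <= excess U alpha n w}.
  apply: ae_foralln => k; apply: ae_foralln => N; apply: (excess_often_ge hU ha halpha).
  by rewrite e0 /=; move: (e4 k) (e0 k); rewrite /e; move: (_^-1) => z; lra.
have h4 : {ae P, forall w, forall k N, exists2 n, (N <= n)%N &
    excess U alpha n w <= (1 / 2 + e k) * lln R n}.
  by apply: ae_foralln => k; apply: ae_foralln => N; exact: (excess_often_le hU ha halpha).
apply: filterS (filterI (filterI h1 h2) (filterI h3 h4)) => w [[w1 w2] [w3 w4]].
have ek1 k : e k <= k.+1%:R^-1 by apply: le_trans (ek k); move: (e0 k); lra.
apply: (@ratio_limits R (fun n => excess U alpha n w) (lln R)).
- by exists n0.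
- move=> k; have [N hN] := w1 k; exists (maxn n0 N) => n; rewrite geq_max => /andP[/tpos tn /hN].
  by apply: le_trans; rewrite ler_pM2r // lerD2l lerN2.
- move=> k; have [N hN] := w2 k; exists (maxn n0 N) => n; rewrite geq_max => /andP[/tpos tn /hN hn].
  by apply: le_trans hn _; rewrite ler_pM2r // lerD2l.
- move=> k N; have [n] := w3 k (maxn n0 N); rewrite geq_max => /andP[/tpos tn Nn] hn.
  by exists n => //; apply: le_trans hn; rewrite ler_pM2r // lerD2l lerN2.
- move=> k N; have [n] := w4 k (maxn n0 N); rewrite geq_max => /andP[/tpos tn Nn] hn.
  by exists n => //; apply: le_trans hn _; rewrite ler_pM2r // lerD2l.
Qed.
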